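(* A closed subspace $N$ of $H_E^2\oplus H_F^2$ is an invariant subspace of $S_E\oplus S_F^*$ if and only if $$N=\ker(W_\Psi)\cap\left(\Theta H_{E_1}^2\oplus H_F^2\right)$$ for some $\Psi\in\Lambda_{E\oplus F}^\infty$ which is zero or partial isometry-valued (i.e. $\Psi(z)^*\Psi(z)=I_{E_0}$ for a.e. $z\in\mathbb T$, for some $E_0\subset E\oplus F$), and some $\Theta\in H^\infty_{B(E_1,E)}$, $E_1\subset E$, which is zero or left inner and right extremal.
   Context: $E$ and $F$ are complex separable Hilbert spaces; subspaces such as $E_0\subset E\oplus F$ or $E_1\subset E$ are closed. $\mathbb T$ is the unit circle with normalized Lebesgue measure. $L_E^2$ is the space of square integrable $E$-valued functions on $\mathbb T$ and $H_E^2\subset L_E^2$ the $E$-valued Hardy space. $L^\infty_{B(E,F)}$ is the space of bounded measurable functions on $\mathbb T$ with values in $B(E,F)$ (bounded operators from $E$ to $F$), and $H^\infty_{B(E,F)}$ the bounded analytic ones; $B(E)=B(E,E)$. $P$ is the orthogonal projection of a vector-valued $L^2$ space onto the corresponding $H^2$. $S_E=T_z$ is the shift (multiplication by $z$) on $H_E^2$. For $\Phi\in L^\infty_{B(E,F)}$ the Toeplitz operator $T_\Phi:H_E^2\to H_F^2$ is $T_\Phi h=P[\Phi h]$, and the Hankel operator $H_\Phi:H_E^2\to H_F^2$ is $H_\Phi h=PJ[\Phi h]$, where $Jf(z)=\overline z f(\overline z)$ for $f\in L_F^2$. (Likewise for other pairs of spaces.) $\Lambda^\infty_{E\oplus F}$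 is the set of all symbols $$\Psi(z)=\begin{bmatrix} C(z)&D(z)\\ A(z)&B(z)\end{bmatrix}:E\oplus F\to E\oplus F$$ with $A\in H^\infty_{B(E,F)}$, $B\in H^\infty_{B(F)}$, $C\in L^\infty_{B(E)}$, $D\in L^\infty_{B(F,E)}$. For such $\Psi$, $$W_\Psi=\begin{bmatrix} H_C^*&T_A^*\\ H_D^*&T_B^*\end{bmatrix}:H_E^2\oplus H_F^2\to H_E^2\oplus H_F^2 .$$ $\Psi$ is partial isometry-valued if there is a fixed subspace $E_0\subset E\oplus F$ with $\Psi(z)^*\Psi(z)=I_{E_0}$ for a.e. $z\in\mathbb T$, meaning that $\Psi(z)^*\Psi(z)=I_{E_0}\oplus 0$ is the orthogonal projection onto $E_0$. $\Theta\in H^\infty_{B(E_1,E)}$ (with $E_1\subset E$, $E_1\ne\{0\}$) is left inner if $\Theta(z)^*\Theta(z)=I_{E_1}$ for a.e. $z\in\mathbb T$. A left inner $\Theta$ is right extremal if it cannot be factored as $\Theta=\Theta_1\Delta$ with $\Theta_1$ left inner and $\Delta\in H^\infty_{B(E_1)}$ a non-constant square inner function (i.e. $\Delta$ is not constant and $\Delta(z)^*\Delta(z)=\Delta(z)\Delta(z)^*=I_{E_1}$ a.e.). If $\Theta=0$ then $\Theta H^2_{E_1}=\{0\}$. *)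

(* Defs.v *)
From HB Require Import structures.
From mathcomp Require Import all_boot all_order all_algebra.
From mathcomp Require Import complex.
From mathcomp Require Import all_classical all_reals all_analysis.

Set Implicit Arguments.
Unset Strict Implicit.
Unset Printing Implicit Defensive.

Import Order.TTheory GRing.Theory Num.Theory.
Import numFieldNormedType.Exports.

Local Open Scope classical_set_scope.
Local Open Scope ring_scope.

(* The inner product is linear in its first argument and conjugate-linear in
   the second one.  It is kept separate from the topology, because the library
   equips a product [E * F] with the sup norm, which has the topology of the
   Hilbert space direct sum but not its norm. *)
HB.mixin Record hasDot (R : realType) V & GRing.Lmodule R[i] V := {
  dotp : {dot V for (@Num.conj R[i])}
}.

#[short(type="innerType")]
HB.structure Definition Inner (R : realType) :=
  {V of GRing.Lmodule R[i] V & hasDot R V}.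

HB.mixin Record isHilbertNorm (R : realType) V
    & NormedModule R[i] V & Inner R V := {
  sqr_normE : forall v : V, `|v| ^+ 2 = dotp v v
}.

#[short(type="hilbertType")]
HB.structure Definition Hilbert (R : realType) :=
  {V of CompleteNormedModule R[i] V & Inner R V & isHilbertNorm R V}.

Definition separable_space (T : topologicalType) :=
  exists2 S : set T, countable S & dense S.

Definition hnorm (R : realType) (V : innerType R) (v : V) : R :=
  Num.sqrt (complex.Re (dotp v v)).

Section InnerTheory.
Context (R : realType) (V : innerType R).
Implicit Types u v : V.

Lemma dotpC u v : dotp u v = (dotp v u)^*.
Proof. by rewrite hermC expr0 mul1r. Qed.

Lemma dotp_gt0 u : u != 0 -> 0 < dotp u u.
Proof. exact: neq0_dnorm_gt0. Qed.

Lemma dotp_ge0 u : 0 <= dotp u u.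
Proof.
by have [->|/dotp_gt0/ltW//] := eqVneq u 0; rewrite linear0l.
Qed.

End InnerTheory.

Section DirectSum.
Context (R : realType) (V W : innerType R).

Definition prod_dotp (p q : V * W) : R[i] := dotp p.1 q.1 + dotp p.2 q.2.

Lemma prod_dotp_bilinear :
  bilinear_for (GRing.Scale.Law.clone _ _ *%R _)
    (GRing.Scale.Law.clone _ _ (@Num.conj R[i] \; *%R) _) prod_dotp.
Proof.
split=> [q a p p'|p a q q'] /=; rewrite /prod_dotp /=.
  by rewrite !linearPl /= mulrDr addrACA.
by rewrite !linearPr /= mulrDr addrACA.
Qed.

HB.instance Definition _ :=
  bilinear_isBilinear.Build R[i] _ _ _ _ _ prod_dotp prod_dotp_bilinear.

Lemma prod_dotp_herm (p q : V * W) :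
  prod_dotp p q = (-1) ^+ false * (prod_dotp q p)^*.
Proof.
by rewrite /prod_dotp expr0 mul1r rmorphD /= (dotpC p.1) (dotpC p.2).
Qed.

HB.instance Definition _ :=
  isHermitianSesquilinear.Build R[i] _ _ _ prod_dotp prod_dotp_herm.

Lemma prod_dotp_gt0 (p : V * W) : p != 0 -> 0 < prod_dotp p p.
Proof.
case: p => u v; rewrite /prod_dotp /= -[0]/(0, 0) xpair_eqE negb_and.
case/orP => /dotp_gt0 h; first by rewrite ltr_pwDl // dotp_ge0.
by rewrite ltr_wpDl // dotp_ge0.
Qed.

HB.instance Definition _ := isDotProduct.Build R[i] _ prod_dotp prod_dotp_gt0.

HB.instance Definition _ :=
  hasDot.Build R (V * W)%type (prod_dotp : {dot _ for _}).

End DirectSum.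

Record clsubspace (R : realType) (V : normedModType R[i]) := ClSubspace {
  clsub_pred :> {pred V};
  clsub_submod : GRing.submod_closed clsub_pred;
  clsub_closed : closed [set` clsub_pred]
}.

HB.instance Definition _ (R : realType) (V : normedModType R[i])
    (S : clsubspace V) :=
  GRing.isSubmodClosed.Build R[i] V (clsub_pred S)
    (GRing.submod_closed_semi (clsub_submod S)).

Record clsub_type (R : realType) (V : normedModType R[i]) (S : clsubspace V) :=
  ClSubElt { clsub_val : V; clsub_valP : clsub_val \in clsub_pred S }.

Section ClSubType.
Context (R : realType) (V : normedModType R[i]) (S : clsubspace V).
HB.instance Definition _ := [isSub for @clsub_val R V S].
HB.instance Definition _ := [Choice of clsub_type S by <:].
HB.instance Definition _ := [SubChoice_isSubZmodule of clsub_type S by <:].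
HB.instance Definition _ := [SubZmodule_isSubLmodule of clsub_type S by <:].
End ClSubType.

Section ClSubDot.
Context (R : realType) (E : hilbertType R) (S : clsubspace E).

Definition clsub_dotp (u v : clsub_type S) : R[i] := dotp (val u) (val v).

Lemma clsub_dotp_bilinear :
  bilinear_for (GRing.Scale.Law.clone _ _ *%R _)
    (GRing.Scale.Law.clone _ _ (@Num.conj R[i] \; *%R) _) clsub_dotp.
Proof.
have valP a u v : val (a *: u + v) = a *: val u + val v :> E.
  by rewrite linearP.
split=> [v a u u'|u a v v']; rewrite /clsub_dotp valP.
  exact: linearPl.
exact: linearPr.
Qed.

HB.instance Definition _ :=
  bilinear_isBilinear.Build R[i] _ _ _ _ _ clsub_dotp clsub_dotp_bilinear.

Lemma clsub_dotp_herm u v :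
  clsub_dotp u v = (-1) ^+ false * (clsub_dotp v u)^*.
Proof. by rewrite expr0 mul1r /clsub_dotp dotpC. Qed.

HB.instance Definition _ :=
  isHermitianSesquilinear.Build R[i] _ _ _ clsub_dotp clsub_dotp_herm.

Lemma clsub_dotp_gt0 (u : clsub_type S) : u != 0 -> 0 < clsub_dotp u u.
Proof. by move=> u0; rewrite dotp_gt0 // -(raddf0 val) (inj_eq val_inj). Qed.

HB.instance Definition _ := isDotProduct.Build R[i] _ clsub_dotp clsub_dotp_gt0.

HB.instance Definition _ :=
  hasDot.Build R (clsub_type S) (clsub_dotp : {dot _ for _}).

End ClSubDot.

Section Operators.
Context (R : realType) (V W : innerType R).

Definition bounded_op (A : V -> W) :=
  linear A /\ exists M : R, forall x, hnorm (A x) <= M * hnorm x.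

(* For a bounded operator between Hilbert spaces the value below is the unique
   vector representing [x |-> dotp (A x) y]. *)
Definition adj (A : V -> W) (y : W) : V :=
  xget 0 [set x' | forall x, dotp (A x) y = dotp x x'].

Definition orthoproj (S : set V) (x : V) : V :=
  xget 0 [set y | S y /\ forall s, S s -> dotp (x - y) s = 0].

End Operators.

Record circle (R : realType) :=
  Circle { cval :> R[i]; norm_cval : `|cval| == 1 }.

HB.instance Definition _ (R : realType) := [isSub for @cval R].
HB.instance Definition _ (R : realType) := [Choice of circle R by <:].

Section Circle.
Context (R : realType).

Lemma norm_expi (t : R) :
  `|(cos (2 * pi * t) +i* sin (2 * pi * t))%C| == 1 :> R[i].
Proof. by rewrite normc_def /= cos2Dsin2 sqrtr1. Qed.

Definition expi (t : R) : circle R := Circle (norm_expi t).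

Lemma norm_conj_cval (z : circle R) : `|(cval z)^*| == 1.
Proof. by rewrite norm_conjC norm_cval. Qed.

Definition circle_conj (z : circle R) : circle R := Circle (norm_conj_cval z).

HB.instance Definition _ := isPointed.Build (circle R) (expi 0).

(* As [expi] is an open continuous surjection, the sets with a Borel preimage
   are exactly the Borel subsets of the circle. *)
Definition circle_measurable : set (set (circle R)) :=
  [set A | measurable (expi @^-1` A)].

Lemma circle_measurable0 : circle_measurable set0.
Proof. by rewrite /circle_measurable /= preimage_set0. Qed.

Lemma circle_measurableC A : circle_measurable A -> circle_measurable (~` A).
Proof. by rewrite /circle_measurable /= preimage_setC; exact: measurableC. Qed.

Lemma circle_measurable_bigcup (A : (set (circle R))^nat) :
  (forall n, circle_measurable (A n)) -> circle_measurable (\bigcup_n A n).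
Proof.
move=> mA; rewrite /circle_measurable /= preimage_bigcup.
exact: bigcupT_measurable.
Qed.

HB.instance Definition _ := @isMeasurable.Build default_measure_display
  (circle R) circle_measurable circle_measurable0 circle_measurableC
  circle_measurable_bigcup.

Lemma measurable_expi : measurable_fun [set: R] expi.
Proof. by move=> _ A mA; rewrite setTI. Qed.

Definition circle_mu : set (circle R) -> \bar R :=
  pushforward (mrestr lebesgue_measure (measurable_itv `[0 : R, 1[)) expi.

Let circle_mu0 : circle_mu set0 = 0%E.
Proof. by rewrite /circle_mu /pushforward preimage_set0 measure0. Qed.

Let circle_mu_ge0 A : (0 <= circle_mu A)%E.
Proof. by rewrite /circle_mu /pushforward measure_ge0. Qed.

Let circle_mu_sigma_additive : semi_sigma_additive circle_mu.
Proof.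
move=> A mA tA mUA; rewrite /circle_mu /pushforward preimage_bigcup.
apply: measure_semi_sigma_additive => [n| |]; first exact: mA.
- apply/trivIsetP => i j _ _ ij; rewrite -preimage_setI.
  by move/trivIsetP : tA => /(_ _ _ _ _ ij) ->//; rewrite preimage_set0.
- by rewrite -preimage_bigcup; exact: mUA.
Qed.

HB.instance Definition _ := isMeasure.Build _ _ _ circle_mu
  circle_mu0 circle_mu_ge0 circle_mu_sigma_additive.

Lemma circle_mu_setT : circle_mu setT = 1%E.
Proof.
rewrite /circle_mu /pushforward preimage_setT /mrestr setTI.
by rewrite lebesgue_measure_itv /= lte_fin ltr01 sube0.
Qed.

HB.instance Definition _ :=
  Measure_isProbability.Build _ _ _ circle_mu circle_mu_setT.

End Circle.

(* Elements of the L^2 and Hardy spaces are represented by functions, to be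
   identified when they are equal almost everywhere; operators between these
   spaces return a representative. *)

Section ScalarFunctions.
Context (R : realType).
Implicit Types f : circle R -> R[i].

Definition cmeasurable f :=
  measurable_fun setT (fun z => complex.Re (f z)) /\
  measurable_fun setT (fun z => complex.Im (f z)).

Definition cintegral f : R[i] :=
  ((\int[circle_mu (R:=R)]_z complex.Re (f z))%R +i*
   (\int[circle_mu (R:=R)]_z complex.Im (f z))%R)%C.

End ScalarFunctions.

Section VectorFunctions.
Context (R : realType) (V : innerType R).
Implicit Types f g h : circle R -> V.

(* For values in a separable Hilbert space, weak and strong measurability
   coincide. *)
Definition wmeasurable f := forall v, cmeasurable (fun z => dotp (f z) v).

Definition sqrL2norm f : \bar R :=
  (\int[circle_mu (R:=R)]_z ((hnorm (f z) ^+ 2)%:E))%E.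

Definition L2 : set (circle R -> V) :=
  [set f | wmeasurable f /\ (sqrL2norm f < +oo)%E].

Definition L2dot f g : R[i] := cintegral (fun z => dotp (f z) (g z)).

(* The Fourier coefficients of negative index vanish; they are the weak
   integrals of [z ^ n *: f z] for [n > 0]. *)
Definition H2 : set (circle R -> V) :=
  [set f | L2 f /\ forall (n : nat) (v : V),
     cintegral (fun z => cval z ^+ n.+1 * dotp (f z) v) = 0].

Definition projH2 f : circle R -> V :=
  xget 0 [set h | H2 h /\ forall k, H2 k -> L2dot (f - h) k = 0].

Definition flip f : circle R -> V :=
  fun z => (cval z)^* *: f (circle_conj z).

Definition shift f : circle R -> V := fun z => cval z *: f z.

End VectorFunctions.

Arguments L2 {R} V.
Arguments H2 {R} V.

Section OperatorFunctions.
Context (R : realType) (V W : innerType R).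
Implicit Types Phi : circle R -> V -> W.

Definition Linfty : set (circle R -> V -> W) :=
  [set Phi | [/\ forall z, bounded_op (Phi z),
    forall x y, cmeasurable (fun z => dotp (Phi z x) y) &
    exists M : R, {ae circle_mu (R:=R), forall z,
      forall x, hnorm (Phi z x) <= M * hnorm x}]].

Definition Hinfty : set (circle R -> V -> W) :=
  [set Phi | Linfty Phi /\ forall (n : nat) (x : V) (y : W),
     cintegral (fun z => cval z ^+ n.+1 * dotp (Phi z x) y) = 0].

Definition toeplitz Phi (h : circle R -> V) : circle R -> W :=
  projH2 (fun z => Phi z (h z)).

Definition hankel Phi (h : circle R -> V) : circle R -> W :=
  projH2 (flip (fun z => Phi z (h z))).

Definition adjH2 (X : (circle R -> V) -> (circle R -> W)) (g : circle R -> W) :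
    circle R -> V :=
  xget 0 [set k | H2 V k /\ forall h, H2 V h -> L2dot (X h) g = L2dot h k].

Definition zero_symbol Phi :=
  {ae circle_mu (R:=R), forall z, forall x, Phi z x = 0}.

End OperatorFunctions.

Arguments Linfty {R} V W.
Arguments Hinfty {R} V W.

Record Lambda (R : realType) (E F : hilbertType R) := MkLambda {
  symC : circle R -> E -> E;
  symD : circle R -> F -> E;
  symA : circle R -> E -> F;
  symB : circle R -> F -> F;
  symC_Linfty : Linfty E E symC;
  symD_Linfty : Linfty F E symD;
  symA_Hinfty : Hinfty E F symA;
  symB_Hinfty : Hinfty F F symB
}.

Section Symbols.
Context (R : realType) (E F : hilbertType R) (Psi : Lambda E F).

Definition symbol (z : circle R) (p : E * F) : E * F :=
  (symC Psi z p.1 + symD Psi z p.2, symA Psi z p.1 + symB Psi z p.2).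

Definition partial_isometry_valued :=
  exists E0 : clsubspace (E * F)%type,
    {ae circle_mu (R:=R), forall z, forall p,
      adj (symbol z) (symbol z p) = orthoproj [set` E0] p}.

Definition Wop (p : (circle R -> E) * (circle R -> F)) :
    (circle R -> E) * (circle R -> F) :=
  (adjH2 (hankel (symC Psi)) p.1 + adjH2 (toeplitz (symA Psi)) p.2,
   adjH2 (hankel (symD Psi)) p.1 + adjH2 (toeplitz (symB Psi)) p.2).

Definition kerW : set ((circle R -> E) * (circle R -> F)) :=
  [set p | [/\ H2 E p.1, H2 F p.2,
     (Wop p).1 = 0 %[ae circle_mu (R:=R)] &
     (Wop p).2 = 0 %[ae circle_mu (R:=R)]]].

End Symbols.

Section InnerFunctions.
Context (R : realType) (E : hilbertType R) (E1 : clsubspace E).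
Local Notation V1 := (clsub_type E1).
Implicit Types Theta : circle R -> V1 -> E.

Definition left_inner Theta :=
  [/\ exists x : V1, x != 0,
      Hinfty V1 E Theta &
      {ae circle_mu (R:=R), forall z, forall x,
        adj (Theta z) (Theta z x) = x}].

Definition square_inner (Delta : circle R -> V1 -> V1) :=
  Hinfty V1 V1 Delta /\
  {ae circle_mu (R:=R), forall z, forall x,
     adj (Delta z) (Delta z x) = x /\ Delta z (adj (Delta z) x) = x}.

Definition constant_symbol (Delta : circle R -> V1 -> V1) :=
  exists K : V1 -> V1,
    {ae circle_mu (R:=R), forall z, forall x, Delta z x = K x}.

Definition right_extremal Theta :=
  ~ exists Theta1 : circle R -> V1 -> E, exists Delta : circle R -> V1 -> V1,
    [/\ left_inner Theta1, square_inner Delta, ~ constant_symbol Delta &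
        {ae circle_mu (R:=R), forall z, forall x,
          Theta z x = Theta1 z (Delta z x)}].

(* The elements of [Theta H2], as almost-everywhere classes. *)
Definition rangeH2 Theta : set (circle R -> E) :=
  [set f | H2 E f /\ exists2 h, H2 V1 h &
     f = (fun z => Theta z (h z)) %[ae circle_mu (R:=R)]].

End InnerFunctions.

Section Invariant.
Context (R : realType) (E F : hilbertType R).
Implicit Types N : set ((circle R -> E) * (circle R -> F)).

(* Closedness for the norm of the direct sum; in particular [N] is then stable
   under almost-everywhere equality. *)
Definition closed_subspace_H2 N :=
  [/\ N `<=` [set p | H2 E p.1 /\ H2 F p.2],
      N 0,
      forall (a : R[i]) p q, N p -> N q -> N (a *: p + q) &
      forall p, H2 E p.1 -> H2 F p.2 ->
        (forall e : R, 0 < e -> exists2 q, N q &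
           (sqrL2norm (p.1 - q.1)%R + sqrL2norm (p.2 - q.2)%R < e%:E)%E) ->
        N p].

Definition invariant_shift N :=
  forall p, N p -> N (shift p.1, adjH2 (@shift R F) p.2).

End Invariant.

(* Main.v *)
Require Import Defs.
From HB Require Import structures.
From mathcomp Require Import all_boot all_order all_algebra.
From mathcomp Require Import complex.
From mathcomp Require Import all_classical all_reals all_analysis.
From mathcomp Require Import measurable_realfun ring lra.

Set Implicit Arguments.
Unset Strict Implicit.
Unset Printing Implicit Defensive.

Import Order.TTheory GRing.Theory Num.Theory.
Import numFieldNormedType.Exports.

Local Open Scope classical_set_scope.
Local Open Scope ring_scope.

(** The flip [J] carries multiplication by [z] to multiplication by the conjugate
    of [z]. Applied to the first component only ([half_flip]), it makes the
    shift plus the backward shift look like the adjoint of multiplication by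
    [z]. So, if [N] is invariant, the orthogonal complement [M] of its half flip
    in the sum of [L2] and [H2] ([flipped_compl]) is a closed subspace invariant
    under multiplication by [z], and [N] consists of the pairs of Hardy
    functions whose half flip is orthogonal to [M] ([flipped_compl_orth]).

    By the Wold decomposition ([wold]), [M] is spanned by its reducing part, the
    functions that stay in [M] when divided by [z] any number of times, and by
    the shifts of the wandering subspace, which is the complement of [z M] in
    [M]. If [v] and [w] are wandering functions, the scalar function
    [<v(z), w(z)>] has no Fourier coefficient of nonzero index, hence is constant
    ([wandering_gram]). An orthonormal basis of the wandering subspace thus
    takes orthonormal values at almost every point, and the partial isometries
    that map its value at one fixed point to its value at [z] form a symbol
    whose product with [H2] is the second part of [M] ([beurling]). The second
    components of [M] are analytic, so the second row of this symbol is; and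
    orthogonality of the half flip of a pair to the second part of [M] says
    that the pair is in the kernel of [W] ([kerW_block]).

    An analytic function that can be divided by [z] any number of times is null
    ([h2_reducing_null]), so the reducing part of [M] lives in the first component.
    It is stable under multiplication by [z] and by its conjugate. The Hardy
    functions orthogonal to its flip form a shift-invariant subspace of [H2]
    without reducing part, which is the range of an inner function [Theta],
    unless it is zero, by the same theorem ([hardy_orth_range]). If [Theta = Theta1 Delta], the values
    of [Theta1], like those of [Theta], are pointwise orthogonal to the reducing
    part, so the range of [Theta1] is contained in that of [Theta]; then the
    pointwise adjoint of [Delta] is analytic together with [Delta], and [Delta]
    is constant ([inner_of_extremal]). So [Theta] is right extremal.

    Conversely, the kernel of [W] is invariant because the second row of the
    symbol is analytic ([kerW_invariant]), and the range of [Theta] is clearly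
    invariant.

    Two facts of analysis carry these arguments: the space of square integrable
    functions with values in a Hilbert space is complete ([l2_complete]), which
    gives orthogonal projections and adjoints; and an integrable function whose
    Fourier coefficients vanish is null ([fourier_unique]), which is shown by
    approximating the indicator functions of arcs by trigonometric polynomials. *)

(** * Complex scalars *)

Section ComplexScalars.
Context (R : realType).
Implicit Types a b z : R[i].

Lemma ReD a b : complex.Re (a + b) = complex.Re a + complex.Re b.
Proof. by case: a b => [? ?] [? ?]. Qed.

Lemma ImD a b : complex.Im (a + b) = complex.Im a + complex.Im b.
Proof. by case: a b => [? ?] [? ?]. Qed.

Lemma ReN a : complex.Re (- a) = - complex.Re a.
Proof. by case: a. Qed.

Lemma ImN a : complex.Im (- a) = - complex.Im a.
Proof. by case: a. Qed.

Lemma ReM a b : complex.Re (a * b) =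
  complex.Re a * complex.Re b - complex.Im a * complex.Im b.
Proof. by case: a b => [? ?] [? ?]. Qed.

Lemma ImM a b : complex.Im (a * b) =
  complex.Re a * complex.Im b + complex.Im a * complex.Re b.
Proof. by case: a b => [? ?] [? ?]. Qed.

Lemma ReJ a : complex.Re a^* = complex.Re a.
Proof. by case: a. Qed.

Lemma ImJ a : complex.Im a^* = - complex.Im a.
Proof. by case: a. Qed.

Lemma eqC a b : complex.Re a = complex.Re b -> complex.Im a = complex.Im b ->
  a = b.
Proof. by case: a b => [? ?] [? ?] /= -> ->. Qed.

Lemma Re_sum I (r : seq I) (P : pred I) (F : I -> R[i]) :
  complex.Re (\sum_(i <- r | P i) F i) = \sum_(i <- r | P i) complex.Re (F i).
Proof. exact: (big_morph _ ReD). Qed.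

Definition sqn z : R := complex.Re z ^+ 2 + complex.Im z ^+ 2.

Lemma sqn_ge0 z : 0 <= sqn z.
Proof. by rewrite addr_ge0 // sqr_ge0. Qed.

Lemma sqn_eq0 z : sqn z = 0 -> z = 0.
Proof.
move/eqP; rewrite paddr_eq0 ?sqr_ge0// !sqrf_eq0 => /andP[/eqP r /eqP i].
exact: eqC.
Qed.

Lemma mulJ z : z * z^* = (sqn z)%:C%C.
Proof. by case: z => a b; apply: eqC => /=; rewrite /sqn /=; ring. Qed.

Lemma sqnJ z : sqn z^* = sqn z.
Proof. by rewrite /sqn ReJ ImJ sqrrN. Qed.

Lemma sqnM a b : sqn (a * b) = sqn a * sqn b.
Proof. by rewrite /sqn ReM ImM; ring. Qed.

Lemma sqn0 : sqn 0 = 0.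
Proof. by rewrite /sqn /= expr0n /= addr0. Qed.

Lemma Re_sqr_le z : complex.Re z ^+ 2 <= sqn z.
Proof. by rewrite lerDl sqr_ge0. Qed.

Lemma Im_sqr_le z : complex.Im z ^+ 2 <= sqn z.
Proof. by rewrite lerDr sqr_ge0. Qed.

Lemma cvg0_sqr (r s : nat -> R) : (forall n, r n ^+ 2 <= s n) ->
  s @ \oo --> (0 : R) -> r @ \oo --> (0 : R).
Proof.
move=> rs s0; apply/cvgrPdist_lt => e e0.
have /cvgrPdist_lt/(_ _ (exprn_gt0 2 e0)) := s0.
apply: filterS => n; rewrite !sub0r !normrN => h.
have : `|r n| ^+ 2 < e ^+ 2.
  rewrite real_normK ?num_real//.
  by rewrite (le_lt_trans (rs n))// (le_lt_trans (ler_norm _)).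
by rewrite ltr_pXn2r ?nnegrE ?normr_ge0 ?(ltW e0).
Qed.

End ComplexScalars.

(** * Complete spaces with a semi-inner product *)

Section Convergence.
Context (R : realType) (X : zmodType).
Implicit Types (q : X -> R) (u : nat -> X).

Definition qcvg q u x := q (u n - x) @[n --> \oo] --> (0 : R).

Definition qcauchy q u := forall e : R, 0 < e ->
  exists k, forall m n, (k <= n)%N -> (n <= m)%N -> q (u m - u n) < e.

End Convergence.

(** The form is only positive semidefinite, so that square integrable functions
    can be treated without passing to almost-everywhere classes. *)
Record semiHilbert (R : realType) := SemiHilbert {
  sh_car :> lmodType R[i];
  ip : sh_car -> sh_car -> R[i];
  ipPl : forall a x y z, ip (a *: x + y) z = a * ip x z + ip y z;
  ipC : forall x y, ip x y = (ip y x)^*;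
  ip_ge0 : forall x, 0 <= complex.Re (ip x x);
  ip_complete : forall u : nat -> sh_car,
    qcauchy (fun x => complex.Re (ip x x)) u ->
    exists x, qcvg (fun x => complex.Re (ip x x)) u x
}.

Section SemiHilbertTheory.
Context (R : realType) (X : semiHilbert R).
Implicit Types (x y z : X) (a b : R[i]) (M : set X) (u v : nat -> X).

Definition n2 x : R := complex.Re (ip x x).

Definition ncvg u x := qcvg n2 u x.

Lemma ip0l x : ip 0 x = 0.
Proof. by have := ipPl (-1) 0 0 x; rewrite scaler0 addr0 mulN1r addNr. Qed.

Lemma ipDl x y z : ip (x + y) z = ip x z + ip y z.
Proof. by rewrite -[x]scale1r ipPl mul1r scale1r. Qed.

Lemma ipZl a x z : ip (a *: x) z = a * ip x z.
Proof. by rewrite -[a *: x]addr0 ipPl ip0l !addr0. Qed.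

Lemma ipNl x z : ip (- x) z = - ip x z.
Proof. by rewrite -scaleN1r ipZl mulN1r. Qed.

Lemma ipBl x y z : ip (x - y) z = ip x z - ip y z.
Proof. by rewrite ipDl ipNl. Qed.

Lemma ip0r x : ip x 0 = 0.
Proof. by rewrite ipC ip0l rmorph0. Qed.

Lemma ipDr x y z : ip x (y + z) = ip x y + ip x z.
Proof. by rewrite ipC ipDl rmorphD /= -!ipC. Qed.

Lemma ipZr a x z : ip x (a *: z) = a^* * ip x z.
Proof. by rewrite ipC ipZl rmorphM /= -ipC. Qed.

Lemma ipNr x z : ip x (- z) = - ip x z.
Proof. by rewrite ipC ipNl rmorphN /= -ipC. Qed.

Lemma ipBr x y z : ip x (y - z) = ip x y - ip x z.
Proof. by rewrite ipDr ipNr. Qed.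

Lemma ip_suml I (r : seq I) (P : pred I) (F : I -> X) z :
  ip (\sum_(i <- r | P i) F i) z = \sum_(i <- r | P i) ip (F i) z.
Proof. by elim/big_rec2: _ => [|i x y _ <-]; rewrite ?ip0l ?ipDl. Qed.

Lemma ip_sumr I (r : seq I) (P : pred I) (F : I -> X) z :
  ip z (\sum_(i <- r | P i) F i) = \sum_(i <- r | P i) ip z (F i).
Proof. by elim/big_rec2: _ => [|i x y _ <-]; rewrite ?ip0r ?ipDr. Qed.

Lemma ip_n2 x : ip x x = (n2 x)%:C%C.
Proof.
apply: eqC => //=; have /(congr1 (@complex.Im R)) := ipC x x.
rewrite ImJ => /eqP; rewrite -subr_eq0 opprK -mulr2n mulrn_eq0 /=.
by move/eqP.
Qed.

Lemma n2_ge0 x : 0 <= n2 x.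
Proof. exact: ip_ge0. Qed.

Lemma n2_0 : n2 0 = 0.
Proof. by rewrite /n2 ip0l. Qed.

Lemma n2D x y : n2 (x + y) = n2 x + n2 y + 2 * complex.Re (ip x y).
Proof.
by rewrite /n2 ipDl !ipDr !ReD (ipC y x) ReJ; ring.
Qed.

Lemma n2Z a x : n2 (a *: x) = sqn a * n2 x.
Proof.
by rewrite /n2 ipZl ipZr mulrA mulJ ReM /= mul0r subr0.
Qed.

Lemma n2N x : n2 (- x) = n2 x.
Proof. by rewrite /n2 ipNl ipNr opprK. Qed.

Lemma n2B x y : n2 (x - y) = n2 x + n2 y - 2 * complex.Re (ip x y).
Proof. by rewrite n2D n2N ipNr ReN; ring. Qed.

Lemma n2BC x y : n2 (x - y) = n2 (y - x).
Proof. by rewrite -n2N opprB. Qed.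

Lemma n2D_le x y : n2 (x + y) <= 2 * n2 x + 2 * n2 y.
Proof. by have := n2_ge0 (x - y); rewrite n2B n2D; lra. Qed.

Lemma ipC_eq0 x y : ip x y = 0 -> ip y x = 0.
Proof. by rewrite ipC => /eqP; rewrite conjC_eq0 => /eqP. Qed.

(** The quadratic polynomial in [t] on which both the Cauchy-Schwarz inequality
    and the orthogonality of a projection rest. *)
Lemma n2_proj x y (t : R) :
  n2 (x - (t%:C%C * ip x y) *: y) =
  n2 x - 2 * t * sqn (ip x y) + t ^+ 2 * sqn (ip x y) * n2 y.
Proof.
by rewrite n2B n2Z ipZr !(ReM, ImM, ReJ, ImJ) sqnM /sqn /=; ring.
Qed.

Lemma cauchy_schwarz x y : sqn (ip x y) <= n2 x * n2 y.
Proof.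
have [y0|y0] := eqVneq (n2 y) 0.
  suff h (e : R) : 0 < e -> sqn (ip x y) <= e.
    by rewrite y0 mulr0; apply/ler_addgt0Pr => e e0; rewrite add0r h.
  move=> e0.
  (* The polynomial is affine in [t] because [n2 y = 0]; a large [t] bounds its
     slope. *)
  have := n2_ge0 (x - ((n2 x / e)%:C%C * ip x y) *: y).
  rewrite n2_proj y0 mulr0 addr0 subr_ge0.
  have [x0|x0] := eqVneq (n2 x) 0.
    have := n2_ge0 (x - (1%:C%C * ip x y) *: y).
    rewrite n2_proj y0 x0 mulr0 addr0 => + _.
    rewrite mulr1 sub0r oppr_ge0 pmulr_rle0// => h.
    exact: le_trans h (ltW e0).
  have {}x0 : 0 < n2 x by rewrite lt_def x0 n2_ge0.
  rewrite (_ : 2 * _ * _ = n2 x * (2 * sqn (ip x y) / e)); last by ring.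
  rewrite -[leRHS]mulr1 ler_pM2l// ler_pdivrMr// mul1r.
  by have := sqn_ge0 (ip x y); move: e0; clear; lra.
have {}y0 : 0 < n2 y by rewrite lt_def y0 n2_ge0.
clear -y0.
have := n2_ge0 (x - ((n2 y)^-1%:C%C * ip x y) *: y).
rewrite n2_proj -(ler_pM2r y0) mul0r.
set s := sqn _; rewrite (_ : (_ + _) * n2 y = n2 x * n2 y - s); first by lra.
by field; rewrite gt_eqF.
Qed.

Lemma n2_eq0l x y : n2 x = 0 -> ip x y = 0.
Proof.
move=> x0; apply: sqn_eq0; apply/eqP; rewrite eq_le sqn_ge0 andbT.
by have := cauchy_schwarz x y; rewrite x0 mul0r.
Qed.

Lemma n2_eq0r x y : n2 y = 0 -> ip x y = 0.
Proof. by move=> y0; apply: ipC_eq0; exact: n2_eq0l. Qed.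

Lemma n2_eq0D x y : n2 y = 0 -> n2 (x + y) = n2 x.
Proof. by move=> y0; rewrite n2D y0 n2_eq0r //=; ring. Qed.

Lemma ipRe_cvg0 u v : n2 (u n) * n2 (v n) @[n --> \oo] --> (0 : R) ->
  (complex.Re (ip (u n) (v n)) @[n --> \oo] --> (0 : R)) /\
  (complex.Im (ip (u n) (v n)) @[n --> \oo] --> (0 : R)).
Proof.
move=> h; split; apply: cvg0_sqr h => n; apply: le_trans (cauchy_schwarz _ _).
  exact: Re_sqr_le.
exact: Im_sqr_le.
Qed.

Lemma ip_cvg u v x y : ncvg u x -> ncvg v y ->
  (complex.Re (ip (u n) (v n)) @[n --> \oo] --> complex.Re (ip x y)) /\
  (complex.Im (ip (u n) (v n)) @[n --> \oo] --> complex.Im (ip x y)).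
Proof.
move=> ux vy.
have E n : ip (u n) (v n) = ip (u n - x) (v n - y) + ip (u n - x) y +
    ip x (v n - y) + ip x y.
  by rewrite !ipBl !ipBr; ring.
have h1 : n2 (u n - x) * n2 (v n - y) @[n --> \oo] --> (0 : R).
  by rewrite -[0](mulr0 0); exact: cvgM.
have h2 : n2 (u n - x) * n2 y @[n --> \oo] --> (0 : R).
  by rewrite -[0](mul0r (n2 y)); apply: cvgM => //; exact: cvg_cst.
have h3 : n2 x * n2 (v n - y) @[n --> \oo] --> (0 : R).
  by rewrite -[0](mulr0 (n2 x)); apply: cvgM => //; exact: cvg_cst.
have [r1 i1] := ipRe_cvg0 h1.
have [r2 i2] := @ipRe_cvg0 (fun n => u n - x) (fun _ => y) h2.
have [r3 i3] := @ipRe_cvg0 (fun=> x) (fun n => v n - y) h3.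
split.
  under eq_fun do rewrite E !ReD.
  have := cvgD (cvgD (cvgD r1 r2) r3) (cvg_cst (complex.Re (ip x y))).
  by rewrite !add0r => h; exact: h.
under eq_fun do rewrite E !ImD.
have := cvgD (cvgD (cvgD i1 i2) i3) (cvg_cst (complex.Im (ip x y))).
by rewrite !add0r => h; exact: h.
Qed.

Lemma ncvg_cst x : ncvg (fun=> x) x.
Proof. by rewrite /ncvg /qcvg subrr n2_0; exact: cvg_cst. Qed.

Lemma ip_lim u v x y (k : R[i]) : ncvg u x -> ncvg v y ->
  (\forall n \near \oo, ip (u n) (v n) = k) -> ip x y = k.
Proof.
move=> ux vy uvk; have [r i] := ip_cvg ux vy.
by apply: eqC; [move: r|move: i] => h; apply: (cvg_unique _ h) => //;
  by apply: cvg_near_cst; apply: filterS uvk => n ->.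
Qed.

End SemiHilbertTheory.

(** * Closed subspaces and orthogonal projections *)

Lemma sqn_small (R : realType) (z : R[i]) (B : R) : 0 <= B ->
  (forall e : R, 0 < e -> sqn z <= e * B) -> z = 0.
Proof.
move=> B0 h; apply: sqn_eq0; apply/eqP; rewrite eq_le sqn_ge0 andbT.
apply/ler_addgt0Pr => e e0; rewrite add0r.
have B1 : 0 < B + 1 by rewrite ltr_wpDl.
have := h (e / (B + 1)) (divr_gt0 e0 B1) => /le_trans; apply.
by rewrite -mulrA ger_pMr// ler_pdivrMl// mulr1 lerDl.
Qed.

Section Subspaces.
Context (R : realType) (X : semiHilbert R).
Implicit Types (x y z : X) (a b : R[i]) (M : set X) (u v : nat -> X).

Definition subsp M := M 0 /\ forall a x y, M x -> M y -> M (a *: x + y).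

Definition nclosed M :=
  forall x, (forall e : R, 0 < e -> exists2 y, M y & n2 (x - y) < e) -> M x.

Definition clsub M := subsp M /\ nclosed M.

Lemma subspZ M a x : subsp M -> M x -> M (a *: x).
Proof. by move=> [M0 MP] Mx; rewrite -[_ *: _]addr0; exact: MP. Qed.

Lemma subspD M x y : subsp M -> M x -> M y -> M (x + y).
Proof. by move=> [M0 MP] Mx My; rewrite -[x]scale1r; exact: MP. Qed.

Lemma subspB M x y : subsp M -> M x -> M y -> M (x - y).
Proof.
by move=> sM Mx My; apply: subspD => //; rewrite -scaleN1r; exact: subspZ.
Qed.

Lemma subsp_sum M n (F : nat -> X) : subsp M -> (forall i, M (F i)) ->
  M (\sum_(i < n) F i).
Proof.
move=> sM MF; elim: n => [|n IH]; first by rewrite big_ord0; case: sM.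
by rewrite big_ord_recr /=; exact: subspD.
Qed.

Lemma nclosed_null M x y : nclosed M -> n2 (x - y) = 0 -> M y -> M x.
Proof. by move=> cM xy My; apply: cM => e e0; exists y => //; rewrite xy. Qed.

Lemma nclosed_cvg M u x : nclosed M -> ncvg u x -> (forall n, M (u n)) -> M x.
Proof.
move=> cM ux Mu; apply: cM => e e0.
have /cvgrPdist_lt/(_ _ e0)[k _ /(_ k (leqnn k))] := ux.
rewrite sub0r normrN => h; exists (u k) => //.
by rewrite n2BC (le_lt_trans (ler_norm _)).
Qed.

Lemma clsub_orth (S : set X) : clsub [set x | forall s, S s -> ip x s = 0].
Proof.
split; first split=> [s _|a x y hx hy s Ss]; first by rewrite ip0l.
  by rewrite ipPl hx// hy// mulr0 addr0.
move=> x h s Ss; apply: (sqn_small (n2_ge0 s)) => e e0.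
have [y /(_ s Ss) ys xy] := h e e0.
rewrite -[ip x s]subr0 -ys -ipBl (le_trans (cauchy_schwarz _ _))//.
by rewrite ler_wpM2r// ?n2_ge0// ltW.
Qed.

Lemma clsubI M M' : clsub M -> clsub M' -> clsub (M `&` M').
Proof.
move=> [[M0 MP] cM] [[M'0 M'P] cM']; split.
  by split=> // a x y [? ?] [? ?]; split; [exact: MP|exact: M'P].
move=> x h; split.
  by apply: cM => e /h[y []]; exists y.
by apply: cM' => e /h[y []]; exists y.
Qed.

Lemma parallelogram x y : n2 (x + y) + n2 (x - y) = 2 * n2 x + 2 * n2 y.
Proof. by rewrite n2D n2B; ring. Qed.

(** By the parallelogram identity a minimizing sequence for the distance to [M]
    is a Cauchy sequence; its limit minimizes the distance, and moving it in
    the direction of [m] cannot decrease the distance. *)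
Lemma proj_exists M x : clsub M ->
  exists2 y, M y & forall m, M m -> ip (x - y) m = 0.
Proof.
move=> [sM cM]; have [M0 MP] := sM.
pose S := [set n2 (x - y) | y in M]; pose d := inf S.
have infS : has_inf S.
  by split; [exists (n2 (x - 0)), 0|exists 0 => _ [y _ <-]; exact: n2_ge0].
have dle y : M y -> d <= n2 (x - y).
  by move=> My; apply: ge_inf; [case: infS|exists y].
have /choice[u hu] : forall n : nat, exists y, M y /\ n2 (x - y) < d + n.+1%:R^-1.
  move=> n; have n0 : 0 < n.+1%:R^-1 :> R by rewrite invr_gt0.
  by have [_ [y My <-]] := inf_adherent n0 infS; exists y.
have uu m n : n2 (u m - u n) <= 2 * m.+1%:R^-1 + 2 * n.+1%:R^-1.
  have [Mm um] := hu m; have [Mn un] := hu n.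
  pose v := 2^-1 *: (u m + u n).
  have Mv : M v by apply: subspZ => //; exact: subspD.
  have := parallelogram (x - u n) (x - u m).
  rewrite (_ : x - u n - (x - u m) = u m - u n); last first.
    by rewrite opprB addrC addrA subrK.
  rewrite (_ : x - u n + (x - u m) = 2 *: (x - v)); last first.
    rewrite scalerBr scalerA mulfV ?pnatr_eq0// scale1r scaler_nat.
    by rewrite addrACA -opprD [u n + _]addrC mulr2n.
  rewrite n2Z (_ : sqn 2 = 4); last by rewrite /sqn /=; ring.
  move: (dle _ Mv) um un; move: (n2 _) (n2 _) (n2 _) (n2 _) (_^-1) (_^-1).
  by clearbody d; clear -d; move=> *; lra.
have cu : qcauchy (@n2 R X) u.
  move=> e e0; have e4 : 0 < e / 4 by rewrite divr_gt0.
  have [k _ hk] := near_infty_natSinv_lt (PosNum e4).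
  exists k => m n kn nm; rewrite (le_lt_trans (uu m n))//.
  have := hk m (leq_trans kn nm); have := hk n kn => /=.
  by move: (n.+1%:R^-1) (m.+1%:R^-1); clear -R; move=> a b *; lra.
have [y uy] := ip_complete cu.
have My : M y by apply: (nclosed_cvg cM uy) => n; have [] := hu n.
exists y => // m Mm; set r := x - y.
have rd : n2 r <= d.
  have ur : ncvg (fun n => x - u n) r.
    rewrite /ncvg /qcvg; under eq_fun do rewrite /r opprB addrC addrA subrK n2BC.
    exact: uy.
  have [hr _] := ip_cvg ur ur.
  have hd : d + n.+1%:R^-1 @[n --> \oo] --> d.
    have := cvgD (cvg_cst d) (@cvg_harmonic R).
    by rewrite addr0 => h; exact: h.
  apply: ler_cvg_to hr hd _; near=> n; rewrite ltW//.
  by have [] := hu n.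
apply: sqn_eq0; set s := sqn _; have s0 : 0 <= s := sqn_ge0 _.
(* For this [t] the quadratic term of the polynomial in [n2_proj] is at most
     half of the linear one. *)
pose t := (n2 m + 1)^-1; have m1 : 0 < n2 m + 1 by rewrite ltr_wpDl// n2_ge0.
have t0 : 0 < t by rewrite invr_gt0.
have tm : t * n2 m <= 1.
  by rewrite /t mulrC ler_pdivrMr// mul1r lerDl.
have : d <= n2 (x - (y + (t%:C%C * ip r m) *: m)).
  by apply: dle; apply: subspD => //; exact: subspZ.
rewrite opprD addrA -/r n2_proj -/s => h; apply/eqP; rewrite eq_le s0 andbT -(pmulr_rle0 s t0).
have tsm : t ^+ 2 * s * n2 m <= t * s.
  rewrite (_ : _ * n2 m = t * s * (t * n2 m)); last by ring.
  by rewrite -[leRHS]mulr1 ler_wpM2l// mulr_ge0// ltW.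
by move: h rd tsm; clearbody d; clear; lra.
Unshelve. all: by end_near. Qed.

(** The difference of [x] and its projection is orthogonal to [M], hence to [x],
    hence to itself. *)
Lemma clsub_biorth M x : clsub M ->
  (forall y, (forall m, M m -> ip y m = 0) -> ip x y = 0) -> M x.
Proof.
move=> cM h; have [y My xy] := proj_exists x cM.
case: (cM) => _ /nclosed_null; apply; last exact: My.
by rewrite /n2 {1}ipBl h// (ipC_eq0 (xy _ My)) subrr.
Qed.

(** The vector is a multiple of the component of some [x0] orthogonal to the
    kernel of [phi], as [phi r *: x - phi x *: r] always lies in the kernel. *)
Lemma riesz (phi : X -> R[i]) (B : R) :
  (forall a x y, phi (a *: x + y) = a * phi x + phi y) ->
  (forall x, sqn (phi x) <= B * n2 x) ->
  exists y, forall x, phi x = ip x y.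
Proof.
move=> phiP phiB.
have phi0 : phi 0 = 0.
  by have := phiP (-1) 0 0; rewrite scaler0 addr0 mulN1r addNr.
have phiB0 x y : phi (x - y) = phi x - phi y.
  by rewrite -scaleN1r addrC phiP mulN1r addrC.
have [phi1|] := pselect (forall x, phi x = 0).
  by exists 0 => x; rewrite ip0r.
move=> /existsNP[x0 x00]; pose M := [set x | phi x = 0].
have cM : clsub M.
  split; first by split=> // a x y hx hy; rewrite /M/= phiP hx hy mulr0 addr0.
  move=> x h; apply: (@sqn_small _ _ `|B|) => // e e0.
  have [y My xy] := h e e0.
  rewrite -[phi x]subr0 -My -phiB0 (le_trans (phiB _))// mulrC.
  apply: le_trans (_ : n2 (x - y) * `|B| <= _).
    by rewrite ler_wpM2l ?n2_ge0// ler_norm.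
  by rewrite ler_wpM2r// ltW.
have [p Mp xp] := proj_exists x0 cM; set r := x0 - p.
have pr : phi r = phi x0 by rewrite phiB0 Mp subr0.
have r0 : n2 r != 0.
  apply/eqP => r0; apply: x00; rewrite -pr; apply: sqn_eq0; apply/eqP.
  by rewrite eq_le sqn_ge0 andbT -(mulr0 B) -r0 phiB.
have rc0 : (n2 r)%:C%C != 0.
  by apply: contra r0 => /eqP/(congr1 (@complex.Re R)) /= ->.
exists (((phi r)^* / (n2 r)%:C%C) *: r) => x.
have : ip r (phi r *: x - phi x *: r) = 0.
  apply: xp; rewrite /M/= phiB0.
  have phiZ a z : phi (a *: z) = a * phi z.
    by rewrite -[a *: z]addr0 phiP phi0 addr0.
  by rewrite !phiZ mulrC subrr.
move/ipC_eq0; rewrite ipBl !ipZl ip_n2 => /eqP; rewrite subr_eq0 => /eqP h.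
rewrite ipZr rmorphM /= conjCK fmorphV /=.
have -> : (n2 r)%:C%C^* = (n2 r)%:C%C.
  by apply: eqC; rewrite /= ?oppr0.
by rewrite mulrAC h mulfK.
Qed.

End Subspaces.

(** * Orthonormal sequences *)

(** Some terms are allowed to vanish, so that finite orthonormal families are
    sequences as well. *)
Definition onz (R : realType) (X : semiHilbert R) (w : nat -> X) :=
  (forall i j, i != j -> ip (w i) (w j) = 0) /\
  (forall i, ip (w i) (w i) = 1 \/ w i = 0).

Section GramSchmidt.
Context (R : realType) (X : semiHilbert R).
Implicit Types (x y z : X) (w s : nat -> X).

Definition gs_step (l : seq X) x : X :=
  let r := x - \sum_(y <- l) ip x y *: y in
  if n2 r == 0 then 0 else (Num.sqrt (n2 r))^-1%:C%C *: r.

Fixpoint gs_list s n : seq X :=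
  if n is m.+1 then rcons (gs_list s m) (gs_step (gs_list s m) (s m))
  else [::].

Definition gs s n := gs_step (gs_list s n) (s n).

Lemma gs_listE s n : gs_list s n = [seq gs s i | i <- iota 0 n].
Proof.
elim: n => [//|n IH]; rewrite -[in RHS]addn1 iotaD map_cat -IH /= cats1.
by rewrite add0n.
Qed.

Definition gs_res s n := s n - \sum_(i < n) ip (s n) (gs s i) *: gs s i.

Lemma gsE s n : gs s n =
  if n2 (gs_res s n) == 0 then 0
  else (Num.sqrt (n2 (gs_res s n)))^-1%:C%C *: gs_res s n.
Proof.
rewrite {1}/gs /gs_step gs_listE big_map -[n in iota 0 n]subn0.
by rewrite -/(index_iota 0 n) big_mkord.
Qed.

Lemma onz_gs s : onz (gs s).
Proof.
have nrm i : ip (gs s i) (gs s i) = 1 \/ gs s i = 0.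
  rewrite gsE; case: eqVneq => [_|r0]; [by right|left].
  have rp : 0 < n2 (gs_res s i) by rewrite lt_def r0 n2_ge0.
  rewrite ip_n2 n2Z /sqn /= expr0n /= addr0 exprVn sqr_sqrtr ?ltW//.
  by rewrite mulVf.
split=> //.
have lt j : forall i, (i < j)%N -> ip (gs s j) (gs s i) = 0.
  elim/ltn_ind: j => j IH i ij.
  rewrite gsE; case: ifP => [_|_]; first by rewrite ip0l.
  suff h : ip (gs_res s j) (gs s i) = 0 by rewrite ipZl h mulr0.
  rewrite /gs_res ipBl ip_suml.
  rewrite (bigD1 (Ordinal ij)) //= big1 => [|k ki].
    rewrite ipZl; case: (nrm i) => [->|->]; last first.
      by rewrite !ip0r mul0r addr0 subrr.
    by rewrite mulr1 addr0 subrr.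
  rewrite ipZl; have [kli|ilk|ki'] := ltngtP k i.
  - by rewrite (ipC_eq0 (IH i ij k kli)) mulr0.
  - by rewrite (IH k (ltn_ord k) i ilk) mulr0.
  - by move: ki; rewrite -(inj_eq val_inj) /= ki' eqxx.
move=> i j; case: ltngtP => // ij _; last exact: lt.
exact/ipC_eq0/lt.
Qed.

Lemma gs_in s (M : set X) : subsp M -> (forall i, M (s i)) ->
  forall n, M (gs s n).
Proof.
move=> sM Mx; elim/ltn_ind => n IH; rewrite gsE; case: ifP => _.
  by case: sM.
apply: subspZ => //; apply: subspB => //.
elim/big_ind: _ => [|y z My Mz|i _]; first by case: sM.
  exact: subspD.
by apply: subspZ => //; exact: IH.
Qed.

Lemma gs_orth s y : (forall n, ip (gs s n) y = 0) ->
  forall n, ip (s n) y = 0.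
Proof.
move=> h n.
rewrite -[s n](subrK (\sum_(i < n) ip (s n) (gs s i) *: gs s i)) -/(gs_res _ _).
rewrite ipDl ip_suml big1 ?addr0 => [|i _]; last by rewrite ipZl h mulr0.
have := h n; rewrite gsE; case: eqVneq => [r0 _|r0]; first exact: n2_eq0l.
rewrite ipZl => /eqP; rewrite mulf_eq0 => /orP[|/eqP//].
move=> /eqP/(congr1 (@complex.Re R)) /= /eqP.
by rewrite invr_eq0 sqrtr_eq0 leNgt lt_def r0 n2_ge0.
Qed.

End GramSchmidt.

(** * Orthogonal series and adjoints *)

Section OrthogonalSeries.
Context (R : realType) (X : semiHilbert R).
Implicit Types (x y z : X) (u v w : nat -> X) (c d : nat -> R[i]).

Definition fsum w c n : X := \sum_(i < n) c i *: w i.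

(** The value is meaningful for square summable coefficients. *)
Definition hsum w c : X := xget 0 [set x | ncvg (fsum w c) x].

Definition sqsum c := exists B : R, forall n, \sum_(i < n) sqn (c i) <= B.

Lemma ncvg_lin (a : R[i]) u v x y : ncvg u x -> ncvg v y ->
  ncvg (fun n => a *: u n + v n) (a *: x + y).
Proof.
move=> ux vy; rewrite /ncvg /qcvg.
have h : 2 * (sqn a * n2 (u n - x)) + 2 * n2 (v n - y) @[n --> \oo] --> (0 : R).
  have := cvgD (cvgM (cvg_cst (2 : R)) (cvgM (cvg_cst (sqn a)) ux))
    (cvgM (cvg_cst (2 : R)) vy).
  by rewrite !mulr0 addr0 => h; exact: h.
apply: squeeze_cvgr (cvg_cst (0 : R)) h; apply: nearW => n.
rewrite n2_ge0 /= -n2Z.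
rewrite (_ : _ - _ = a *: (u n - x) + (v n - y)); first exact: n2D_le.
by rewrite scalerBr addrACA opprD.
Qed.

Lemma ncvg_unique u x y : ncvg u x -> ncvg u y -> n2 (x - y) = 0.
Proof.
move=> ux uy; have h z : ip (x - y) z = 0.
  have uu : ncvg (fun n => -1 *: u n + u n) (-1 *: y + x) by exact: ncvg_lin.
  rewrite addrC -scaleN1r; apply: (ip_lim uu (ncvg_cst z)).
  by near=> n; rewrite scaleN1r addNr ip0l.
by rewrite /n2 h.
Unshelve. all: by end_near. Qed.

Lemma ip_fsum w c d n : onz w ->
  ip (fsum w c n) (fsum w d n) =
  \sum_(i < n) c i * (d i)^* * ip (w i) (w i).
Proof.
move=> [w0 _]; rewrite ip_suml; apply: eq_bigr => i _.
rewrite ip_sumr (bigD1 i) //= big1 ?addr0 => [|j ji].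
  by rewrite ipZl ipZr mulrA.
by rewrite ipZl ipZr w0 ?mulr0//; apply: contra ji => /eqP/val_inj ->.
Qed.

Lemma n2_fsum w c n : onz w -> n2 (fsum w c n) <= \sum_(i < n) sqn (c i).
Proof.
move=> ow; have := ip_fsum c c n ow; rewrite ip_n2 => /(congr1 (@complex.Re R)).
rewrite /= Re_sum => ->; apply: ler_sum => i _.
rewrite mulJ; case: ow => _ /(_ i)[->|->]; first by rewrite mulr1.
by rewrite ip0l mulr0 sqn_ge0.
Qed.

Lemma hsum_cvg w c : onz w -> sqsum c -> ncvg (fsum w c) (hsum w c).
Proof.
move=> ow [B cB].
suff [x hx] : exists x, ncvg (fsum w c) x.
  by rewrite /hsum; case: xgetP => [//|/(_ x)/(_ hx)].
apply: ip_complete => e e0.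
pose S n := \sum_(i < n) sqn (c i).
have nS : {homo S : n m / (n <= m)%N >-> n <= m}.
  apply/nondecreasing_seqP => n.
  by rewrite /S big_ord_recr /= lerDl sqn_ge0.
have cS : cvgn S.
  by apply: nondecreasing_is_cvgn => //; exists B => _ [n _ <-]; exact: cB.
have e2 : 0 < e / 2 by rewrite divr_gt0.
have /cvgrPdist_lt/(_ _ e2)[k _ hk] := cS.
exists k => m n kn nm.
have -> : fsum w c m - fsum w c n =
    fsum w (fun i => if (n <= i)%N then c i else 0) m.
  rewrite /fsum -!(big_mkord predT (fun i => c i *: w i)).
  rewrite (big_cat_nat _ nm) //= [X in X - _]addrC addrK.
  rewrite -(big_mkord predT (fun i => (if (n <= i)%N then c i else 0) *: w i)).
  rewrite [RHS](big_cat_nat _ nm) //= [X in X + _]big_nat [X in X + _]big1 ?add0r => [|i].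
    by apply: eq_big_nat => i /andP[->].
  by move=> /andP[_]; rewrite ltnNge => /negPf ->; rewrite scale0r.
apply: le_lt_trans (n2_fsum _ _ ow) _.
have -> : \sum_(i < m) sqn (if (n <= i)%N then c i else 0) = S m - S n.
  rewrite /S -!(big_mkord predT (fun i => sqn (c i))).
  rewrite -(big_mkord predT (fun i => sqn (if (n <= i)%N then c i else 0))).
  rewrite [LHS](big_cat_nat _ nm) // [X in _ = X - _](big_cat_nat _ nm) //=.
  rewrite [X in _ = X - _]addrC addrK.
  rewrite [X in X + _]big_nat [X in X + _]big1 ?add0r => [|i].
    by apply: eq_big_nat => i /andP[->].
  by move=> /andP[_]; rewrite ltnNge => /negPf ->; rewrite sqn0.
have := hk m (leq_trans kn nm); have := hk n kn => /=.
rewrite !ltr_norml => /andP[_ h1] /andP[h2 _].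
by move: h1 h2; move: (limn S) (S m) (S n); clear; move=> *; lra.
Qed.

Lemma bessel w x n : onz w -> \sum_(i < n) sqn (ip x (w i)) <= n2 x.
Proof.
move=> ow; pose c i := ip x (w i).
have := n2_ge0 (x - fsum w c n); rewrite n2B.
have -> : complex.Re (ip x (fsum w c n)) = \sum_(i < n) sqn (c i).
  rewrite ip_sumr Re_sum; apply: eq_bigr => i _.
  by rewrite ipZr mulrC mulJ.
have := n2_fsum c n ow; rewrite -/(c _).
by rewrite (eq_bigr (fun i : 'I_n => sqn (c i)))//; move: (n2 _) (n2 _) (\sum_(_ < _) _); clear; move=> *; lra.
Qed.

Lemma sqsum_ip w x : onz w -> sqsum (fun i => ip x (w i)).
Proof. by move=> ow; exists (n2 x) => n; exact: bessel. Qed.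

Lemma ip_hsum_orth w c y : onz w -> sqsum c -> (forall i, ip (w i) y = 0) ->
  ip (hsum w c) y = 0.
Proof.
move=> ow sc wy; apply: (ip_lim (hsum_cvg ow sc) (ncvg_cst y)).
by near=> n; rewrite ip_suml big1// => i _; rewrite ipZl wy mulr0.
Unshelve. all: by end_near. Qed.

Lemma ip_hsuml w c j : onz w -> sqsum c ->
  ip (hsum w c) (w j) = c j * ip (w j) (w j).
Proof.
move=> ow sc; apply: (ip_lim (hsum_cvg ow sc) (ncvg_cst (w j))).
near=> n; have jn : (j < n)%N by near: n; exists j.+1.
rewrite ip_suml (bigD1 (Ordinal jn)) //= big1 ?addr0 ?ipZl// => i ij.
by rewrite ipZl (proj1 ow) ?mulr0//; apply: contra ij => /eqP ij;
  apply/eqP/val_inj.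
Unshelve. all: by end_near. Qed.

Lemma onz_gram w x j : onz w -> ip x (w j) * ip (w j) (w j) = ip x (w j).
Proof. by move=> [_ /(_ j)[->|->]]; rewrite ?mulr1// !ip0r mulr0. Qed.

Definition hproj w x := hsum w (fun i => ip x (w i)).

Lemma ip_hproj w x j : onz w -> ip (x - hproj w x) (w j) = 0.
Proof.
move=> ow; rewrite ipBl ip_hsuml//; last exact: sqsum_ip.
by rewrite onz_gram// subrr.
Qed.

Lemma onb_cvg w x : onz w -> (forall y, (forall i, ip y (w i) = 0) -> n2 y = 0) ->
  ncvg (fsum w (fun i => ip x (w i))) x.
Proof.
move=> ow tw; have cw := hsum_cvg ow (sqsum_ip x ow).
have x0 : n2 (x - hproj w x) = 0 by apply: tw => i; exact: ip_hproj.
rewrite /ncvg /qcvg.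
rewrite (_ : (fun n => _) = (fun n => n2 (fsum w (fun i => ip x (w i)) n -
  hproj w x)))//; apply/funext => n.
rewrite -[LHS](@n2_eq0D _ _ _ (x - hproj w x))//; congr n2.
by rewrite addrA subrK.
Qed.

End OrthogonalSeries.

Lemma ip_hsum2 (R : realType) (X Y : semiHilbert R) (w : nat -> X)
    (b : nat -> Y) c d : onz w -> onz b -> sqsum c -> sqsum d ->
  (forall i, ip (w i) (w i) = ip (b i) (b i)) ->
  ip (hsum w c) (hsum w d) = ip (hsum b c) (hsum b d).
Proof.
move=> ow ob sc sd wb.
have [h1 h2] := ip_cvg (hsum_cvg ow sc) (hsum_cvg ow sd).
have [h3 h4] := ip_cvg (hsum_cvg ob sc) (hsum_cvg ob sd).
have E n : ip (fsum w c n) (fsum w d n) = ip (fsum b c n) (fsum b d n).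
  by rewrite !ip_fsum//; apply: eq_bigr => i _; rewrite wb.
have Er : (fun n => complex.Re (ip (fsum w c n) (fsum w d n))) =
  (fun n => complex.Re (ip (fsum b c n) (fsum b d n))).
  by apply/funext => n; rewrite E.
have Ei : (fun n => complex.Im (ip (fsum w c n) (fsum w d n))) =
  (fun n => complex.Im (ip (fsum b c n) (fsum b d n))).
  by apply/funext => n; rewrite E.
rewrite Er in h1; rewrite Ei in h2.
by apply: eqC; [exact: cvg_unique h1 h3|exact: cvg_unique h2 h4].
Qed.

Section BoundedOperators.
Context (R : realType) (X Y : semiHilbert R) (T : X -> Y) (B : R).
Hypothesis TP : forall a x y, T (a *: x + y) = a *: T x + T y.
Hypothesis TB : forall x, n2 (T x) <= B * n2 x.

Lemma adjoint_exists u : exists v, forall x, ip (T x) u = ip x v.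
Proof.
apply: (@riesz _ _ (fun x => ip (T x) u) (B * n2 u)) => [a x y|x].
  by rewrite TP ipPl.
by rewrite (le_trans (cauchy_schwarz _ _))// mulrAC ler_wpM2r// n2_ge0.
Qed.

End BoundedOperators.

(** * Measurability and integration of complex functions on the circle *)

Section ComplexMeasurable.
Context (R : realType).
Implicit Types (f g : circle R -> R[i]) (a : R[i]).
Local Notation mu := (@circle_mu R).

Lemma cmeasurable_cst a : cmeasurable (fun=> a).
Proof. by split; exact: measurable_cst. Qed.

Lemma cmeasurableD f g : cmeasurable f -> cmeasurable g ->
  cmeasurable (fun z => f z + g z).
Proof.
move=> [f1 f2] [g1 g2]; split.
  by under eq_fun do rewrite ReD; exact: measurable_funD.
by under eq_fun do rewrite ImD; exact: measurable_funD.
Qed.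

Lemma cmeasurableM f g : cmeasurable f -> cmeasurable g ->
  cmeasurable (fun z => f z * g z).
Proof.
move=> [f1 f2] [g1 g2]; split.
  under eq_fun do rewrite ReM.
  by apply: measurable_funB; apply: measurable_funM.
under eq_fun do rewrite ImM.
by apply: measurable_funD; apply: measurable_funM.
Qed.

Lemma cmeasurableJ f : cmeasurable f -> cmeasurable (fun z => (f z)^*).
Proof.
move=> [f1 f2]; split; first by under eq_fun do rewrite ReJ.
by under eq_fun do rewrite ImJ; exact: measurable_funN.
Qed.

Lemma cmeasurable_sum n (F : nat -> circle R -> R[i]) :
  (forall i, cmeasurable (F i)) -> cmeasurable (fun z => \sum_(i < n) F i z).
Proof.
move=> mF; elim: n => [|n IH].
  by under eq_fun do rewrite big_ord0; exact: cmeasurable_cst.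
by under eq_fun do rewrite big_ord_recr /=; exact: cmeasurableD.
Qed.

Lemma cmeasurable_lim (F : nat -> circle R -> R[i]) f :
  (forall n, cmeasurable (F n)) ->
  (forall z, (complex.Re (F n z) @[n --> \oo] --> complex.Re (f z)) /\
             (complex.Im (F n z) @[n --> \oo] --> complex.Im (f z))) ->
  cmeasurable f.
Proof.
move=> mF Ff; split.
  apply: (@measurable_fun_cvg _ _ _ _ (fun n z => complex.Re (F n z))).
    by move=> n; case: (mF n).
  by move=> z _; case: (Ff z).
apply: (@measurable_fun_cvg _ _ _ _ (fun n z => complex.Im (F n z))).
  by move=> n; case: (mF n).
by move=> z _; case: (Ff z).
Qed.

Lemma cmeasurable_if (A : set (circle R)) f g : measurable A ->
  cmeasurable f -> cmeasurable g ->
  cmeasurable (fun z => if `[< A z >] then f z else g z).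
Proof.
have mif (r s : circle R -> R) : measurable A -> measurable_fun setT r ->
    measurable_fun setT s ->
    measurable_fun setT (fun z => if `[< A z >] then r z else s z).
  move=> mA mr ms; apply: measurable_fun_ifT => //.
  apply: (measurable_fun_bool true); rewrite setTI.
  by rewrite (_ : _ @^-1` _ = A)//; apply/seteqP; split=> z /= /asboolP.
move=> mA [f1 f2] [g1 g2]; split.
  rewrite (_ : (fun z => _) = fun z => if `[< A z >] then complex.Re (f z)
    else complex.Re (g z)); first exact: mif.
  by apply/funext => z; case: ifP.
rewrite (_ : (fun z => _) = fun z => if `[< A z >] then complex.Im (f z)
  else complex.Im (g z)); first exact: mif.
by apply/funext => z; case: ifP.
Qed.

Definition cintegrable f :=
  mu.-integrable setT (EFin \o (fun z => complex.Re (f z))) /\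
  mu.-integrable setT (EFin \o (fun z => complex.Im (f z))).

Lemma cintegrable_meas f : cintegrable f -> cmeasurable f.
Proof.
by move=> [/measurable_int/measurable_EFinP ? /measurable_int/measurable_EFinP].
Qed.

Lemma le_cintegrable f (g : circle R -> R) : cmeasurable f ->
  mu.-integrable setT (EFin \o g) -> (forall z, sqn (f z) <= g z ^+ 2) ->
  cintegrable f.
Proof.
move=> [f1 f2] ig fg; split.
  apply: le_integrable ig => //; first exact/measurable_EFinP.
  move=> z _; rewrite /= lee_fin -ler_sqr ?nnegrE// !real_normK ?num_real//.
  by apply: le_trans (fg z); exact: Re_sqr_le.
apply: le_integrable ig => //; first exact/measurable_EFinP.
move=> z _; rewrite /= lee_fin -ler_sqr ?nnegrE// !real_normK ?num_real//.
by apply: le_trans (fg z); exact: Im_sqr_le.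
Qed.

Lemma cintegrable_bounded f (B : R) : cmeasurable f ->
  (forall z, sqn (f z) <= B ^+ 2) -> cintegrable f.
Proof.
move=> mf fB; apply: (@le_cintegrable f (cst B)) => //.
exact: finite_measure_integrable_cst.
Qed.

Lemma cintegrableD f g : cintegrable f -> cintegrable g ->
  cintegrable (fun z => f z + g z).
Proof.
move=> [f1 f2] [g1 g2]; split.
  rewrite (_ : _ \o _ = (EFin \o (fun z => complex.Re (f z))) \+
    (EFin \o (fun z => complex.Re (g z))))%E; first exact: integrableD.
  by apply/funext => z /=; rewrite ReD EFinD.
rewrite (_ : _ \o _ = (EFin \o (fun z => complex.Im (f z))) \+
  (EFin \o (fun z => complex.Im (g z))))%E; first exact: integrableD.
by apply/funext => z /=; rewrite ImD EFinD.
Qed.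

(** The modulus of [f] is dominated by the sum of the absolute values of its
    real and imaginary parts. *)
Lemma cintegrableM f g (B : R) : cintegrable f -> cmeasurable g ->
  (forall z, sqn (g z) <= B ^+ 2) -> cintegrable (fun z => g z * f z).
Proof.
move=> fi mg gB; have mf := cintegrable_meas fi.
have ifi : mu.-integrable setT
    (EFin \o (fun z => `|complex.Re (f z)| + `|complex.Im (f z)|)).
  rewrite (_ : _ \o _ = ((EFin \o (Num.norm \o (fun z => complex.Re (f z)))) \+
    (EFin \o (Num.norm \o (fun z => complex.Im (f z))))))%E//.
  by apply: integrableD => //; apply: integrable_norm; case: fi.
have {}ifi : mu.-integrable setT
    (EFin \o (fun z => B * (`|complex.Re (f z)| + `|complex.Im (f z)|))).
  by have := integrableZl measurableT B ifi; exact.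
apply: le_cintegrable ifi _; first exact: cmeasurableM.
move=> z; rewrite sqnM exprMn; apply: ler_pM => //; rewrite ?sqn_ge0//.
rewrite sqrrD !real_normK ?num_real// addrAC lerDl.
by rewrite mulrn_wge0// mulr_ge0.
Qed.

Lemma cintegrableZ f a : cintegrable f -> cintegrable (fun z => a * f z).
Proof.
move=> fi; apply: (@cintegrableM f (cst a) (Num.sqrt (sqn a))) => //.
by move=> z /=; rewrite sqr_sqrtr// sqn_ge0.
Qed.

Lemma cintegrable_cst a : cintegrable (cst a).
Proof. by split; exact: finite_measure_integrable_cst. Qed.

Lemma cintegrableJ f : cintegrable f -> cintegrable (fun z => (f z)^*).
Proof.
move=> [f1 f2]; split.
  by under [X in _ \o X]eq_fun do rewrite ReJ.
rewrite (_ : _ \o _ = (fun z => (-1)%:E * (EFin \o (fun z => complex.Im (f z))) z)%E).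
  exact: integrableZl.
by apply/funext => z; rewrite /= ImJ -EFinM mulN1r.
Qed.

Lemma cintegralD f g : cintegrable f -> cintegrable g ->
  cintegral (fun z => f z + g z) = cintegral f + cintegral g.
Proof.
move=> [f1 f2] [g1 g2]; apply: eqC; rewrite /cintegral /=.
  by under eq_Rintegral do rewrite ReD; rewrite RintegralD.
by under eq_Rintegral do rewrite ImD; rewrite RintegralD.
Qed.

Lemma cintegralZ f a : cintegrable f ->
  cintegral (fun z => a * f z) = a * cintegral f.
Proof.
move=> [f1 f2]; apply: eqC; rewrite /cintegral ?ReM ?ImM /=.
  under eq_Rintegral do rewrite ReM.
  rewrite RintegralB//= ?RintegralZl//.
    exact: (integrableZl measurableT _ f1).
  exact: (integrableZl measurableT _ f2).
under eq_Rintegral do rewrite ImM.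
rewrite RintegralD//= ?RintegralZl//.
  exact: (integrableZl measurableT _ f2).
exact: (integrableZl measurableT _ f1).
Qed.

Lemma cintegralJ f : cintegrable f ->
  cintegral (fun z => (f z)^*) = (cintegral f)^*.
Proof.
move=> [f1 f2]; apply: eqC; rewrite ?ReJ ?ImJ /cintegral /=.
  by under eq_Rintegral do rewrite ReJ.
under eq_Rintegral do rewrite ImJ -mulN1r.
by rewrite RintegralZl// mulN1r.
Qed.

Lemma cintegral_cst a : cintegral (fun=> a) = a.
Proof.
rewrite /cintegral /Rintegral !integral_cst//= ?(@circle_mu_setT R) ?mule1/=.
by case: a.
Qed.

Lemma cintegral0 : cintegral (fun=> 0 : R[i]) = 0 :> R[i].
Proof. exact: cintegral_cst. Qed.

Lemma ae_eq_cintegral f g : cmeasurable f -> cmeasurable g ->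
  {ae mu, forall z, f z = g z} -> cintegral f = cintegral g.
Proof.
move=> [f1 f2] [g1 g2] fg; apply: eqC; rewrite /cintegral /Rintegral /=.
  congr fine; apply: ae_eq_integral => //; try exact/measurable_EFinP.
  by apply: filterS fg => z /= -> _.
congr fine; apply: ae_eq_integral => //; try exact/measurable_EFinP.
by apply: filterS fg => z /= -> _.
Qed.

Lemma ae_exists (P : circle R -> Prop) :
  {ae mu, forall z, P z} -> exists z, P z.
Proof.
move=> [A [mA A0 PA]]; apply: contrapT => /forallNP nP.
have : (mu setT <= mu A)%E.
  by apply: le_measure; rewrite ?inE// => z _; apply: PA; exact: nP.
by rewrite A0 circle_mu_setT lee_fin ler10.
Qed.

End ComplexMeasurable.

(** * Square integrable vector functions *)

Definition vn2 (R : realType) (V : innerType R) (x : V) : R :=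
  complex.Re (dotp x x).

(** Completeness and separability, the latter in the form of an orthonormal
    basis (with possible zero terms), expressed by the inner product alone. *)
Record sepHilbert (R : realType) := SepHilbert {
  sep_car :> innerType R;
  basis : nat -> sep_car;
  basis_orth : forall i j, i != j -> dotp (basis i) (basis j) = 0;
  basis_norm : forall i, dotp (basis i) (basis i) = 1 \/ basis i = 0;
  basis_total : forall x, (forall i, dotp x (basis i) = 0) -> x = 0;
  sep_complete : forall u : nat -> sep_car,
    qcauchy (@vn2 R sep_car) u -> exists x, qcvg (@vn2 R sep_car) u x
}.

Lemma dotpPl (R : realType) (V : innerType R) (a : R[i]) (x y z : V) :
  dotp (a *: x + y) z = a * dotp x z + dotp y z.
Proof. exact: linearPl. Qed.

Lemma dotp_Re_ge0 (R : realType) (V : innerType R) (x : V) : 0 <= vn2 x.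
Proof. by have := dotp_ge0 x; rewrite lecE => /andP[_]. Qed.

Definition vecH (R : realType) (V : sepHilbert R) : semiHilbert R :=
  SemiHilbert (@dotpPl R V) (@dotpC R V) (@dotp_Re_ge0 R V)
    (@sep_complete R V).

Section InnerVectors.
Context (R : realType) (V : innerType R).
Implicit Types x y : V.

Lemma vn2_eq0 x : vn2 x = 0 -> x = 0.
Proof.
move=> x0; apply/eqP; apply: contraT => /dotp_gt0.
by rewrite ltcE -/(vn2 x) x0 /= ltxx andbF.
Qed.

Lemma hnormE x : hnorm x ^+ 2 = vn2 x.
Proof. by rewrite sqr_sqrtr// dotp_Re_ge0. Qed.

Lemma hnorm_ge0 x : 0 <= hnorm x.
Proof. exact: sqrtr_ge0. Qed.

End InnerVectors.

Section SepHilbertTheory.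
Context (R : realType) (V : sepHilbert R).
Implicit Types (x y : V).

Lemma onz_basis : @onz R (vecH V) (@basis R V).
Proof. by split; [exact: basis_orth|exact: basis_norm]. Qed.

Lemma basis_cvg x :
  @ncvg R (vecH V) (@fsum R (vecH V) (@basis R V) (fun i => dotp x (basis V i))) x.
Proof.
apply: (@onb_cvg R (vecH V)) => [|y /basis_total ->]; first exact: onz_basis.
exact: (@n2_0 R (vecH V)).
Qed.

Lemma dotp_basis x y : (forall i, dotp x (basis V i) = dotp y (basis V i)) -> x = y.
Proof.
move=> h; apply/eqP; rewrite -subr_eq0; apply/eqP/basis_total => i.
by rewrite linearBl /= h subrr.
Qed.

End SepHilbertTheory.

Section SquareIntegrable.
Context (R : realType) (V : sepHilbert R).
Local Notation mu := (@circle_mu R).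
Implicit Types (f g : circle R -> V).

(** The inner product of two weakly measurable functions is the limit of the
    partial sums over a countable orthonormal basis. *)
Lemma cmeasurable_dot f g : wmeasurable f -> wmeasurable g ->
  cmeasurable (fun z => dotp (f z) (g z)).
Proof.
move=> mf mg.
pose s z := @fsum R (vecH V) (@basis R V) (fun i => dotp (f z) (basis V i)).
apply: (@cmeasurable_lim _ (fun n z => dotp (s z n) (g z))) => [n|z].
  rewrite (_ : (fun z => _) = fun z =>
    \sum_(i < n) dotp (f z) (basis V i) * (dotp (g z) (basis V i))^*).
    apply: (@cmeasurable_sum _ n
      (fun i z => dotp (f z) (basis V i) * (dotp (g z) (basis V i))^*)) => i.
    by apply: cmeasurableM; [exact: mf|exact/cmeasurableJ/mg].
  apply/funext => z.
  rewrite -[LHS]/(@ip R (vecH V) (s z n) (g z)) ip_suml; apply: eq_bigr => i _.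
  by rewrite ipZl; congr (_ * _); exact: dotpC.
exact: (@ip_cvg R (vecH V) _ (fun=> g z) _ _ (basis_cvg (f z)) (ncvg_cst _)).
Qed.

Lemma measurable_vn2 f : wmeasurable f ->
  measurable_fun setT (fun z => vn2 (f z)).
Proof. by move=> mf; case: (cmeasurable_dot mf mf). Qed.

Lemma sqrL2normE f : sqrL2norm f = (\int[mu]_z (vn2 (f z))%:E)%E.
Proof. by apply: eq_integral => z _; rewrite hnormE. Qed.

Lemma L2P f : L2 V f <->
  wmeasurable f /\ mu.-integrable setT (EFin \o (fun z => vn2 (f z))).
Proof.
have E : (\int[mu]_z `|(EFin \o (fun z => vn2 (f z))) z| = sqrL2norm f)%E.
  rewrite sqrL2normE; apply: eq_integral => z _.
  by rewrite /= ger0_norm// dotp_Re_ge0.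
split=> -[mf h]; split=> //.
  apply/integrableP; split; last by rewrite E.
  by apply/measurable_EFinP; apply: measurable_vn2; exact: mf.
by move/integrableP : h => [_]; rewrite E.
Qed.

Lemma wmeasurable_lin (a : R[i]) f g : wmeasurable f -> wmeasurable g ->
  wmeasurable (a *: f + g).
Proof.
move=> mf mg v; rewrite (_ : (fun z => _) =
    fun z => a * dotp (f z) v + dotp (g z) v).
  apply: cmeasurableD; last exact: mg.
  by apply: cmeasurableM; [exact: cmeasurable_cst|exact: mf].
by apply/funext => z; rewrite dotpPl.
Qed.

Lemma wmeasurable0 : wmeasurable (0 : circle R -> V).
Proof.
move=> v; rewrite (_ : (fun z => _) = fun=> 0); first exact: cmeasurable_cst.
by apply/funext => z; rewrite linear0l.
Qed.

Lemma le_vn2_L2 f (r : circle R -> R) : wmeasurable f ->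
  mu.-integrable setT (EFin \o r) -> (forall z, vn2 (f z) <= r z) -> L2 V f.
Proof.
move=> mf ir fr; apply/L2P; split=> //; apply: le_integrable ir => //.
  by apply/measurable_EFinP; apply: measurable_vn2; exact: mf.
move=> z _; rewrite /= lee_fin !ger0_norm ?dotp_Re_ge0//.
exact: le_trans (dotp_Re_ge0 _) (fr z).
Qed.

Definition L2pred : {pred circle R -> V} := fun f => `[< L2 V f >].

Lemma L2_submod : GRing.submod_closed L2pred.
Proof.
split=> [|a f g /asboolP Lf /asboolP Lg]; apply/asboolP.
  apply: (@le_vn2_L2 _ (cst 0)); first exact: wmeasurable0.
    exact: finite_measure_integrable_cst.
  by move=> z /=; rewrite /vn2 linear0l.
have [mf fi] := (L2P f).1 Lf; have [mg gi] := (L2P g).1 Lg.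
apply: (@le_vn2_L2 _ (fun z => 2 * sqn a * vn2 (f z) + 2 * vn2 (g z))).
- exact: wmeasurable_lin.
- have h1 := integrableZl measurableT (2 * sqn a) fi.
  have h2 := integrableZl measurableT 2 gi.
  exact: (integrableD measurableT h1 h2).
- move=> z; rewrite -mulrA -[sqn a * _](@n2Z R (vecH V)).
  exact: (@n2D_le R (vecH V)).
Qed.

HB.instance Definition _ :=
  GRing.isSubmodClosed.Build R[i] (circle R -> V) L2pred
    (GRing.submod_closed_semi L2_submod).

Record L2t := MkL2t { l2fun :> circle R -> V; l2funP : l2fun \in L2pred }.

HB.instance Definition _ := [isSub for l2fun].
HB.instance Definition _ := [Choice of L2t by <:].
HB.instance Definition _ := [SubChoice_isSubZmodule of L2t by <:].
HB.instance Definition _ := [SubZmodule_isSubLmodule of L2t by <:].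

End SquareIntegrable.

Arguments L2t {R} V.

Section L2Space.
Context (R : realType) (V : sepHilbert R).
Local Notation mu := (@circle_mu R).
Implicit Types (f g h : L2t V).

Lemma l2_L2 f : L2 V f.
Proof. exact/asboolP/(l2funP f). Qed.

Definition toL2 (f : circle R -> V) (Lf : L2 V f) : L2t V :=
  MkL2t (introT (asboolP _) Lf).

Lemma l2P a f g z : (a *: f + g) z = a *: f z + g z.
Proof. by []. Qed.

Lemma l2D f g z : (f + g) z = f z + g z.
Proof. by []. Qed.

Lemma l2B f g z : (f - g) z = f z - g z.
Proof. by []. Qed.

Lemma l2_wm f : wmeasurable f.
Proof. by case: (l2_L2 f). Qed.

Lemma l2_int f : mu.-integrable setT (EFin \o (fun z => vn2 (f z))).
Proof. by case: ((L2P f).1 (l2_L2 f)). Qed.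

Lemma dot_cintegrable f g : cintegrable (fun z => dotp (f z) (g z)).
Proof.
apply: (@le_cintegrable _ _ (fun z => vn2 (f z) + vn2 (g z))).
- by apply: cmeasurable_dot; exact: l2_wm.
- exact: (integrableD measurableT (l2_int f) (l2_int g)).
- move=> z; apply: le_trans (@cauchy_schwarz R (vecH V) (f z) (g z)) _.
  rewrite -[n2 _]/(vn2 (f z)) -[n2 _]/(vn2 (g z)).
  have := dotp_Re_ge0 (f z); have := dotp_Re_ge0 (g z); nra.
Qed.

Definition l2ip f g : R[i] := L2dot f g.

Lemma l2ipPl a f g h : l2ip (a *: f + g) h = a * l2ip f h + l2ip g h.
Proof.
rewrite /l2ip /L2dot -cintegralZ; last exact: dot_cintegrable.
rewrite -cintegralD; [|exact/cintegrableZ/dot_cintegrable|exact: dot_cintegrable].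
by congr cintegral; apply/funext => z; rewrite l2P dotpPl.
Qed.

Lemma l2ipC f g : l2ip f g = (l2ip g f)^*.
Proof.
rewrite /l2ip /L2dot -cintegralJ; last exact: dot_cintegrable.
by congr cintegral; apply/funext => z; rewrite dotpC.
Qed.

Definition l2n2 f : R := complex.Re (l2ip f f).

Lemma l2n2E f : l2n2 f = \int[mu]_z vn2 (f z).
Proof. by []. Qed.

Lemma l2n2_fin f : (\int[mu]_z (vn2 (f z))%:E)%E = (l2n2 f)%:E.
Proof.
rewrite l2n2E /Rintegral fineK//; apply: integrable_fin_num => //.
exact: l2_int.
Qed.

Lemma l2n2_ge0 f : 0 <= complex.Re (l2ip f f).
Proof.
rewrite -lee_fin -/(l2n2 f) -l2n2_fin; apply: integral_ge0 => z _.
by rewrite lee_fin dotp_Re_ge0.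
Qed.

Lemma sqrL2norm_l2 f : sqrL2norm f = (l2n2 f)%:E.
Proof. by rewrite sqrL2normE l2n2_fin. Qed.

Lemma l2n2_le f (r : circle R -> R) : mu.-integrable setT (EFin \o r) ->
  (forall z, vn2 (f z) <= r z) -> l2n2 f <= \int[mu]_z r z.
Proof.
by move=> ir fr; rewrite l2n2E; apply: le_Rintegral => //; exact: l2_int.
Qed.

End L2Space.

(** * Completeness of the space of square integrable functions *)

Section RieszFischer.
Context (R : realType) (V : sepHilbert R).
Local Notation mu := (@circle_mu R).

Lemma l2n2_le_ae (f : L2t V) (r : circle R -> R) :
  mu.-integrable setT (EFin \o r) -> (forall z, 0 <= r z) ->
  {ae mu, forall z, vn2 (f z) <= r z} -> l2n2 f <= \int[mu]_z r z.
Proof.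
move=> ir r0 fr; rewrite -lee_fin -l2n2_fin /Rintegral fineK; last first.
  exact: integrable_fin_num.
apply: ae_ge0_le_integral => //.
- by move=> z _; rewrite lee_fin dotp_Re_ge0.
- exact: measurable_int (l2_int f).
- by move=> z _; rewrite lee_fin.
- exact: measurable_int ir.
- by apply: filterS fr => z h _; rewrite lee_fin.
Qed.

Lemma l2n2D_le (f g : L2t V) : l2n2 (f + g) <= 2 * l2n2 f + 2 * l2n2 g.
Proof.
rewrite !l2n2E -!RintegralZl//; [|exact: l2_int|exact: l2_int].
have h1 := integrableZl measurableT 2 (l2_int f).
have h2 := integrableZl measurableT 2 (l2_int g).
rewrite -RintegralD//; apply: l2n2_le; first exact: (integrableD measurableT h1 h2).
by move=> z; exact: (@n2D_le R (vecH V)).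
Qed.

Lemma cvg_4V : (4 ^+ n)^-1 @[n --> \oo] --> (0 : R).
Proof.
under eq_fun do rewrite -exprVn.
by apply: cvg_expr; rewrite ger0_norm ?invr_ge0// invf_lt1// ltr1n.
Qed.

Lemma small_4V (c e : R) : 0 < e -> exists n, c * (4 ^+ n)^-1 < e.
Proof.
move=> e0; have : c * (4 ^+ n)^-1 @[n --> \oo] --> (0 : R).
  by rewrite -[0](mulr0 c); apply: cvgM; [exact: cvg_cst|exact: cvg_4V].
move=> /cvgrPdist_lt/(_ _ e0)[k _ /(_ k (leqnn k))].
by rewrite sub0r normrN => h; exists k; exact: le_lt_trans (ler_norm _) h.
Qed.

(** A subsequence [v] with summable increments [4 ^ j * ||v (j + 1) - v j|| ^ 2]
    converges almost everywhere, with a rate dominated by the sum. *)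
Lemma l2_complete (u : nat -> L2t V) : qcauchy (fun x => complex.Re (l2ip x x)) u ->
  exists x, qcvg (fun x => complex.Re (l2ip x x)) u x.
Proof.
rewrite -/(@l2n2 R V) => cu.
pose r j : R := (2 ^+ j.+1)^-1 * (4 ^+ j)^-1.
have r0 j : 0 < r j by rewrite mulr_gt0// invr_gt0 exprn_gt0.
have /choice[K hK] : forall j, exists k, forall m n, (k <= n)%N -> (n <= m)%N ->
    l2n2 (u m - u n) < r j by move=> j; exact: cu.
(* Partial sums of [K] dominate [K] and are nondecreasing. *)
pose k j := (\sum_(i < j.+1) K i)%N.
have kK j : (K j <= k j)%N by rewrite /k big_ord_recr leq_addl.
have kS j : (k j <= k j.+1)%N by rewrite [X in (_ <= X)%N]/k big_ord_recr leq_addr.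
pose v j := u (k j).
pose g j z := vn2 (v j.+1 z - v j z).
have g0 j z : 0 <= g j z by exact: dotp_Re_ge0.
have mg j : measurable_fun setT (g j).
  by apply: (@measurable_vn2 R V (v j.+1 - v j)); exact: l2_wm.
have g_int j : (\int[mu]_z (g j z)%:E <= (r j)%:E)%E.
  rewrite -[X in (X <= _)%E]/(\int[mu]_z (vn2 ((v j.+1 - v j) z))%:E)%E l2n2_fin.
  by rewrite lee_fin ltW// hK// kK.
pose S z : \bar R := (\sum_(0 <= j <oo) (4 ^+ j * g j z)%:E)%E.
have S_ge0 j z : (0 <= (4 ^+ j * g j z)%:E)%E.
  by rewrite lee_fin mulr_ge0// exprn_ge0.
have mS_ j : measurable_fun setT (fun z => (4 ^+ j * g j z)%:E).
  apply/measurable_EFinP; apply: measurable_funM; last exact: mg.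
  exact: measurable_cst.
have mS : measurable_fun setT S by apply: ge0_emeasurable_sum => // *.
have S0 z : (0 <= S z)%E by exact: nneseries_ge0.
have intS : (\int[mu]_z S z < +oo)%E.
  apply: (@le_lt_trans _ _ 1%E); last exact: ltry.
  rewrite integral_nneseries//.
  apply: (le_trans (@lee_nneseries _ _ (fun j => (1 / (2 ^ j.+1)%:R)%:E) _ _ _ _)).
  - by move=> j _ _; exact: integral_ge0.
  - move=> j _; under eq_integral do rewrite EFinM.
    rewrite ge0_integralZl//=; last 2 first.
    + exact/measurable_EFinP.
    + by move=> z _; rewrite lee_fin.
    apply: (@le_trans _ _ ((4 ^+ j)%:E * (r j)%:E)%E).
      by apply: lee_wpmul2l; [rewrite lee_fin exprn_ge0|exact: g_int].
    rewrite -EFinM lee_fin natrX /r mulrCA mulfV ?mulr1 ?div1r//.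
  - by apply: epsilon_trick0.
pose A := [set z | (S z < +oo)%E].
have mA : measurable A.
  by rewrite -[A]setTI; exact: emeasurable_fun_infty_o.
have aeA : {ae mu, forall z, A z}.
  have iS : mu.-integrable setT S.
    apply/integrableP; split=> //.
    by under eq_integral do rewrite gee0_abs//.
  apply: filterS (integrable_ae measurableT iS) => z /(_ I) Sf.
  by rewrite /A /= ltey_eq Sf.
pose s z := if `[< A z >] then fine (S z) else 0.
have s0 z : 0 <= s z by rewrite /s; case: ifP => // _; rewrite fine_ge0.
have is_ : mu.-integrable setT (EFin \o s).
  apply: (@le_integrable _ _ _ _ _ _ _ S) => //.
  - apply/measurable_EFinP; apply: measurable_fun_ifT => //.
      apply: (measurable_fun_bool true); rewrite setTI.
      by rewrite (_ : _ @^-1` _ = A)//; apply/seteqP; split=> z /= /asboolP.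
    exact: measurableT_comp.
  - move=> z _; rewrite /= ger0_norm// gee0_abs// /s.
    case: asboolP => // Az; rewrite fineK// ge0_fin_numE//.
  - apply/integrableP; split=> //.
    by under eq_integral do rewrite gee0_abs//.
have g_le j z : A z -> g j z <= s z * (4 ^+ j)^-1.
  move=> Az; rewrite ler_pdivlMr ?exprn_gt0// mulrC /s; case: asboolP => // _.
  rewrite -lee_fin fineK ?ge0_fin_numE//.
  apply: le_trans (nneseries_lim_ge j.+1 _); last by move=> *.
  by rewrite big_nat_recr //= leeDr// sume_ge0.
have vle z n d : A z ->
    vn2 (v (n + d)%N z - v n z) <= 4 * s z * (4 ^+ n)^-1.
  move=> Az; elim: d n => [|d IH] n.
    rewrite addn0 subrr /vn2 linear0l mulr_ge0 ?invr_ge0 ?exprn_ge0//.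
    by rewrite mulr_ge0.
  rewrite -addSnnS (_ : _ - _ = (v (n.+1 + d)%N z - v n.+1 z) +
    (v n.+1 z - v n z)); last by rewrite addrA subrK.
  apply: le_trans (@n2D_le R (vecH V) _ _) _.
  have h1 := IH n.+1; have h2 := g_le n z Az.
  have -> : 4 * s z / 4 ^+ n = 2 * (4 * s z / 4 ^+ n.+1) + 2 * (s z / 4 ^+ n).
    rewrite exprS invfM.
    by field; rewrite expf_neq0.
  by apply: lerD; rewrite ler_pM2l.
(* Off the set [A] of convergence the limit is set to zero, which keeps it
     measurable. *)
pose f z : V := if `[< A z >] then xget 0 [set x | qcvg (@vn2 R V) (v ^~ z) x]
  else 0.
have fcvg z : A z -> qcvg (@vn2 R V) (v ^~ z) (f z).
  move=> Az; rewrite /f; case: asboolP => // _.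
  suff [x hx] : exists x, qcvg (@vn2 R V) (v ^~ z) x.
    by case: xgetP => [//|/(_ x)/(_ hx)].
  apply: sep_complete => e e0; have [j hj] := small_4V (4 * s z) e0.
  exists j => m n jn nm; apply: le_lt_trans hj.
  rewrite -(subnKC nm); apply: le_trans (vle z n _ Az) _.
  rewrite ler_wpM2l ?mulr_ge0// lef_pV2 ?posrE ?exprn_gt0//.
  by rewrite ler_weXn2l// ler1n.
have fle z n : A z -> vn2 (f z - v n z) <= 4 * s z * (4 ^+ n)^-1.
  move=> Az; have h : @ncvg R (vecH V) (fun m => v m z - v n z) (f z - v n z).
    rewrite /ncvg /qcvg; under eq_fun => m.
      rewrite (_ : v m z - v n z - (f z - v n z) = v m z - f z); last first.
        by rewrite opprB addrA subrK.
      over.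
    exact: fcvg.
  have [hr _] := ip_cvg h h.
  apply: ler_cvg_to hr (cvg_cst _) _; near=> m.
  rewrite -(@subnKC n m); last by near: m; exists n.
  exact: vle.
have wf : wmeasurable f.
  move=> x; pose F n z := if `[< A z >] then dotp (v n z) x else 0.
  apply: (@cmeasurable_lim _ F) => [n|z].
    by apply: cmeasurable_if => //; exact: l2_wm.
  rewrite /F; case: asboolP => Az.
    exact: (@ip_cvg R (vecH V) _ (fun=> x) _ _ (fcvg z Az) (ncvg_cst _)).
  rewrite /f; case: asboolP => // _; rewrite linear0l.
  by split; exact: cvg_cst.
have Lf : L2 V f.
  apply: (@le_vn2_L2 _ _ f (fun z => 2 * vn2 (v 0%N z) + 2 * (4 * s z))) => //.
    have h1 := integrableZl measurableT 2 (l2_int (v 0%N)).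
    have h2 := integrableZl measurableT 2 (integrableZl measurableT 4 is_).
    exact: (integrableD measurableT h1 h2).
  move=> z; have [Az|nAz] := pselect (A z).
    rewrite -[f z](subrK (v 0%N z)) addrC.
    apply: le_trans (@n2D_le R (vecH V) _ _) _.
    by rewrite lerD2l ler_pM2l//; have := fle z 0%N Az; rewrite expr0 invr1 mulr1.
  rewrite /f; case: asboolP => // _; rewrite /vn2 linear0l addr_ge0//.
    by rewrite mulr_ge0// dotp_Re_ge0.
  by rewrite !mulr_ge0.
exists (toL2 Lf); set x := toL2 Lf.
pose I := \int[mu]_z s z.
have xv n : l2n2 (x - v n) <= 4 * (4 ^+ n)^-1 * I.
  rewrite /I -RintegralZl//; apply: l2n2_le_ae.
  - exact: (integrableZl measurableT _ is_).
  - by move=> z; rewrite !mulr_ge0// invr_ge0 exprn_ge0.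
  - by apply: filterS aeA => z Az; rewrite mulrAC; exact: fle.
have I0 : 0 <= I by apply: Rintegral_ge0 => z _.
have uNx m : l2n2 (u m - x) = l2n2 (x - u m).
  rewrite /l2n2; congr complex.Re; rewrite /l2ip /L2dot; congr cintegral.
  apply/funext => z; rewrite !l2B.
  by rewrite -opprB linearNl linearNr opprK.
apply/cvgrPdist_lt => e e0.
have [n hn] := small_4V (8 * I + 2) e0.
exists (k n) => // m /= nm; rewrite sub0r normrN ger0_norm; last exact: l2n2_ge0.
rewrite (_ : u m - x = (u m - v n) + (v n - x)); last by rewrite addrA subrK.
apply: le_lt_trans (l2n2D_le _ _) _; apply: le_lt_trans hn.
have h1 : l2n2 (u m - v n) <= (4 ^+ n)^-1.
  apply: le_trans (ltW (hK n m (k n) (kK n) nm)) _; rewrite /r ger_pMl ?invr_gt0 ?exprn_gt0//.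
  by rewrite invf_le1 ?exprn_gt0// exprn_ege1// ler1n.
have h2 := xv n; rewrite -uNx in h2.
have -> : l2n2 (v n - x) = l2n2 (u (k n) - x) by [].
by move: h1 h2; rewrite uNx; move: (l2n2 _) (l2n2 _) (4 ^+ n)^-1 => a b c; nra.
Unshelve. all: by end_near. Qed.

Definition L2H : semiHilbert R :=
  SemiHilbert (@l2ipPl R V) (@l2ipC R V) (@l2n2_ge0 R V) l2_complete.

End RieszFischer.

(** * Integration over the circle and Fourier coefficients *)

Section CircleIntegral.
Context (R : realType).
Local Notation mu := (@circle_mu R).
Local Notation leb := (@lebesgue_measure R).
Local Notation I01 := (`[0 : R, 1[%classic).

Let mI : measurable I01. Proof. exact: measurable_itv. Qed.

Let nu := mrestr leb (measurable_itv `[0 : R, 1[).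

Let nuM : {measure set (measurableTypeR R) -> \bar R} := nu.

Lemma ge0_integral_mrestr (h : R -> \bar R) : measurable_fun setT h ->
  (forall t, 0 <= h t)%E ->
  (\int[nu]_t h t = \int[leb]_(t in I01) h t)%E.
Proof.
move=> mh h0.
have nN : nu (~` I01) = 0%E by rewrite /nu /mrestr setICl measure0.
rewrite -(setUv I01) ge0_integral_setU//=; last 3 first.
- exact: measurableC.
- by rewrite setUv.
- exact/disj_set2P/setICr.
rewrite [X in (_ + X)%E](_ : _ = 0%E) ?adde0.
  by apply: eq_measure_integral => A mA AI; rewrite /nu /= /mrestr setIidl.
apply: null_set_integral => //; first exact: measurableC.
exact: measurable_funTS.
Qed.

Lemma ge0_circle_integral (f : circle R -> \bar R) : measurable_fun setT f ->
  (forall z, 0 <= f z)%E ->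
  (\int[mu]_z f z = \int[leb]_(t in I01) f (expi t))%E.
Proof.
move=> mf f0; have me : measurable_fun [set: measurableTypeR R] (@expi R).
  exact: measurable_expi.
have := @ge0_integral_pushforward _ _ _ _ _ _ me nuM setT f measurableT mf (fun z _ => f0 z).
move=> /= h; rewrite [LHS]h.
by rewrite preimage_setT ge0_integral_mrestr.
Qed.

Lemma circle_integrable (f : circle R -> R) :
  mu.-integrable setT (EFin \o f) ->
  leb.-integrable I01 (EFin \o (f \o @expi R)).
Proof.
move=> /integrableP[mf If]; apply/integrableP; split.
  apply: measurable_funTS; apply/measurable_EFinP.
  apply: measurableT_comp; last exact: measurable_expi.
  exact/measurable_EFinP.
move: If; rewrite ge0_circle_integral//.
by apply: measurableT_comp => //; exact/measurable_EFinP.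
Qed.

Lemma circle_Rintegral (f : circle R -> R) :
  mu.-integrable setT (EFin \o f) ->
  \int[mu]_z f z = \int[leb]_(t in I01) f (expi t).
Proof.
move=> fi; have [mf _] := integrableP _ _ _ fi.
rewrite /Rintegral; congr fine; rewrite integralE [RHS]integralE.
rewrite ge0_circle_integral//; last exact: measurable_funepos.
rewrite [X in (_ - X)%E]ge0_circle_integral//; last exact: measurable_funeneg.
by congr (_ - _)%E; apply: eq_integral => t _; 
  rewrite ?funeposE ?funenegE.
Qed.

Lemma cval_expi (t : R) :
  cval (expi t) = (cos (2 * pi * t) +i* sin (2 * pi * t))%C.
Proof. by []. Qed.

Lemma de_moivre (x : R) n :
  ((cos x +i* sin x)%C : R[i]) ^+ n = (cos (n%:R * x) +i* sin (n%:R * x))%C.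
Proof.
elim: n => [|n IH].
  by rewrite expr0 mul0r cos0 sin0.
rewrite exprS IH; apply: eqC; rewrite ?ReM ?ImM /=.
  by rewrite -natr1 mulrDl mul1r cosD; ring.
by rewrite -natr1 mulrDl mul1r sinD; ring.
Qed.

Lemma measurable_cval : cmeasurable (@cval R).
Proof.
have me (h : R -> R) : continuous h -> measurable_fun setT
    (fun t : R => h (2 * pi * t)).
  move=> ch; apply: continuous_measurable_fun => t.
  apply: continuous_comp; last exact: ch.
  exact: mulrl_continuous.
have mc (h : circle R -> R) : measurable_fun setT (h \o @expi R) ->
    measurable_fun setT h.
  move=> mh _ Y mY; rewrite setTI.
  by have := mh measurableT Y mY; rewrite setTI.
split; apply: mc.
  exact: (me cos (@continuous_cos R)).
exact: (me sin (@continuous_sin R)).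
Qed.

Lemma sqn_cval (z : circle R) : sqn (cval z) = 1.
Proof.
have := norm_cval z; rewrite normc_def => /eqP h.
have := congr1 (@complex.Re R) h => /= /(congr1 (fun x => x ^+ 2)).
by rewrite sqr_sqrtr ?sqn_ge0 // expr1n.
Qed.

Lemma cval_mulJ (z : circle R) : cval z * (cval z)^* = 1.
Proof. by rewrite mulJ sqn_cval. Qed.

Lemma sqn_cvalX (z : circle R) n : sqn (cval z ^+ n) = 1.
Proof.
elim: n => [|n IH]; last by rewrite exprS sqnM IH sqn_cval mulr1.
by rewrite expr0 /sqn /= expr0n expr1n addr0.
Qed.

Lemma cmeasurable_cvalX n : cmeasurable (fun z : circle R => cval z ^+ n).
Proof.
elim: n => [|n IH].
  by under eq_fun do rewrite expr0; exact: cmeasurable_cst.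
by under eq_fun do rewrite exprS; apply: cmeasurableM => //; exact: measurable_cval.
Qed.

Lemma cintegrable_cvalX n : cintegrable (fun z : circle R => cval z ^+ n).
Proof.
apply: (@cintegrable_bounded _ _ 1) => [|z]; first exact: cmeasurable_cvalX.
by rewrite sqn_cvalX expr1n.
Qed.

Lemma cintegral_cvalX n : cintegral (fun z : circle R => cval z ^+ n.+1) = 0.
Proof.
have [i1 i2] := cintegrable_cvalX n.+1.
pose w : R := n.+1%:R * (2 * pi).
have w0 : w != 0 by rewrite !mulf_neq0// gt_eqF// pi_gt0.
have E (t : R) : cval (expi t) ^+ n.+1 = (cos (w * t) +i* sin (w * t))%C.
  by rewrite cval_expi de_moivre mulrA.
have cw (h : R -> R) : continuous h -> continuous (fun t => h (w * t)).
  move=> ch t; apply: continuous_comp; last exact: ch.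
  exact: mulrl_continuous.
have dw (t : R) : is_derive t 1 ( *%R w) w.
  by apply: is_derive_eq; rewrite /GRing.scale /= mulr1.
have F2 (f F : R -> R) : continuous f -> (forall t : R, is_derive t 1 F (f t)) ->
    F 0 = F 1 -> (\int[leb]_(t in `[0%R, 1%R]) (f t)%:E)%E = 0%E.
  move=> cf dF F01; rewrite (@continuous_FTC2 _ f F)//.
  - by rewrite F01 subee.
  - exact: continuous_subspaceT.
  - have cF : continuous F.
      move=> t; apply: differentiable_continuous; apply/derivable1_diffP.
      by have [] := dF t.
    split; first by move=> t _; have [] := dF t.
      exact/cvg_at_right_filter/cF.
    exact/cvg_at_left_filter/cF.
  - by move=> t _; rewrite derive1E; have [_ ->] := dF t.
have c1 : cos w = 1 by rewrite /w !mulr_natl -[_ *+ n.+1]add0r (periodicn (@cosD2pi R)) cos0.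
have s1 : sin w = 0 by rewrite /w !mulr_natl -[_ *+ n.+1]add0r (periodicn (@sinD2pi R)) sin0.
apply: eqC => /=; rewrite circle_Rintegral// Rintegral_itv_bndo_bndc.
- rewrite /Rintegral; under eq_integral do rewrite E /=.
  rewrite [X in fine X](_ : _ = 0%E)//.
  apply: (F2 _ (fun t => w^-1 * sin (w * t))).
  + exact/cw/continuous_cos.
  + move=> t; have h := @is_deriveZ _ _ _ _ w^-1 t 1 _
      (is_derive1_comp (is_derive_sin (w * t)) (dw t)).
    by apply: is_derive_eq h _; rewrite /GRing.scale /=; field.
  + by rewrite mulr0 mulr1 s1 sin0.
- exact: (circle_integrable i1).
- rewrite /Rintegral; under eq_integral do rewrite E /=.
  rewrite [X in fine X](_ : _ = 0%E)//.
  apply: (F2 _ (fun t => w^-1 * - cos (w * t))).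
  + exact/cw/continuous_sin.
  + move=> t; have h := @is_deriveZ _ _ _ _ w^-1 t 1 _ (is_deriveN
      (is_derive1_comp (is_derive_cos (w * t)) (dw t))).
    by apply: is_derive_eq h _; rewrite /GRing.scale /=; field.
  + by rewrite mulr0 mulr1 c1 cos0.
- exact: (circle_integrable i2).
Qed.

End CircleIntegral.

(** * Complex conjugation on the circle *)

Section Reflection.
Context (R : realType).
Local Notation mu := (@circle_mu R).
Local Notation leb := (@lebesgue_measure R).
Local Notation I01 := (`[0 : R, 1[%classic).

Definition onem_refl (t : measurableTypeR R) : measurableTypeR R := 1 - t.

Lemma measurable_onem_refl : measurable_fun setT onem_refl.
Proof. by apply: measurable_funB => //; exact: measurable_id. Qed.

Lemma lebesgue_reflection (A : set R) : measurable A ->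
  leb ((fun t => 1 - t) @^-1` A) = leb A.
Proof.
move=> mA.
pose nu : {measure set (measurableTypeR R) -> \bar R} := pushforward leb onem_refl.
suff -> : leb A = nu measurable_onem_refl A by [].
apply: lebesgue_measure_unique => //= _ [[a b]] _ <-.
rewrite /nu /= /pushforward /onem_refl /=.
rewrite (_ : _ @^-1` _ = `[1 - b, 1 - a[%classic); last first.
  by apply/seteqP; split=> t /=; rewrite !in_itv /=; lra.
rewrite !lebesgue_measure_itv /= !lte_fin ltrD2l ltrN2.
by case: ifP => // _; rewrite -!EFinD; congr (_%:E); ring.
Qed.

Lemma circle_muE (A : set (circle R)) :
  mu A = leb ((@expi R) @^-1` A `&` I01).
Proof. by []. Qed.

Lemma conj_expi (t : R) : circle_conj (expi t) = expi (1 - t).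
Proof.
apply: val_inj; rewrite /= !mulrBr mulr1 mulr_natl addrC.
rewrite (periodicn (@cosD2pi R) 1) (periodicn (@sinD2pi R) 1).
by rewrite cosN sinN.
Qed.

Lemma measurable_circle_conj : measurable_fun setT (@circle_conj R).
Proof.
move=> _ A mA; rewrite setTI.
rewrite /measurable /= /circle_measurable /= -comp_preimage.
have -> : (@circle_conj R) \o (@expi R) = (@expi R) \o (fun t => 1 - t).
  by apply/funext => t; exact: conj_expi.
rewrite comp_preimage -[X in measurable X]setTI.
have : measurable_fun setT (fun t : R => 1 - t).
  by apply: measurable_funB => //; exact: measurable_id.
exact.
Qed.

(** In the angle, conjugation is the reflection [t |-> 1 - t]; it maps the
    half-open unit interval to one that differs from it by two points. *)
Lemma circle_mu_conj (A : set (circle R)) : measurable A ->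
  mu ((@circle_conj R) @^-1` A) = mu A.
Proof.
move=> mA; rewrite !circle_muE -comp_preimage.
have -> : (@circle_conj R) \o (@expi R) = (@expi R) \o (fun t => 1 - t).
  by apply/funext => t; exact: conj_expi.
rewrite comp_preimage; set B := (@expi R) @^-1` A.
have mB : measurable B by exact: mA.
have -> : (fun t => 1 - t) @^-1` B `&` I01 =
    (fun t => 1 - t) @^-1` (B `&` `]0, 1]%classic).
  by apply/seteqP; split=> t /=; rewrite !in_itv /= => -[Bt]; split=> //; lra.
have mBo : measurable (B `&` `]0, 1]%classic).
  by apply: measurableI => //; exact: measurable_itv.
have mBc : measurable (B `&` I01).
  by apply: measurableI => //; exact: measurable_itv.
rewrite lebesgue_reflection//; apply/eqP; rewrite eq_le; apply/andP; split.
  apply: (@le_trans _ _ (leb ((B `&` I01) `|` [set 1]))).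
    apply: le_measure; rewrite ?inE//.
      by apply: measurableU => //; exact: measurable_set1.
    move=> t [Bt]; rewrite /= !in_itv /= => /andP[t0].
    rewrite le_eqVlt => /orP[/eqP ->|t1]; [by right|left].
    by split=> //; rewrite /= ?in_itv /= ?(ltW t0) ?t1.
  have hU := @measureU2 _ (measurableTypeR R) R leb _ _ mBc (measurable_set1 (1 : R)).
  apply: (le_trans hU).
  by rewrite [X in (_ + X)%E](lebesgue_measure_set1 (1 : R)) adde0.
apply: (@le_trans _ _ (leb ((B `&` `]0, 1]%classic) `|` [set 0]))).
  apply: le_measure; rewrite ?inE//.
    by apply: measurableU => //; exact: measurable_set1.
  move=> t [Bt]; rewrite /= !in_itv /= => /andP[].
  rewrite le_eqVlt => /orP[/eqP <-|t0 t1]; [by right|left].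
  by split=> //; rewrite /= ?in_itv /= ?t0 ?(ltW t1).
have hU := @measureU2 _ (measurableTypeR R) R leb _ _ mBo (measurable_set1 (0 : R)).
apply: (le_trans hU).
by rewrite [X in (_ + X)%E](lebesgue_measure_set1 (0 : R)) adde0.
Qed.

Lemma ge0_integral_conj (f : circle R -> \bar R) : measurable_fun setT f ->
  (forall z, 0 <= f z)%E ->
  (\int[mu]_z f (circle_conj z) = \int[mu]_z f z)%E.
Proof.
move=> mf f0.
have := @ge0_integral_pushforward _ _ _ _ _ _ measurable_circle_conj mu setT f
  measurableT mf (fun z _ => f0 z).
rewrite preimage_setT => <-; apply: eq_measure_integral; first exact: measurable_circle_conj.
by move=> ? A mA _; exact: circle_mu_conj.
Qed.

Lemma cintegral_conj (f : circle R -> R[i]) : cintegrable f ->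
  cintegral (f \o @circle_conj R) = cintegral f.
Proof.
move=> fi; have mf := cintegrable_meas fi.
have H (g : circle R -> R) : mu.-integrable setT (EFin \o g) ->
    \int[mu]_z g (circle_conj z) = \int[mu]_z g z.
  move=> /integrableP[mg _].
  rewrite /Rintegral; congr fine; rewrite integralE [RHS]integralE.
  have := ge0_integral_conj (measurable_funepos mg) (funepos_ge0 _).
  have := ge0_integral_conj (measurable_funeneg mg) (funeneg_ge0 _).
  move=> h1 h2; rewrite -h1 -h2; congr (_ - _)%E; apply: eq_integral => z _.
    by rewrite !funeposE.
  by rewrite !funenegE.
case: fi => f1 f2.
by apply: eqC; rewrite /cintegral /=; [exact: (H _ f1)|exact: (H _ f2)].
Qed.

End Reflection.

(** * Uniqueness of Fourier coefficients *)

Section IndicatorApproximation.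
Context (R : realType).
Implicit Types (x y : R).

Lemma bernoulli_le y m : 0 <= y <= 1 -> 1 - m%:R * y <= (1 - y) ^+ m.
Proof.
move=> /andP[y0 y1]; elim: m => [|m IH]; first by rewrite mul0r subr0 expr0.
rewrite exprS -natr1; apply: le_trans (_ : (1 - y) * (1 - m%:R * y) <= _).
  by have := mulr_ge0 (ler0n R m) (sqr_ge0 y); rewrite expr2; nra.
by rewrite ler_wpM2l// subr_ge0.
Qed.

Lemma bernoulli_mul_le1 y m : 0 <= y <= 1 -> (1 - y) ^+ m * (1 + m%:R * y) <= 1.
Proof.
move=> /andP[y0 y1]; elim: m => [|m IH]; first by rewrite mul0r addr0 expr0 mulr1.
rewrite exprS -natr1 -mulrA mulrCA; apply: le_trans IH.
rewrite ler_wpM2l ?exprn_ge0 ?subr_ge0//.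
by have := mulr_ge0 (ler0n R m) (sqr_ge0 y); have := sqr_ge0 y; rewrite expr2; nra.
Qed.

(** The Brosowski-Deutsch polynomials: they tend to 1 where [x < 1 / 2] and to
    0 where [x > 1 / 2], by the two Bernoulli inequalities above. *)
Definition step_poly x n := (1 - x ^+ n) ^+ (2 ^ n).

Lemma step_poly_ge0 x n : 0 <= x <= 1 -> 0 <= step_poly x n.
Proof.
by move=> /andP[x0 x1]; rewrite exprn_ge0// subr_ge0 exprn_ile1.
Qed.

Lemma step_poly_le1 x n : 0 <= x <= 1 -> step_poly x n <= 1.
Proof.
move=> /andP[x0 x1]; rewrite exprn_ile1// ?subr_ge0 ?exprn_ile1//.
by rewrite lerBlDr lerDl exprn_ge0.
Qed.

Lemma step_poly_cvg1 x : 0 <= x -> x < 2^-1 ->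
  step_poly x n @[n --> \oo] --> (1 : R).
Proof.
move=> x0 x2; have h : 1 - (2 * x) ^+ n @[n --> \oo] --> (1 : R).
  rewrite -[X in _ --> X]subr0; apply: cvgB; first exact: cvg_cst.
  by apply: cvg_expr; rewrite ger0_norm ?mulr_ge0//; lra.
apply: squeeze_cvgr h (cvg_cst (1 : R)); apply: nearW => n.
have x1 : 0 <= x <= 1 by rewrite x0 /=; lra.
rewrite step_poly_le1 ?andbT//.
have := @bernoulli_le (x ^+ n) (2 ^ n); rewrite natrX -exprMn; apply.
by case/andP: x1 => *; rewrite exprn_ge0//= exprn_ile1.
Qed.

Lemma step_poly_cvg0 x : x <= 1 -> 2^-1 < x ->
  step_poly x n @[n --> \oo] --> (0 : R).
Proof.
move=> x1 x2; have x0 : 0 < 2 * x by lra.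
have h : (2 * x)^-1 ^+ n @[n --> \oo] --> (0 : R).
  apply: cvg_expr; rewrite ger0_norm ?invr_ge0 ?ltW// invf_lt1//; lra.
apply: squeeze_cvgr (cvg_cst (0 : R)) h; apply: nearW => n.
have x01 : 0 <= x <= 1 by rewrite x1 andbT; lra.
rewrite step_poly_ge0//=.
have y01 : 0 <= x ^+ n <= 1.
  by case/andP: x01 => *; rewrite exprn_ge0//= exprn_ile1.
have := @bernoulli_mul_le1 (x ^+ n) (2 ^ n) y01; rewrite natrX -exprMn => H.
rewrite exprVn -[leRHS]mul1r ler_pdivlMr ?exprn_gt0//.
apply: le_trans H; rewrite ler_wpM2l ?step_poly_ge0//.
by rewrite lerDr.
Qed.

End IndicatorApproximation.

Section ArcIndicator.
Context (R : realType).
Local Notation leb := (@lebesgue_measure R).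
Local Notation I01 := (`[0 : R, 1[%classic).
Implicit Types (p q t : R).

(** On the unit interval, the set where [arc_poly] is below [1 / 2] is the
    interval between [p] and [q]. The coefficient does not exceed [1 / 2], and so
    [arc_poly] does not exceed 1, when the interval is at least half of the
    period. *)
Definition arc_coef p q : R := (2 * (1 - cos (pi * (q - p))))^-1.

Definition arc_poly p q t : R :=
  arc_coef p q * (1 - cos (2 * pi * (t - (p + q) / 2))).

Lemma cos_pi_lt (x y : R) : 0 <= x <= 1 -> 0 <= y <= 1 ->
  (cos (pi * x) < cos (pi * y)) = (y < x).
Proof.
have pI z : 0 <= z <= 1 -> pi * z \in `[0, @pi R].
  move=> /andP[z0 z1]; rewrite in_itv /= mulr_ge0 ?pi_ge0//=.
  by rewrite -[leRHS]mulr1 ler_wpM2l// pi_ge0.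
by move=> x01 y01; rewrite ltr_cos ?pI// ltr_pM2l// pi_gt0.
Qed.

Lemma cos_arc_le0 p q : 0 <= p -> q <= 1 -> 2^-1 <= q - p ->
  cos (pi * (q - p)) <= 0.
Proof.
move=> p0 q1 pq; rewrite -(@cos_pihalf R) leNgt cos_pi_lt; [|lra|lra].
by rewrite -leNgt.
Qed.

Lemma cos_arc_norm (t c : R) : cos (2 * pi * (t - c)) = cos (pi * (2 * `|t - c|)) :> R.
Proof.
rewrite -cos_norm normrM ger0_norm ?mulr_ge0 ?pi_ge0//.
by congr cos; ring.
Qed.

Lemma arc_coef_bounds p q : 0 <= p -> q <= 1 -> 2^-1 <= q - p ->
  0 < arc_coef p q <= 2^-1.
Proof.
move=> p0 q1 pq; have c0 := cos_arc_le0 p0 q1 pq.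
rewrite /arc_coef invr_gt0 mulr_gt0 ?subr_gt0//=; last lra.
by rewrite lef_pV2 ?posrE ?mulr_gt0//; lra.
Qed.

Lemma arc_poly_bounds p q t : 0 <= p -> q <= 1 -> 2^-1 <= q - p ->
  0 <= arc_poly p q t <= 1.
Proof.
move=> p0 q1 pq; have /andP[s0 s2] := arc_coef_bounds p0 q1 pq.
have := cos_le1 (2 * pi * (t - (p + q) / 2)).
have := cos_geN1 (2 * pi * (t - (p + q) / 2)).
rewrite /arc_poly; set c := cos _ => c1 c2; set s := arc_coef _ _ in s0 s2 *.
by apply/andP; split; [apply: mulr_ge0; lra|nra].
Qed.

Lemma arc_poly_half p q t : 0 <= p -> q <= 1 -> 2^-1 <= q - p ->
  (arc_poly p q t < 2^-1) =
    (cos (pi * (q - p)) < cos (2 * pi * (t - (p + q) / 2))) /\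
  (2^-1 < arc_poly p q t) =
    (cos (2 * pi * (t - (p + q) / 2)) < cos (pi * (q - p))).
Proof.
move=> p0 q1 pq; have c0 := cos_arc_le0 p0 q1 pq.
rewrite /arc_poly /arc_coef; set a := cos (pi * _) in c0 *; set b := cos _.
have a1 : 0 < 2 * (1 - a) by rewrite mulr_gt0// subr_gt0; lra.
clearbody a b.
split; apply/idP/idP.
- by rewrite mulrC ltr_pdivrMr//; move=> h; lra.
- by move=> h; rewrite mulrC ltr_pdivrMr//; lra.
- by rewrite [_ * (1 - b)]mulrC ltr_pdivlMr// => h; lra.
- by move=> h; rewrite [_ * (1 - b)]mulrC ltr_pdivlMr//; lra.
Qed.

Lemma arc_poly_in p q t : 0 <= p -> q <= 1 -> 2^-1 <= q - p ->
  p < t < q -> arc_poly p q t < 2^-1.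
Proof.
move=> p0 q1 pq /andP[pt tq]; rewrite (proj1 (arc_poly_half _ _ _ _))//.
have h : `|t - (p + q) / 2| < (q - p) / 2.
  by rewrite ltr_norml; apply/andP; split; lra.
have s0 := normr_ge0 (t - (p + q) / 2).
rewrite cos_arc_norm; move: (`|_|) s0 h => s s0 h.
by rewrite cos_pi_lt; lra.
Qed.

Lemma arc_poly_out p q t : 0 <= p -> q <= 1 -> 2^-1 <= q - p ->
  0 < t < 1 -> t < p \/ q < t -> 2^-1 < arc_poly p q t.
Proof.
move=> p0 q1 pq /andP[t0 t1] tpq; rewrite (proj2 (arc_poly_half _ _ _ _))//.
rewrite cos_arc_norm; set s := `|t - (p + q) / 2|.
have s0 : 0 <= s by exact: normr_ge0.
have sl : (q - p) / 2 < s.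
  by rewrite /s; case: tpq => h; [rewrite ltr0_norm|rewrite gtr0_norm]; lra.
have su : s < 1 - (q - p) / 2 by rewrite /s ltr_norml; apply/andP; split; lra.
clearbody s.
have [s2|s2] := leP (2 * s) 1; first by rewrite cos_pi_lt; lra.
have -> : cos (pi * (2 * s)) = cos (pi * (2 - 2 * s)).
  by rewrite -cosN -(@cosD2pi R); congr cos; rewrite mulr2n; ring.
by rewrite cos_pi_lt; lra.
Qed.

Lemma continuous_arc_poly p q : continuous (arc_poly p q).
Proof.
move=> t; apply: cvgM; first exact: cvg_cst.
apply: cvgB; first exact: cvg_cst.
apply: (@continuous_comp _ _ _ (fun t => 2 * pi * (t - (p + q) / 2)) cos).
  by apply: cvgM; [exact: cvg_cst|apply: cvgB; [exact: cvg_id|exact: cvg_cst]].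
exact: continuous_cos.
Qed.

(** The polynomials [step_poly (arc_poly p q t) n] are between 0 and 1 and tend
    to the indicator function of the interval, except at its ends. *)
Lemma arc_integral0 p q (phi : R -> R) : 0 <= p -> q <= 1 -> 2^-1 <= q - p ->
  leb.-integrable I01 (EFin \o phi) ->
  (forall n, \int[leb]_(t in I01) (step_poly (arc_poly p q t) n * phi t) = 0) ->
  (\int[leb]_(t in `]p, q[) (phi t)%:E = 0)%E.
Proof.
move=> p0 q1 pq iphi h.
have mI : measurable I01 by exact: measurable_itv.
have mphi : measurable_fun I01 phi.
  by case/integrableP: iphi => /measurable_EFinP.
have ms n : measurable_fun I01 (fun t => step_poly (arc_poly p q t) n).
  apply: measurable_funTS; apply: measurable_funX.
  apply: measurable_funB; first exact: measurable_cst.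
  apply: measurable_funX; apply: continuous_measurable_fun.
  exact: continuous_arc_poly.
have sb t n : `|step_poly (arc_poly p q t) n| <= 1.
  have := arc_poly_bounds t p0 q1 pq => ab.
  by rewrite ger0_norm ?step_poly_ge0// step_poly_le1.
have mU : measurable (`]p, q[%classic : set R) by exact: measurable_itv.
have UI : I01 `&` `]p, q[ = `]p, q[%classic.
  by apply/seteqP; split=> [t []//|t /= ht]; split=> //=; move: ht;
    rewrite !in_itv /=; lra.
rewrite -UI integral_mkcondr.
have mg : measurable_fun I01 ((fun t => (phi t)%:E) \_ `]p, q[).
  apply/measurable_restrict => //; rewrite UI.
  apply/measurable_EFinP; apply: measurable_funS mphi => //.
  by rewrite -UI; exact: subIsetl.
(* At the ends of the interval, and at 0 when [q - p = 1], [arc_poly] can be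
     equal to [1 / 2]. *)
have nN : leb.-negligible ([set 0] `|` [set p] `|` [set q]).
  apply/negligibleP.
    by apply: measurableU; [apply: measurableU|]; exact: measurable_set1.
  apply: countable_lebesgue_measure0; apply: finite_set_countable.
  by rewrite !finite_setU; split; [split|]; exact: finite_set1.
have cv : {ae leb, forall t, I01 t ->
    (step_poly (arc_poly p q t) n * phi t)%:E @[n --> \oo] -->
    ((fun t => (phi t)%:E) \_ `]p, q[) t}.
  apply: negligibleS nN.
  move=> t /= ht; apply: contrapT => /not_orP[/not_orP[/= t0 tp] tq].
  apply: ht; rewrite in_itv /= => /andP[t0' t1].
  have {}t0 : 0 < t by rewrite lt_def t0' andbT; exact/eqP.
  rewrite patchE; case: ifPn => [|]; rewrite ?inE ?notin_setE /= in_itv /= => ht.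
    apply: cvg_EFin; first by apply: nearW.
    have := cvgM (step_poly_cvg1 _ (arc_poly_in p0 q1 pq ht)) (cvg_cst (phi t)).
    rewrite mul1r; apply.
    by have /andP[] := arc_poly_bounds t p0 q1 pq.
  have ht' : t < p \/ q < t.
    move/negP: ht; rewrite negb_and -!leNgt => /orP[] h'; [left|right];
      rewrite lt_neqAle h' andbT; apply/eqP => e; [exact: tp|exact/tq/esym].
  apply: cvg_EFin; first by apply: nearW.
  have t01 : 0 < t < 1 by rewrite t0.
  have /andP[_ a1] := arc_poly_bounds t p0 q1 pq.
  have := cvgM (step_poly_cvg0 a1 (arc_poly_out p0 q1 pq t01 ht')) (cvg_cst (phi t)).
  by rewrite mul0r => hh; exact: hh.
have dom : {ae leb, forall t n, I01 t ->
    (`|(step_poly (arc_poly p q t) n * phi t)%:E| <= `|(phi t)%:E|)%E}.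
  apply: aeW => t n _; rewrite /= lee_fin normrM.
  by rewrite -[leRHS]mul1r ler_wpM2r.
have iabs : leb.-integrable I01 (fun t => `|(phi t)%:E|%E).
  exact: integrable_abse.
have mf n : measurable_fun I01 (fun t => (step_poly (arc_poly p q t) n * phi t)%:E).
  by apply/measurable_EFinP; exact: measurable_funM.
have [_ _ lim0] := @dominated_convergence _ (measurableTypeR R) R leb _ mI
  _ _ _ mf mg cv iabs dom.
apply: (cvg_unique _ lim0) => //=.
rewrite (_ : (fun n => _) = cst 0%E); first exact: cvg_cst.
apply/funext => n /=.
have in_ : leb.-integrable I01 (fun t => (step_poly (arc_poly p q t) n * phi t)%:E).
  apply: le_integrable iabs => //; first exact: mf.
  move=> t It; by rewrite /= ?normr_id lee_fin normrM -[leRHS]mul1r ler_wpM2r.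
rewrite -[LHS]fineK; last exact: integrable_fin_num.
by rewrite -[fine _]/(\int[leb]_(t in I01) (step_poly (arc_poly p q t) n * phi t)) h.
Qed.

End ArcIndicator.

Section FourierUniqueness.
Context (R : realType).
Local Notation mu := (@circle_mu R).
Local Notation leb := (@lebesgue_measure R).
Local Notation I01 := (`[0 : R, 1[%classic).

(** The indefinite integral vanishes, hence so does its derivative. Only
    intervals of length at least [1 / 2] are given; a shorter one starting at 0
    is the difference of the unit interval and a long one. *)
Lemma interval_integral_ae0 (phi : R -> R) :
  leb.-integrable I01 (EFin \o phi) ->
  (forall p q, 0 <= p -> q <= 1 -> 2^-1 <= q - p ->
     \int[leb]_(t in `]p, q[) phi t = 0) ->
  {ae leb, forall t, 0 < t < 1 -> phi t = 0}.
Proof.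
move=> iphi h0.
have mI : measurable I01 by exact: measurable_itv.
have isub (D : set R) : measurable D -> D `<=` I01 ->
    leb.-integrable D (EFin \o phi) by move=> mD DI; exact: integrableS iphi.
have i0c c : 0 < c < 1 -> \int[leb]_(t in `[0, c]) phi t = 0.
  move=> /andP[c0 c1].
  have s1 : `]0, c] `<=` I01.
    by move=> t /=; rewrite !in_itv /=; lra.
  have s2 : `]0, c[ `<=` I01.
    by move=> t /=; rewrite !in_itv /=; lra.
  have s3 : `]0, 1[ `<=` I01.
    by move=> t /=; rewrite !in_itv /=; lra.
  have i1 : leb.-integrable `]0, c] (EFin \o phi).
    by apply: isub => //; exact: measurable_itv.
  have i2 : leb.-integrable `]0, c[ (EFin \o phi).
    by apply: isub => //; exact: measurable_itv.
  have i3 : leb.-integrable `]0, 1[ (EFin \o phi).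
    by apply: isub => //; exact: measurable_itv.
  rewrite -Rintegral_itv_obnd_cbnd//.
  have [c2|c2] := leP 2^-1 c.
    by rewrite -Rintegral_itv_bndo_bndc// h0//; lra.
  have := @Rintegral_itvB R phi (BRight 0) (BLeft 1) c i3.
  rewrite !bnd_simp => /(_ (ltW c0) c1).
  rewrite h0//; last by lra.
  rewrite h0//; [|lra|lra].
  by rewrite sub0r => /eqP; rewrite oppr_eq0 => /eqP.
pose h := phi \_ I01.
have hE : EFin \o h = (EFin \o phi) \_ I01.
  by apply/funext => t; rewrite /h restrict_EFin.
have ih : leb.-integrable setT (EFin \o h).
  by rewrite hE; have [+ _] := @integrable_mkcond _ (measurableTypeR R) R leb I01 (EFin \o phi) mI;
    exact.
have := @FTC1 R h (BLeft 0) _ _.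
have H1 y : leb.-integrable [set` Interval (BLeft (0 : R)) (BRight y)] (EFin \o h).
  by apply: integrableS ih => //; exact: measurable_itv.
move=> /(_ H1 (open_integrable_locally openT ih)) /=.
apply: filterS; first exact: (ae_filter_ringOfSetsType leb).
move=> x /[swap] /andP[x0 x1]; rewrite lte_fin => /(_ x0)[dF].
pose F (y : R) := \int[leb]_(t in `[0, y]) h t.
rewrite -/F in dF *; rewrite derive1E.
rewrite (@near_eq_derive _ _ _ F (cst 0)).
  rewrite derive_cst => /esym; rewrite /h patchE ifT// inE /= in_itv /= x1 ltW//.
near=> y.
have y01 : 0 < y < 1.
  have : y \in `]0, 1[ by near: y; apply: near_in_itvoo; rewrite in_itv /= x0.
  by rewrite in_itv.
rewrite /F /h -Rintegral_mkcondr (_ : _ `&` _ = `[0, y]%classic) ?i0c//.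
case/andP: y01 => y0 y1.
by apply/seteqP; split=> t /=; rewrite !in_itv /=; lra.
Unshelve. all: by end_near. Qed.

Implicit Types (f g : circle R -> R[i]).

Definition fourier_null f := forall n,
  cintegral (fun z => cval z ^+ n * f z) = 0 /\
  cintegral (fun z => (cval z)^* ^+ n * f z) = 0.

(** This set of multipliers is stable under products with trigonometric
    polynomials of degree one. It thus contains all polynomials in [arc_poly],
    and no general trigonometric polynomial has to be expanded. *)
Definition null_mult f g := [/\ cmeasurable g,
  exists B : R, forall z, sqn (g z) <= B ^+ 2 &
  fourier_null (fun z => g z * f z)].

Lemma cintegrable_cvalXM f n : cintegrable f ->
  cintegrable (fun z => cval z ^+ n * f z).
Proof.
move=> fi; apply: (@cintegrableM _ _ _ 1) => // [|z].
  exact: cmeasurable_cvalX.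
by rewrite sqn_cvalX expr1n.
Qed.

Lemma cintegrable_cvalJXM f n : cintegrable f ->
  cintegrable (fun z => (cval z)^* ^+ n * f z).
Proof.
move=> fi; apply: (@cintegrableM _ _ _ 1) => // [|z].
  under eq_fun do rewrite -rmorphXn /=; apply: cmeasurableJ.
  exact: cmeasurable_cvalX.
by rewrite -rmorphXn /= sqnJ sqn_cvalX expr1n.
Qed.

Lemma fourier_nullD f g : cintegrable f -> cintegrable g ->
  fourier_null f -> fourier_null g -> fourier_null (fun z => f z + g z).
Proof.
move=> fi gi f0 g0 n; have [f1 f2] := f0 n; have [g1 g2] := g0 n; split.
  under [X in cintegral X]eq_fun do rewrite mulrDr.
  by rewrite cintegralD ?f1 ?g1 ?addr0//; exact: cintegrable_cvalXM.
under [X in cintegral X]eq_fun do rewrite mulrDr.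
by rewrite cintegralD ?f2 ?g2 ?addr0//; exact: cintegrable_cvalJXM.
Qed.

Lemma fourier_nullZ f (a : R[i]) : cintegrable f -> fourier_null f ->
  fourier_null (fun z => a * f z).
Proof.
move=> fi f0 n; have [f1 f2] := f0 n; split.
  under [X in cintegral X]eq_fun do rewrite mulrCA.
  by rewrite cintegralZ ?f1 ?mulr0//; exact: cintegrable_cvalXM.
under [X in cintegral X]eq_fun do rewrite mulrCA.
by rewrite cintegralZ ?f2 ?mulr0//; exact: cintegrable_cvalJXM.
Qed.

Lemma cvalKJ (z : circle R) (a : R[i]) : cval z * ((cval z)^* * a) = a.
Proof. by rewrite mulrA cval_mulJ mul1r. Qed.

Lemma cvalJK (z : circle R) (a : R[i]) : (cval z)^* * (cval z * a) = a.
Proof. by rewrite mulrCA cvalKJ. Qed.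

Lemma fourier_null_cval f : fourier_null f ->
  fourier_null (fun z => cval z * f z).
Proof.
move=> f0 n; split.
  by under [X in cintegral X]eq_fun do rewrite mulrA -exprSr; case: (f0 n.+1).
case: n => [|n].
  under [X in cintegral X]eq_fun do rewrite expr0 mul1r -[cval _]expr1.
  by case: (f0 1%N).
under [X in cintegral X]eq_fun do
  rewrite exprSr -mulrA cvalJK.
by case: (f0 n).
Qed.

Lemma fourier_null_cvalJ f : fourier_null f ->
  fourier_null (fun z => (cval z)^* * f z).
Proof.
move=> f0 n; split; last first.
  by under [X in cintegral X]eq_fun do rewrite mulrA -exprSr; case: (f0 n.+1).
case: n => [|n].
  under [X in cintegral X]eq_fun do rewrite expr0 mul1r -[(cval _)^*]expr1.
  by case: (f0 1%N).
under [X in cintegral X]eq_fun do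
  rewrite exprSr -mulrA cvalKJ.
by case: (f0 n).
Qed.

Lemma null_mult_int f g : cintegrable f -> null_mult f g ->
  cintegrable (fun z => g z * f z).
Proof. by move=> fi [mg [B gB] _]; exact: cintegrableM gB. Qed.

Definition trig1 (a b c : R[i]) (z : circle R) : R[i] :=
  a + b * cval z + c * (cval z)^*.

Lemma cmeasurable_trig1 a b c : cmeasurable (trig1 a b c).
Proof.
apply: cmeasurableD; first apply: cmeasurableD; first exact: cmeasurable_cst.
  by apply: cmeasurableM; [exact: cmeasurable_cst|exact: measurable_cval].
apply: cmeasurableM; first exact: cmeasurable_cst.
by apply: cmeasurableJ; exact: measurable_cval.
Qed.

Lemma null_mult_trig1 f g a b c : cintegrable f ->
  (forall z, sqn (trig1 a b c z) <= 1) -> null_mult f g ->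
  null_mult f (fun z => trig1 a b c z * g z).
Proof.
move=> fi t1 Ng; have gfi := null_mult_int fi Ng; case: Ng => mg [B gB] g0.
split.
- by apply: cmeasurableM => //; exact: cmeasurable_trig1.
- exists B => z; rewrite sqnM -[leRHS]mul1r ler_pM ?sqn_ge0//.
- have i1 := cintegrable_cvalXM 1 gfi.
  have i2 := cintegrable_cvalJXM 1 gfi.
  have -> : (fun z => trig1 a b c z * g z * f z) = (fun z =>
      (a * (g z * f z) + b * (cval z * (g z * f z))) +
      c * ((cval z)^* * (g z * f z))).
    by apply/funext => z; rewrite /trig1; ring.
  apply: fourier_nullD.
  + by apply: cintegrableD; apply: cintegrableZ.
  + exact: cintegrableZ.
  + apply: fourier_nullD; [exact: cintegrableZ|exact: cintegrableZ| |].
      exact: fourier_nullZ.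
    by apply: fourier_nullZ => //; exact: fourier_null_cval.
  + by apply: fourier_nullZ => //; exact: fourier_null_cvalJ.
Qed.

Lemma null_mult_sub f g (r : circle R -> R) : cintegrable f ->
  null_mult f g -> null_mult f (fun z => (r z)%:C%C * g z) ->
  measurable_fun setT r -> (forall z, 0 <= r z <= 1) ->
  null_mult f (fun z => (1 - r z)%:C%C * g z).
Proof.
move=> fi Ng Nrg mr r01.
have gfi := null_mult_int fi Ng; have rgfi := null_mult_int fi Nrg.
case: (Ng) => mg [B gB] g0; case: (Nrg) => mrg _ rg0; split.
- apply: cmeasurableM => //; split => /=; last exact: measurable_cst.
  exact: measurable_funB.
- exists B => z; rewrite sqnM -[leRHS]mul1r ler_pM ?sqn_ge0//.
  rewrite /sqn /= expr0n addr0 /= exprn_ile1//; have /andP[] := r01 z; lra.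
- have -> : (fun z => (1 - r z)%:C%C * g z * f z) = (fun z =>
      (g z * f z) + (-1) * ((r z)%:C%C * g z * f z)).
    by apply/funext => z; rewrite rmorphB /= rmorph1; ring.
  apply: fourier_nullD => //; first exact: cintegrableZ.
  exact: fourier_nullZ.
Qed.

Lemma null_mult_step f (r : circle R -> R) a b c : cintegrable f ->
  fourier_null f -> (forall z, (r z)%:C%C = trig1 a b c z) ->
  (forall z, 0 <= r z <= 1) ->
  forall n, null_mult f (fun z => (step_poly (r z) n)%:C%C).
Proof.
move=> fi f0 rE r01 n.
have mr : measurable_fun setT r.
  have [+ _] := cmeasurable_trig1 a b c.
  by rewrite (_ : (fun z => _) = r)//; apply/funext => z; rewrite -rE.
have t1 z : sqn (trig1 a b c z) <= 1.
  rewrite -rE /sqn /= expr0n addr0 /= exprn_ile1//; by have /andP[] := r01 z.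
have rX g m : null_mult f g -> null_mult f (fun z => (r z ^+ m)%:C%C * g z).
  move=> Ng; elim: m => [|m IH].
    by under eq_fun do rewrite expr0 mul1r.
  have := null_mult_trig1 fi t1 IH; congr null_mult; apply/funext => z.
  by rewrite -rE exprS rmorphM /= mulrA.
have sX m : null_mult f (fun z => ((1 - r z ^+ n) ^+ m)%:C%C).
  elim: m => [|m IH].
    split; [exact: (cmeasurable_cst 1)| |].
      by exists 1 => z; rewrite expr0 /sqn /= expr0n addr0.
    by under eq_fun do rewrite expr0 mul1r.
  under eq_fun do rewrite exprS rmorphM /=.
  apply: (null_mult_sub (r := fun z => r z ^+ n)) => //; first exact: rX.
    exact: measurable_funX.
  move=> z; have /andP[r0 r1] := r01 z.
  by rewrite exprn_ge0//= exprn_ile1.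
exact: sX.
Qed.

(** If all coefficients vanish, so do the integrals of [f] against the
    polynomials that approximate the indicator functions of arcs. *)
Lemma fourier_unique f : cintegrable f -> fourier_null f ->
  {ae mu, forall z, f z = 0}.
Proof.
move=> fi f0; have [f1 f2] := fi.
suff H (phi : circle R -> R) : mu.-integrable setT (EFin \o phi) ->
    (forall r : circle R -> R, measurable_fun setT r ->
      (forall z, 0 <= r z <= 1) ->
      null_mult f (fun z => (r z)%:C%C) -> \int[mu]_z (r z * phi z) = 0) ->
    {ae mu, forall z, phi z = 0}.
  have a1 : {ae mu, forall z, complex.Re (f z) = 0}.
    apply: H => // r mr r01 [_ _ /(_ 0%N)[+ _]].
    move=> /(congr1 (@complex.Re R)) /= <-; rewrite /cintegral /=.
    by apply: eq_Rintegral => z _; rewrite expr0 mul1r ReM /= mul0r subr0.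
  have a2 : {ae mu, forall z, complex.Im (f z) = 0}.
    apply: H => // r mr r01 [_ _ /(_ 0%N)[+ _]].
    move=> /(congr1 (@complex.Im R)) /= <-; rewrite /cintegral /=.
    by apply: eq_Rintegral => z _; rewrite expr0 mul1r ImM /= mul0r addr0.
  by apply: filterS2 a1 a2 => z r0 i0; exact: eqC.
move=> iphi hr.
have ipe := circle_integrable iphi.
have ae0 : {ae leb, forall t, 0 < t < 1 -> phi (expi t) = 0}.
  apply: (interval_integral_ae0 ipe) => p q p0 q1 pq.
  rewrite /Rintegral (arc_integral0 p0 q1 pq ipe)// => n.
  (* [r] is the function [arc_poly] of the angle, as a trigonometric polynomial
     on the circle. *)
  pose s := arc_coef p q; pose t0 := (p + q) / 2.
  pose w : R[i] := cval (expi t0).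
  pose r z : R := s * (1 - complex.Re (cval z * w^*)).
  have rt t : r (expi t) = arc_poly p q t.
    rewrite /r /arc_poly ReM ReJ ImJ !cval_expi /=.
    rewrite -/s -/t0 [2 * pi * (t - t0)]mulrBr cosB; congr (_ * (1 - _)).
    by ring.
  have rE z : (r z)%:C%C = trig1 s%:C%C (- (s / 2)%:C%C * w^*) (- (s / 2)%:C%C * w) z.
    rewrite /r /trig1; apply: eqC; rewrite /= ?(ReD, ImD, ReM, ImM, ReN, ImN, ReJ, ImJ) /=.
      by field.
    by field.
  have r01 z : 0 <= r z <= 1.
    have /andP[s0 s2] := arc_coef_bounds p0 q1 pq; rewrite -/s in s0 s2.
    have c1 : complex.Re (cval z * w^*) ^+ 2 <= 1.
      by apply: le_trans (Re_sqr_le _) _; rewrite sqnM sqnJ !sqn_cval mulr1.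
    have {c1} : `|complex.Re (cval z * w^*)| <= 1.
      by rewrite -(@ler_sqr R) ?nnegrE// expr1n real_normK ?num_real.
    rewrite /r ler_norml; move: (complex.Re _) => c /andP[c1 c2].
    by apply/andP; split; [apply: mulr_ge0; lra|nra].
  have mr : measurable_fun setT r.
    have [+ _] := cmeasurable_trig1 s%:C%C (- (s / 2)%:C%C * w^*) (- (s / 2)%:C%C * w).
    by rewrite (_ : (fun z => _) = r)//; apply/funext => z; rewrite -rE.
  have ms : measurable_fun setT (fun z => step_poly (r z) n).
    apply: measurable_funX; apply: measurable_funB => //.
    exact: measurable_funX.
  have sp01 z : 0 <= step_poly (r z) n <= 1.
    by rewrite step_poly_ge0// step_poly_le1.
  have := hr _ ms sp01 (null_mult_step fi f0 rE r01 n).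
  rewrite circle_Rintegral; last first.
    apply: le_integrable (iphi) => //.
      apply/measurable_EFinP; apply: measurable_funM => //.
      by case/integrableP: (iphi) => /measurable_EFinP.
    move=> z _; rewrite /= lee_fin normrM -[leRHS]mul1r ler_wpM2r//.
    by have /andP[? ?] := sp01 z; rewrite ger0_norm.
  by under eq_Rintegral do rewrite rt.
have mphi : measurable_fun setT phi.
  by case/integrableP: iphi => /measurable_EFinP.
have mB : measurable [set z | phi z != 0].
  rewrite (_ : [set z | _] = ~` (phi @^-1` [set 0])); last first.
    by apply/seteqP; split=> z /= /eqP.
  apply: measurableC; rewrite -[X in measurable X]setTI.
  by apply: mphi => //; exact: measurable_set1.
exists [set z | phi z != 0]; split=> //; last first.
  by move=> z /= h; apply/eqP.
rewrite circle_muE; set A := _ `&` _.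
have mA : measurable A.
  by apply: measurableI; [exact: mB|exact: measurable_itv].
have mA' : measurable (A : set (measurableTypeR R)) by exact: mA.
apply/(@negligibleP _ (measurableTypeR R) R leb A mA').
have n0 : leb.-negligible [set (0 : R)].
  apply/negligibleP; first exact: measurable_set1.
  exact: lebesgue_measure_set1.
apply: (negligibleS _ (negligibleU ae0 n0)) => t [/= At].
rewrite in_itv /= => /andP[]; rewrite le_eqVlt => /orP[/eqP <-|t0 t1].
  by right.
by left => /= h; move/eqP: At; apply; apply: h; rewrite t0.
Qed.

Lemma fourier_constant f : cintegrable f ->
  (forall n, cintegral (fun z => cval z ^+ n.+1 * f z) = 0) ->
  (forall n, cintegral (fun z => (cval z)^* ^+ n.+1 * f z) = 0) ->
  {ae mu, forall z, f z = cintegral f}.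
Proof.
move=> fi fp fm; set c := cintegral f.
have ci : cintegrable (fun _ : circle R => - c) by exact: cintegrable_cst.
suff h : {ae mu, forall z, f z + - c = 0}.
  by apply: filterS h => z /eqP; rewrite subr_eq0 => /eqP.
apply: fourier_unique; first exact: cintegrableD.
case=> [|n]; split.
- under [X in cintegral X]eq_fun do rewrite expr0 mul1r.
  by rewrite cintegralD// cintegral_cst subrr.
- under [X in cintegral X]eq_fun do rewrite expr0 mul1r.
  by rewrite cintegralD// cintegral_cst subrr.
- under [X in cintegral X]eq_fun do rewrite mulrDr.
  rewrite cintegralD; [|exact: cintegrable_cvalXM|exact: cintegrable_cvalXM].
  under [X in _ + cintegral X]eq_fun do rewrite mulrC.
  rewrite cintegralZ; last exact: cintegrable_cvalX.
  by rewrite cintegral_cvalX mulr0 addr0 fp.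
- under [X in cintegral X]eq_fun do rewrite mulrDr.
  rewrite cintegralD; [|exact: cintegrable_cvalJXM|exact: cintegrable_cvalJXM].
  under [X in _ + cintegral X]eq_fun do rewrite mulrC -rmorphXn.
  rewrite cintegralZ; last exact/cintegrableJ/cintegrable_cvalX.
  rewrite cintegralJ; last exact: cintegrable_cvalX.
  by rewrite cintegral_cvalX rmorph0 mulr0 addr0 fm.
Qed.

End FourierUniqueness.

(** * The shift, the flip and the Hardy space *)

Section L2Operators.
Context (R : realType) (V : sepHilbert R).
Local Notation mu := (@circle_mu R).
Local Notation H := (L2H V).
Implicit Types (f g h : L2t V) (x v : V) (n : nat).

Lemma L2_ext f g : (forall z, f z = g z) -> f = g.
Proof. by move=> fg; apply: val_inj; apply/funext. Qed.

Lemma dotpZl (a : R[i]) x v : dotp (a *: x) v = a * dotp x v.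
Proof. exact: (@ipZl R (vecH V)). Qed.

Lemma dotpZr (a : R[i]) x v : dotp x (a *: v) = a^* * dotp x v.
Proof. exact: (@ipZr R (vecH V)). Qed.

Lemma vn2Z (a : R[i]) x : vn2 (a *: x) = sqn a * vn2 x.
Proof. exact: (@n2Z R (vecH V)). Qed.

Lemma L2_unimodular (w : circle R -> R[i]) (f : circle R -> V) : cmeasurable w ->
  (forall z, sqn (w z) = 1) -> L2 V f -> L2 V (fun z => w z *: f z).
Proof.
move=> mw w1 /L2P[mf fi]; apply: (le_vn2_L2 _ fi) => [v|z].
  under eq_fun do rewrite dotpZl.
  by apply: cmeasurableM => //; exact: mf.
by rewrite vn2Z w1 mul1r.
Qed.

Lemma cmeasurable_cvalJX n : cmeasurable (fun z : circle R => (cval z)^* ^+ n).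
Proof.
under eq_fun do rewrite -rmorphXn; apply: cmeasurableJ.
exact: cmeasurable_cvalX.
Qed.

Lemma sqn_cvalJX (z : circle R) n : sqn ((cval z)^* ^+ n) = 1.
Proof. by rewrite -rmorphXn /= sqnJ sqn_cvalX. Qed.

Lemma L2_shift f : L2 V (Defs.shift f).
Proof.
exact: (L2_unimodular (@measurable_cval R) (@sqn_cval R) (l2_L2 f)).
Qed.

Definition zmul f : L2t V := toL2 (L2_shift f).

Lemma L2_zmulJ f : L2 V (fun z => (cval z)^* *: f z).
Proof.
apply: (@L2_unimodular (fun z => (cval z)^*) f) (l2_L2 f).
  exact/cmeasurableJ/measurable_cval.
by move=> z; rewrite sqnJ sqn_cval.
Qed.

Definition zmulJ f : L2t V := toL2 (L2_zmulJ f).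

Lemma zmulJP a f g : zmulJ (a *: f + g) = a *: zmulJ f + zmulJ g.
Proof.
apply: L2_ext => z; transitivity ((cval z)^* *: (a *: f z + g z)); first by [].
by rewrite scalerDr scalerA mulrC -scalerA.
Qed.

Lemma zmulK f : zmulJ (zmul f) = f.
Proof.
by apply: L2_ext => z; rewrite /= /Defs.shift scalerA mulrC cval_mulJ scale1r.
Qed.

Lemma zmulJK f : zmul (zmulJ f) = f.
Proof. by apply: L2_ext => z; rewrite /= /Defs.shift /= scalerA cval_mulJ scale1r. Qed.

Lemma ip_zmul f g : ip (s := H) (zmul f) g = ip (s := H) f (zmulJ g).
Proof.
congr cintegral; apply/funext => z.
by rewrite /= /Defs.shift dotpZl dotpZr conjCK.
Qed.

Lemma ip_zmulJ f g : ip (s := H) (zmulJ f) g = ip (s := H) f (zmul g).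
Proof. by rewrite -[g in LHS]zmulK -ip_zmul zmulJK. Qed.

Lemma L2_flip f : L2 V (flip f).
Proof.
have [mf fi] := (L2P f).1 (l2_L2 f).
apply: (@L2_unimodular (fun z => (cval z)^*) (fun z => f (circle_conj z))).
- exact/cmeasurableJ/measurable_cval.
- by move=> z; rewrite sqnJ sqn_cval.
- apply/L2P; split=> [v|].
    have [m1 m2] := mf v; split.
      exact: (measurableT_comp m1 (@measurable_circle_conj R)).
    exact: (measurableT_comp m2 (@measurable_circle_conj R)).
  have mn := measurable_vn2 mf.
  apply/integrableP; split.
    apply/measurable_EFinP.
    exact: (measurableT_comp mn (@measurable_circle_conj R)).
  move: fi => /integrableP[_].
  rewrite -(@ge0_integral_conj R (fun z => `|(EFin \o (fun z => vn2 (f z))) z|%E))//.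
  by apply: measurableT_comp => //; exact/measurable_EFinP.
Qed.

Definition flipL f : L2t V := toL2 (L2_flip f).

Lemma circle_conjK (z : circle R) : circle_conj (circle_conj z) = z.
Proof. by apply: val_inj; rewrite /= conjCK. Qed.

Lemma flipK f : flipL (flipL f) = f.
Proof.
apply: L2_ext => z; rewrite /= /flip /= /flip /= circle_conjK scalerA.
by rewrite conjCK mulrC cval_mulJ scale1r.
Qed.

Lemma flip_zmul f : flipL (zmul f) = zmulJ (flipL f).
Proof. by apply: L2_ext => z. Qed.

Lemma flip_zmulJ f : flipL (zmulJ f) = zmul (flipL f).
Proof. by rewrite -[f in RHS]zmulJK flip_zmul zmulJK. Qed.

Lemma ip_flip f g : ip (s := H) (flipL f) g = ip (s := H) f (flipL g).
Proof.
rewrite [RHS]/(cintegral _) -[RHS]cintegral_conj; last exact: dot_cintegrable.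
congr cintegral; apply/funext => z; rewrite /= /flip /= circle_conjK.
by rewrite dotpZl dotpZr conjCK.
Qed.

Lemma ip_flip2 f g : ip (s := H) (flipL f) (flipL g) = ip (s := H) f g.
Proof. by rewrite ip_flip flipK. Qed.

Lemma L2_cst x : L2 V (fun=> x).
Proof.
apply: (@le_vn2_L2 _ _ _ (cst (vn2 x))) => //.
exact: finite_measure_integrable_cst.
Qed.

Lemma L2_zp n x : L2 V (fun z => cval z ^+ n *: x).
Proof.
apply: (@L2_unimodular (fun z => cval z ^+ n) (fun=> x)) (L2_cst x).
  exact: cmeasurable_cvalX.
by move=> z; exact: sqn_cvalX.
Qed.

Lemma L2_zn n x : L2 V (fun z => (cval z)^* ^+ n *: x).
Proof.
apply: (@L2_unimodular (fun z => (cval z)^* ^+ n) (fun=> x)) (L2_cst x).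
  exact: cmeasurable_cvalJX.
by move=> z; exact: sqn_cvalJX.
Qed.

Definition zp n x : L2t V := toL2 (L2_zp n x).

Definition zn n x : L2t V := toL2 (L2_zn n x).

Lemma ip_zp f n x :
  ip (s := H) f (zp n x) = cintegral (fun z => (cval z)^* ^+ n * dotp (f z) x).
Proof.
by congr cintegral; apply/funext => z; rewrite dotpZr rmorphXn.
Qed.

Lemma ip_zn f n x :
  ip (s := H) f (zn n x) = cintegral (fun z => cval z ^+ n * dotp (f z) x).
Proof.
by congr cintegral; apply/funext => z; rewrite dotpZr rmorphXn /= conjCK.
Qed.

Lemma dot_cst_cintegrable f x : cintegrable (fun z => dotp (f z) x).
Proof. exact: (dot_cintegrable f (toL2 (L2_cst x))). Qed.

Lemma l2n2_eq0 f : l2n2 f = 0 -> {ae mu, forall z, f z = 0}.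
Proof.
move=> f0; have [mf fi] := (L2P f).1 (l2_L2 f).
have := l2n2_fin f; rewrite f0 => h.
have : (\int[mu]_z `|(EFin \o (fun z => vn2 (f z))) z| = 0)%E.
  by rewrite -[RHS]h; apply: eq_integral => z _; rewrite /= ger0_norm ?dotp_Re_ge0.
move=> /(ae_eq_integral_abs _ measurableT (measurable_int _ fi)).1.
by apply: filterS => z /(_ I) /= [/vn2_eq0].
Qed.

Lemma ae_l2n2 f : {ae mu, forall z, f z = 0} -> l2n2 f = 0.
Proof.
move=> f0; apply/eqP; rewrite eq_le l2n2_ge0 andbT.
have <- : \int[mu]_z (cst 0 z : R) = 0 by rewrite Rintegral_cst// mul0r.
apply: l2n2_le_ae => //; first exact: finite_measure_integrable_cst.
by apply: filterS f0 => z -> /=; rewrite /vn2 linear0l.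
Qed.

Lemma ae_ip f f' g : {ae mu, forall z, f z = f' z} ->
  ip (s := H) f g = ip (s := H) f' g.
Proof.
move=> ff'; apply/eqP; rewrite -subr_eq0 -ipBl; apply/eqP.
apply: (@n2_eq0l R H); apply: ae_l2n2; apply: filterS ff' => z zz.
by rewrite l2B zz subrr.
Qed.

Lemma l2_unique f : (forall n i, ip (s := H) f (zp n (basis V i)) = 0) ->
  (forall n i, ip (s := H) f (zn n (basis V i)) = 0) -> {ae mu, forall z, f z = 0}.
Proof.
move=> fp fn.
have h i : {ae mu, forall z, dotp (f z) (basis V i) = 0}.
  apply: fourier_unique => [|n]; first exact: dot_cst_cintegrable.
  by rewrite -ip_zp -ip_zn.
have := ae_foralln h; apply: filterS => z hz.
exact: basis_total.
Qed.

Definition h2 : set H := [set f | H2 V (l2fun f)].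

Lemma h2E f : h2 f <-> forall n x, ip (s := H) f (zn n.+1 x) = 0.
Proof.
split=> [[_ h] n x|h]; first by rewrite ip_zn.
by split; [exact: l2_L2|move=> n x; rewrite -ip_zn].
Qed.

Lemma clsub_h2 : clsub h2.
Proof.
have -> : h2 = [set f | forall s, (exists n x, s = zn n.+1 x) -> ip (s := H) f s = 0].
  apply/seteqP; split=> f /=.
    by move=> /h2E h _ [n [x ->]]; exact: h.
  by move=> h; apply/h2E => n x; apply: h; exists n, x.
exact: clsub_orth.
Qed.

Lemma h2_zp n x : h2 (zp n x).
Proof.
apply/h2E => k v; rewrite ip_zn.
rewrite (_ : (fun z => _) = fun z => dotp x v * cval z ^+ (k + n).+1); last first.
  apply/funext => z; rewrite /= dotpZl mulrA -exprD addSn mulrC.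
  by [].
by rewrite cintegralZ ?cintegral_cvalX ?mulr0//; exact: cintegrable_cvalX.
Qed.

Lemma h2_zmul f : h2 f -> h2 (zmul f).
Proof.
move=> /h2E h; apply/h2E => n x; rewrite ip_zmul.
rewrite (_ : zmulJ _ = zn n.+2 x) ?h//.
by apply: L2_ext => z; rewrite /= scalerA -exprS.
Qed.

(** The projection of [u] onto the Hardy space has no nonzero Fourier
    coefficient. *)
Lemma h2_total (u : L2t V) : (forall n x, ip (s := H) (zp n x) u = 0) ->
  forall h, h2 h -> ip (s := H) h u = 0.
Proof.
move=> hu h hh; have [p hp up] := @proj_exists R H _ u clsub_h2.
have p0 : {ae mu, forall z, p z = 0}.
  apply: l2_unique => [n i|[|n] i].
  - apply: ipC_eq0; rewrite -[RHS](hu n (basis V i)); apply/eqP; rewrite eq_sym -subr_eq0 -ipBr.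
    apply/eqP/ipC_eq0/up; exact: h2_zp.
  - rewrite (_ : zn 0 (basis V i) = zp 0 (basis V i)); last by apply: L2_ext => z /=; rewrite !expr0.
    apply: ipC_eq0; rewrite -[RHS](hu 0%N (basis V i)); apply/eqP; rewrite eq_sym -subr_eq0 -ipBr.
    apply/eqP/ipC_eq0/up; exact: h2_zp.
  - by move/h2E: hp.
rewrite -[u](subrK p) ipDr (ipC_eq0 (up _ hh)) add0r.
by apply: (@n2_eq0r R H); exact: ae_l2n2.
Qed.

End L2Operators.

(** * Multiplication by bounded operator functions *)

Lemma hnorm_le_vn2 (R : realType) (V W : innerType R) (x : V) (y : W) (M : R) :
  hnorm y <= M * hnorm x -> vn2 y <= M ^+ 2 * vn2 x.
Proof.
move=> h; rewrite -!hnormE -exprMn -[leRHS]real_normK ?num_real//.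
by rewrite ler_sqr ?nnegrE ?hnorm_ge0//; exact: le_trans h (ler_norm _).
Qed.

Section Multiplication.
Context (R : realType) (V W : sepHilbert R).
Local Notation mu := (@circle_mu R).
Variable Phi : circle R -> V -> W.
Hypothesis LPhi : Linfty V W Phi.

Lemma Linfty_lin z a x y : Phi z (a *: x + y) = a *: Phi z x + Phi z y.
Proof. by case: LPhi => /(_ z)[+ _] _ _; exact. Qed.

Lemma Linfty_bound z : exists B : R, forall x, vn2 (Phi z x) <= B * vn2 x.
Proof.
case: LPhi => /(_ z)[_ [M hM]] _ _; exists (M ^+ 2) => x.
exact: hnorm_le_vn2.
Qed.

Lemma Linfty_ae_bound : exists2 B : R, 0 <= B &
  {ae mu, forall z, forall x, vn2 (Phi z x) <= B * vn2 x}.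
Proof.
case: LPhi => _ _ [M hM]; exists (M ^+ 2); first exact: sqr_ge0.
apply: filterS hM => z hM x.
exact: hnorm_le_vn2.
Qed.

Lemma Linfty0 z : Phi z 0 = 0.
Proof. by have := Linfty_lin z (-1) 0 0; rewrite scaler0 addr0 scaleN1r addNr. Qed.

Lemma LinftyB z x y : Phi z (x - y) = Phi z x - Phi z y.
Proof. by rewrite addrC -scaleN1r Linfty_lin scaleN1r addrC. Qed.

Lemma LinftyZ z a x : Phi z (a *: x) = a *: Phi z x.
Proof. by rewrite -[a *: x]addr0 Linfty_lin Linfty0 addr0. Qed.

Lemma Linfty_sum z n (F : nat -> V) :
  Phi z (\sum_(i < n) F i) = \sum_(i < n) Phi z (F i).
Proof.
elim: n => [|n IH]; first by rewrite !big_ord0 Linfty0.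
by rewrite !big_ord_recr /= addrC -[X in X + _]scale1r Linfty_lin scale1r IH addrC.
Qed.

Lemma Linfty_cvg z (u : nat -> V) x : @ncvg R (vecH V) u x ->
  @ncvg R (vecH W) (fun n => Phi z (u n)) (Phi z x).
Proof.
move=> ux; have [B hB] := Linfty_bound z; rewrite /ncvg /qcvg.
have h : B * vn2 (u n - x) @[n --> \oo] --> (0 : R).
  by rewrite -[0](mulr0 B); apply: cvgM; [exact: cvg_cst|exact: ux].
apply: squeeze_cvgr (cvg_cst (0 : R)) h; apply: nearW => n.
by rewrite n2_ge0 /= -LinftyB hB.
Qed.

Lemma wmeasurable_mul (f : circle R -> V) : wmeasurable f ->
  wmeasurable (fun z => Phi z (f z)).
Proof.
move=> mf w; case: LPhi => _ mPhi _.
pose s z := @fsum R (vecH V) (@basis R V) (fun i => dotp (f z) (basis V i)).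
apply: (@cmeasurable_lim _ (fun n z => dotp (Phi z (s z n)) w)) => [n|z].
  rewrite (_ : (fun z => _) = fun z =>
    \sum_(i < n) dotp (f z) (basis V i) * dotp (Phi z (basis V i)) w).
    apply: (@cmeasurable_sum _ n
      (fun i z => dotp (f z) (basis V i) * dotp (Phi z (basis V i)) w)) => i.
    by apply: cmeasurableM; [exact: mf|exact: mPhi].
  apply/funext => z.
  rewrite /s /fsum (@Linfty_sum z n (fun i => dotp (f z) (basis V i) *: basis V i)).
  rewrite -[LHS]/(@ip R (vecH W) _ w) ip_suml; apply: eq_bigr => i _.
  by rewrite LinftyZ; exact: dotpZl.
exact: (@ip_cvg R (vecH W) _ (fun=> w) _ _ (Linfty_cvg z (basis_cvg (f z)))
  (ncvg_cst _)).
Qed.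

Lemma L2_mul (f : L2t V) : L2 W (fun z => Phi z (f z)).
Proof.
have mP := wmeasurable_mul (l2_wm f).
apply/L2P; split=> //; have [B B0 hB] := Linfty_ae_bound.
have iB := integrableZl measurableT B (l2_int f).
apply/integrableP; split; first by apply/measurable_EFinP; apply: measurable_vn2; exact: mP.
apply: le_lt_trans (_ : (\int[mu]_z (B * vn2 (f z))%:E < +oo)%E).
  apply: ae_ge0_le_integral => //.
  - apply: measurableT_comp => //; apply/measurable_EFinP; apply: measurable_vn2.
    exact: mP.
  - by move=> z _; rewrite lee_fin mulr_ge0// dotp_Re_ge0.
  - exact: measurable_int iB.
  - by apply: filterS hB => z h _; rewrite /= ger0_norm ?dotp_Re_ge0// lee_fin.
exact: integrable_lty iB.
Qed.

Definition mulop f : L2t W := toL2 (L2_mul f).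

Lemma mulopP a f g : mulop (a *: f + g) = a *: mulop f + mulop g.
Proof. by apply: L2_ext => z; exact: Linfty_lin. Qed.

Lemma mulop_bound : exists B : R, forall f, l2n2 (mulop f) <= B * l2n2 f.
Proof.
have [B B0 hB] := Linfty_ae_bound; exists B => f.
rewrite [X in _ <= B * X]l2n2E -RintegralZl//; last exact: l2_int.
apply: l2n2_le_ae.
- exact: (integrableZl measurableT B (l2_int f)).
- by move=> z; rewrite mulr_ge0// dotp_Re_ge0.
- by apply: filterS hB => z; exact.
Qed.

Lemma mulop_adjoint (u : L2t W) : exists v : L2t V, forall f,
  ip (s := L2H W) (mulop f) u = ip (s := L2H V) f v.
Proof.
have [B hB] := mulop_bound.
exact: (@adjoint_exists R (L2H V) (L2H W) mulop B mulopP hB u).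
Qed.

Lemma mulop_zmul f : mulop (zmul f) = zmul (mulop f).
Proof. by apply: L2_ext => z; exact: LinftyZ. Qed.

(** Through the adjoint, orthogonality to the image of the Hardy space can be
    tested on analytic monomials. *)
Lemma mulop_h2_orth (u : L2t W) :
  (forall n x, ip (s := L2H W) (mulop (zp n x)) u = 0) ->
  forall h, h2 h -> ip (s := L2H W) (mulop h) u = 0.
Proof.
move=> hu h hh; have [v hv] := mulop_adjoint u.
by rewrite hv; apply: h2_total => // n x; rewrite -hv.
Qed.

Lemma mulop_zp_val n x z : mulop (zp n x) z = cval z ^+ n *: Phi z x.
Proof. exact: LinftyZ. Qed.

Lemma h2_mulop : Hinfty V W Phi -> forall h, h2 h -> h2 (mulop h).
Proof.
move=> [_ hPhi] h hh; apply/h2E => n y; apply: mulop_h2_orth => // k x.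
rewrite ip_zn -[RHS](hPhi (n + k)%N x y); congr cintegral.
by apply/funext => z; rewrite mulop_zp_val dotpZl mulrA -exprD addSn.
Qed.

End Multiplication.

(** * Wold decomposition of shift-invariant subspaces *)

Section LinearPreimage.
Context (R : realType) (X Y : semiHilbert R) (T : X -> Y) (B : R).
Hypothesis TP : forall a x y, T (a *: x + y) = a *: T x + T y.
Hypothesis TB : forall x, n2 (T x) <= B * n2 x.

Lemma clsub_preimage (M : set Y) : clsub M -> clsub (T @^-1` M).
Proof.
move=> [[M0 MP] cM].
have T0 : T 0 = 0.
  by have := TP (-1) 0 0; rewrite scaler0 addr0 scaleN1r addNr.
have TBB x y : T (x - y) = T x - T y.
  by rewrite addrC -scaleN1r TP scaleN1r addrC.
split; first by split=> [|a x y Mx My] /=; [rewrite T0|rewrite TP; exact: MP].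
move=> x h; apply: cM => e e0.
have B1 : 0 < `|B| + 1 by rewrite ltr_wpDl.
have [y My xy] := h (e / (`|B| + 1)) (divr_gt0 e0 B1).
exists (T y) => //; rewrite -TBB; apply: le_lt_trans (TB _) _.
apply: le_lt_trans (_ : (`|B| + 1) * n2 (x - y) < e).
  rewrite ler_wpM2r ?n2_ge0//; have := ler_norm B; lra.
by rewrite mulrC -ltr_pdivlMr.
Qed.

End LinearPreimage.

Section Wold.
Context (R : realType) (V : sepHilbert R).
Local Notation mu := (@circle_mu R).
Local Notation H := (L2H V).
Local Notation "'[ f , g ]" := (ip (s := H) f g).
Implicit Types (f g m u w : L2t V) (n : nat) (M : set (L2t V)).

Definition zinvariant M := forall m, M m -> M (zmul m).

Definition reducing_part M : set (L2t V) :=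
  [set f | forall n, M (iter n (@zmulJ R V) f)].

Definition wandering M : set (L2t V) :=
  [set w | M w /\ forall m, M m -> '[w, zmul m] = 0].

Lemma ip_iter_zmul n f g : '[iter n (@zmul R V) f, g] = '[f, iter n (@zmulJ R V) g].
Proof. by elim: n f => [//|n IH] f; rewrite iterSr IH ip_zmul. Qed.

Lemma iter_zmul_in M n m : zinvariant M -> M m -> M (iter n (@zmul R V) m).
Proof. by move=> zM Mm; elim: n => //= n; exact: zM. Qed.

Lemma iter_zmulE n f z : iter n (@zmul R V) f z = cval z ^+ n *: f z.
Proof.
elim: n => [|n IH]; first by rewrite expr0 scale1r.
by rewrite iterS exprS -scalerA -IH.
Qed.

Lemma n2_zmulJ f : n2 (X := H) (zmulJ f) = n2 (X := H) f.
Proof. by rewrite /n2 ip_zmulJ zmulJK. Qed.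

Lemma clsub_zmulJ M : @clsub R H M -> @clsub R H [set f | M (zmulJ f)].
Proof.
move=> cM; apply: (@clsub_preimage R H H (@zmulJ R V) 1) cM.
  exact: zmulJP.
by move=> f; rewrite n2_zmulJ mul1r.
Qed.

Lemma clsub_wandering M : @clsub R H M -> @clsub R H (wandering M).
Proof.
move=> cM; have := clsubI cM (@clsub_orth R H [set zmul m | m in M]).
congr clsub; apply/seteqP; split=> w [Mw h]; split=> //.
  by move=> m Mm; apply: h; exists m.
by move=> _ [m Mm <-]; exact: h.
Qed.

Lemma reducing_zmulJ M f : reducing_part M f -> reducing_part M (zmulJ f).
Proof. by move=> h n; rewrite -iterSr; exact: h. Qed.

Lemma reducing_zmul M f : zinvariant M -> reducing_part M f ->
  reducing_part M (zmul f).
Proof.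
move=> zM h [|n]; first exact/zM/(h 0%N).
by rewrite iterSr zmulK; exact: h.
Qed.

(** If the component [p] of [u] in [M] is orthogonal to all shifts of the
    wandering subspace, then it can be divided by [z] inside [M] indefinitely: it
    belongs to the reducing part, and so is orthogonal to [u]. *)
Lemma wold M u : @clsub R H M -> zinvariant M ->
  (forall m, reducing_part M m -> '[m, u] = 0) ->
  (forall n w, wandering M w -> '[iter n (@zmul R V) w, u] = 0) ->
  forall m, M m -> '[m, u] = 0.
Proof.
move=> cM zM hinf hW m Mm.
have [p Mp up] := @proj_exists R H M u cM.
have ipu f : M f -> '[f, u] = '[f, p].
  by move=> Mf; rewrite -[u](subrK p) ipDr (ipC_eq0 (up f Mf)) add0r.
have step q : M q -> (forall w, wandering M w -> '[w, q] = 0) -> M (zmulJ q).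
  move=> Mq qW; have cz := clsub_zmulJ cM.
  have [r zr qr] := @proj_exists R H _ q cz.
  have Mr : M r by rewrite -[r]zmulJK; exact: zM.
  have Wqr : wandering M (q - r).
    split; first by apply: (@subspB R H) => //; exact: (proj1 cM).
    by move=> f Mf; apply: qr; rewrite /= zmulK.
  have q0 : n2 (X := H) (q - r) = 0.
    by rewrite /n2 ipBr (qW _ Wqr) (qr _ zr) subrr.
  exact: (@nclosed_null R H _ q r (proj2 cz) q0 zr).
have pn n : M (iter n (@zmulJ R V) p).
  elim: n => [//|n IH]; apply: step => // w Ww.
  rewrite -ip_iter_zmul -ipu; first exact: hW.
  by apply: iter_zmul_in => //; case: Ww.
have p0 : n2 (X := H) p = 0 by rewrite /n2 -ipu// hinf.
by rewrite ipu//; exact: n2_eq0r.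
Qed.

(** The projections of a total sequence onto the wandering subspace are total
    in it, and the Gram-Schmidt process makes them orthonormal. *)
Lemma wandering_basis M : @clsub R H M -> zinvariant M ->
  exists w : nat -> L2t V, [/\ @onz R H w, forall k, wandering M (w k) &
    forall u, (forall n k, '[iter n (@zmul R V) (w k), u] = 0) ->
      forall n v, wandering M v -> '[iter n (@zmul R V) v, u] = 0].
Proof.
move=> cM zM; have cW := clsub_wandering cM.
(* An enumeration of the monomials [z ^ n x] and [z ^ -n x], with [x] in a
     basis. *)
pose t (k : nat) : L2t V :=
  if unpickle k is Some (b, n, i) then
    (if (b : bool) then zp (n : nat) (basis V (i : nat)) else zn n (basis V i)) else 0.
have /choice[s hs] : forall k, exists y, wandering M y /\
    forall m, wandering M m -> '[t k - y, m] = 0.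
  by move=> k; have [y] := @proj_exists R H _ (t k) cW; exists y.
exists (@gs R H s); split; first exact: onz_gs.
  by apply: gs_in; [exact: (proj1 cW)|move=> k; case: (hs k)].
move=> u hu n v Wv; rewrite ip_iter_zmul.
set u' := iter n _ u.
have [p Wp up] := @proj_exists R H _ u' cW.
have p0 : {ae mu, forall z, p z = 0}.
  have sp k : '[s k, p] = 0.
    apply: (@gs_orth R H s) => j; rewrite -(hu n j) ip_iter_zmul -/u'.
    have Wj : wandering M (gs (X := H) s j).
      by apply: gs_in; [exact: (proj1 cW)|move=> i; case: (hs i)].
    by rewrite -[u'](subrK p) ipDr (ipC_eq0 (up _ Wj)) add0r.
  have tp k : '[p, t k] = 0.
    by apply: ipC_eq0; rewrite -[t k](subrK (s k)) ipDl sp addr0; case: (hs k) => _; exact.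
  apply: l2_unique => j i.
    by have := tp (pickle (true, j, i)); rewrite /t pickleK.
  by have := tp (pickle (false, j, i)); rewrite /t pickleK.
rewrite -[u'](subrK p) ipDr (ipC_eq0 (up _ Wv)) add0r.
by apply: (@n2_eq0r R H); exact: ae_l2n2.
Qed.

(** The products [<w_i(z), w_j(z)>] have vanishing Fourier coefficients of
    nonzero index, by the definition of the wandering subspace. *)
Lemma wandering_gram M v w : zinvariant M -> wandering M v -> wandering M w ->
  {ae mu, forall z, dotp (v z) (w z) = '[v, w]}.
Proof.
move=> zM [Mv hv] [Mw hw].
apply: fourier_constant => [|n|n]; first exact: dot_cintegrable.
  have -> : cintegral (fun z => cval z ^+ n.+1 * dotp (v z) (w z)) =
      '[iter n.+1 (@zmul R V) v, w].
    by congr cintegral; apply/funext => z; rewrite iter_zmulE dotpZl.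
  by apply: ipC_eq0; apply: hw; exact: iter_zmul_in.
have -> : cintegral (fun z => (cval z)^* ^+ n.+1 * dotp (v z) (w z)) =
    '[v, iter n.+1 (@zmul R V) w].
  by congr cintegral; apply/funext => z; rewrite iter_zmulE dotpZr rmorphXn.
by apply: hv; exact: iter_zmul_in.
Qed.

End Wold.

(** * The symbol of an invariant subspace *)

Section SeriesInInnerSpace.
Context (R : realType) (V : sepHilbert R).
Local Notation X := (vecH V).
Implicit Types (w : nat -> V) (c d : nat -> R[i]) (x y : V).

Lemma vn2_hsum_le w c B : @onz R X w -> (forall n, \sum_(i < n) sqn (c i) <= B) ->
  vn2 (@hsum R X w c) <= B.
Proof.
move=> ow cB; have hw := hsum_cvg ow (ex_intro _ B cB).
have [hr _] := ip_cvg hw hw.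
apply: ler_cvg_to hr (cvg_cst B) _; apply: nearW => n.
exact: le_trans (n2_fsum c n ow) (cB n).
Qed.

Lemma hsum_eq w c x : @onz R X w -> sqsum c -> @ncvg R X (@fsum R X w c) x ->
  @hsum R X w c = x.
Proof.
move=> ow sc cx; apply/eqP; rewrite -subr_eq0; apply/eqP/vn2_eq0.
exact: (ncvg_unique (hsum_cvg ow sc) cx).
Qed.

Lemma hproj_fixed w x : @onz R X w ->
  (forall y, (forall i, dotp (w i) y = 0) -> dotp x y = 0) -> @hproj R X w x = x.
Proof.
move=> ow h; apply/esym/eqP; rewrite -subr_eq0; apply/eqP/vn2_eq0.
have o i : dotp (w i) (x - @hproj R X w x) = 0.
  by apply: (@ipC_eq0 R X); exact: ip_hproj.
rewrite /vn2 -[dotp _ _]/(@ip R X (x - @hproj R X w x) (x - @hproj R X w x)) ipBl.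
rewrite [X in X - _](h _ o) [X in _ - X](@ip_hsum_orth R X w) ?subrr//.
exact: sqsum_ip.
Qed.

End SeriesInInnerSpace.

Section FamilySymbol.
Context (R : realType) (V : sepHilbert R).
Local Notation mu := (@circle_mu R).
Local Notation H := (L2H V).
Local Notation X := (vecH V).
Variable w : nat -> L2t V.
Hypothesis ow : @onz R H w.
Hypothesis gram : forall i j,
  {ae mu, forall z, dotp (w i z) (w j z) = ip (s := H) (w i) (w j)}.

(** At these points the values of [w] are orthonormal; elsewhere they are
    replaced by zero, so that the symbol is bounded everywhere. *)
Definition gram_set : set (circle R) :=
  [set z | forall i j, dotp (w i z) (w j z) = ip (s := H) (w i) (w j)].

Lemma gram_ae : {ae mu, forall z, gram_set z}.
Proof.
apply: ae_foralln => i; apply: ae_foralln => j; exact: gram.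
Qed.

Lemma measurable_gram : measurable gram_set.
Proof.
have -> : gram_set = \bigcap_i \bigcap_j
    [set z | dotp (w i z) (w j z) = ip (s := H) (w i) (w j)].
  by apply/seteqP; split=> z h i; [move=> _ j _; exact: h|move=> j; exact: (h i I j I)].
apply: bigcapT_measurable => i; apply: bigcapT_measurable => j.
have [m1 m2] := cmeasurable_dot (l2_wm (w i)) (l2_wm (w j)).
set c := ip _ _.
have -> : [set z | dotp (w i z) (w j z) = c] =
    (setT `&` (fun z => complex.Re (dotp (w i z) (w j z))) @^-1` [set complex.Re c]) `&`
    (setT `&` (fun z => complex.Im (dotp (w i z) (w j z))) @^-1` [set complex.Im c]).
  rewrite !setTI; apply/seteqP; split=> z /=; first by move=> ->.
  by move=> [re im]; exact: eqC.
by apply: measurableI; [apply: m1|apply: m2] => //; exact: measurable_set1.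
Qed.

Lemma gram_point : exists z, gram_set z.
Proof. exact: ae_exists gram_ae. Qed.

Definition family_at z k : V := if `[< gram_set z >] then w k z else 0.

Lemma onz_at z : gram_set z -> @onz R X (fun k => w k z).
Proof.
move=> Zz; split=> [i j ij|i]; first by rewrite [LHS](Zz i j) (proj1 ow).
by case: (proj2 ow i) => [h|->]; [left; rewrite [LHS](Zz i i)|right].
Qed.

Lemma onz_family_at z : @onz R X (family_at z).
Proof.
rewrite /family_at; case: asboolP => [Zz|_]; first exact: onz_at.
by split=> *; [exact: (@ip0l R X)|right].
Qed.

Variable z0 : circle R.
Hypothesis Zz0 : gram_set z0.

Definition base_family k : V := w k z0.

(** Sends the orthonormal family at the base point to the family at [z]. *)
Definition family_symbol z (x : V) : V :=
  @hsum R X (family_at z) (fun k => dotp x (base_family k)).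

Lemma onz_base : @onz R X base_family.
Proof. exact: onz_at. Qed.

Lemma sqsum_base x : sqsum (fun k => dotp x (base_family k)).
Proof. exact: (@sqsum_ip R X _ x onz_base). Qed.

Lemma family_symbol_lin z a x y :
  family_symbol z (a *: x + y) = a *: family_symbol z x + family_symbol z y.
Proof.
apply: hsum_eq; [exact: onz_family_at|exact: sqsum_base|].
have := @ncvg_lin R X a _ _ _ _ (hsum_cvg (onz_family_at z) (sqsum_base x))
  (hsum_cvg (onz_family_at z) (sqsum_base y)).
congr qcvg; apply/funext => n; rewrite /fsum scaler_sumr -big_split /=.
by apply: eq_bigr => i _; rewrite dotpPl scalerDl scalerA.
Qed.

Lemma family_symbol_le z x : vn2 (family_symbol z x) <= vn2 x.
Proof.
apply: vn2_hsum_le => [|n]; first exact: onz_family_at.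
exact: (@bessel R X base_family x n onz_base).
Qed.

Lemma hnorm_family_symbol z x : hnorm (family_symbol z x) <= hnorm x.
Proof.
by rewrite /hnorm ler_sqrt; [exact: family_symbol_le|exact: dotp_Re_ge0].
Qed.

Lemma family_symbol_Linfty : Linfty V V family_symbol.
Proof.
split.
- move=> z; split; first by move=> a x y; exact: family_symbol_lin.
  by exists 1 => x; rewrite mul1r; exact: hnorm_family_symbol.
- move=> x y.
  apply: (@cmeasurable_lim _ (fun n z => dotp (@fsum R X (family_at z)
      (fun k => dotp x (base_family k)) n) y)) => [n|z].
    rewrite (_ : (fun z => _) = fun z =>
      \sum_(k < n) dotp x (base_family k) *
        (if `[< gram_set z >] then dotp (w k z) y else 0)).
      apply: (@cmeasurable_sum _ n (fun k z => dotp x (base_family k) *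
        (if `[< gram_set z >] then dotp (w k z) y else 0))) => k.
      apply: cmeasurableM; first exact: cmeasurable_cst.
      apply: cmeasurable_if; [exact: measurable_gram|exact: l2_wm|].
      exact: cmeasurable_cst.
    apply/funext => z; rewrite -[LHS]/(@ip R X _ y) ip_suml; apply: eq_bigr => k _.
    rewrite ipZl; congr (_ * _); rewrite /family_at; case: ifP => // _.
    exact: (@ip0l R X).
  exact: (@ip_cvg R X _ (fun=> y) _ _ (hsum_cvg (onz_family_at z) (sqsum_base x))
    (ncvg_cst _)).
- by exists 1; apply: aeW => z x; rewrite mul1r; exact: hnorm_family_symbol.
Qed.

Definition base_proj (x : V) : V := @hproj R X base_family x.

Lemma base_projP x k : dotp (base_proj x) (base_family k) = dotp x (base_family k).
Proof.
apply/esym/eqP; rewrite -subr_eq0; apply/eqP.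
have := @ip_hproj R X _ x k onz_base.
by rewrite ipBl.
Qed.

Lemma base_proj_orth x y : (forall k, dotp (base_family k) y = 0) ->
  dotp (base_proj x) y = 0.
Proof.
move=> h; apply: (@ip_hsum_orth R X) => //; first exact: onz_base.
exact: sqsum_base.
Qed.

(** Inner products of orthogonal series depend only on the coefficients and on
    the norms of the terms, which are the same at [z] and at the base point. *)
Lemma family_symbol_isometry z x y : gram_set z ->
  dotp (family_symbol z x) (family_symbol z y) = dotp x (base_proj y).
Proof.
move=> Zz; rewrite -[LHS]/(@ip R X (family_symbol z x) (family_symbol z y)).
rewrite /family_symbol (@ip_hsum2 R X X (family_at z) base_family _ _
  (onz_family_at z) onz_base (sqsum_base x) (sqsum_base y)); last first.
  move=> k; rewrite /family_at; case: asboolP => // _.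
  by rewrite [LHS](Zz k k) -(Zz0 k k).
have h : dotp (base_proj y) (x - base_proj x) = 0.
  apply: base_proj_orth => k; apply: (@ipC_eq0 R X).
  by rewrite ipBl [X in _ - X]base_projP subrr.
rewrite -[X in _ = dotp X _](subrK (base_proj x)).
by rewrite -[RHS]/(@ip R X _ _) ipDl (@ipC_eq0 R X _ _ h) add0r.
Qed.

Lemma family_symbol_base z k : family_symbol z (base_family k) = family_at z k.
Proof.
apply: hsum_eq; [exact: onz_family_at|exact: sqsum_base|].
rewrite /ncvg /qcvg; apply: cvg_near_cst; near=> n.
have kn : (k < n)%N by near: n; exists k.+1.
rewrite /fsum (bigD1 (Ordinal kn)) //= big1 ?addr0 => [|i ik]; last first.
  rewrite (_ : dotp _ _ = 0) ?scale0r//; apply: (proj1 onz_base).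
  by apply: contra ik => /eqP e; apply/eqP/val_inj.
have -> : dotp (base_family k) (base_family k) *: family_at z k = family_at z k.
  rewrite [X in X *: _](Zz0 k k) /family_at.
  case: (proj2 ow k) => [->|h]; first by rewrite scale1r.
  by case: ifP => _; rewrite ?scaler0// [w k]h scaler0.
by rewrite subrr (@n2_0 R X).
Unshelve. all: by end_near. Qed.

Lemma family_symbol_proj z x : family_symbol z (base_proj x) = family_symbol z x.
Proof.
by congr (@hsum R X _ _); apply/funext => k; exact: base_projP.
Qed.

Local Notation mulw := (mulop family_symbol_Linfty).

Lemma mulop_base n k : {ae mu, forall z,
  mulw (zp n (base_family k)) z = iter n (@zmul R V) (w k) z}.
Proof.
apply: filterS gram_ae => z Zz.
rewrite mulop_zp_val iter_zmulE family_symbol_base /family_at.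
by case: asboolP.
Qed.

(** The partial sums of the series of [family_symbol] converge in mean square,
    uniformly in [z]. *)
Lemma mulop_zp_in (M : set (L2t V)) n x : @clsub R H M ->
  (forall k, M (iter n (@zmul R V) (w k))) -> M (mulw (zp n x)).
Proof.
move=> cM Mw.
pose s N : V := @fsum R X base_family (fun k => dotp x (base_family k)) N.
have sx : @ncvg R X s (base_proj x) := hsum_cvg onz_base (sqsum_base x).
have Ms N : M (mulw (zp n (s N))).
  pose t N : L2t V := \sum_(k < N) dotp x (base_family k) *:
    iter n (@zmul R V) (w k).
  have Mt : M (t N).
    apply: (@subsp_sum R H M N (fun k => dotp x (base_family k) *:
      iter n (@zmul R V) (w k)) (proj1 cM)) => k.
    exact: (@subspZ R H _ _ _ (proj1 cM) (Mw k)).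
  apply: (@nclosed_null R H _ _ (t N) (proj2 cM) _ Mt).
  apply: ae_l2n2; apply: filterS gram_ae => z Zz; rewrite l2B mulop_zp_val.
  have tE K : t K z = \sum_(k < K) dotp x (base_family k) *: (cval z ^+ n *: w k z).
    elim: K => [|K IH]; first by rewrite /t !big_ord0.
    rewrite /t !big_ord_recr /= -IH -iter_zmulE.
    by [].
  rewrite tE /s /fsum.
  have := @Linfty_sum R V V family_symbol family_symbol_Linfty z N
    (fun k => dotp x (base_family k) *: base_family k).
  move=> ->; rewrite scaler_sumr -sumrB big1// => k _.
  rewrite (LinftyZ family_symbol_Linfty) family_symbol_base /family_at.
  by case: asboolP => // _; rewrite !scalerA mulrC subrr.
apply: (@nclosed_cvg R H _ (fun N => mulw (zp n (s N))) _ (proj2 cM) _ Ms).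
rewrite /ncvg /qcvg.
apply: squeeze_cvgr (cvg_cst (0 : R)) sx; apply: nearW => N.
rewrite n2_ge0 /=.
have <- : \int[mu]_z (cst (@n2 R X (s N - base_proj x)) z : R) =
    @n2 R X (s N - base_proj x).
  by rewrite Rintegral_cst// [X in fine X](@circle_mu_setT R) mulr1.
apply: l2n2_le; first exact: finite_measure_integrable_cst.
move=> z; rewrite l2B !mulop_zp_val -scalerBr vn2Z sqn_cvalX mul1r.
rewrite -(family_symbol_proj z x) -(LinftyB family_symbol_Linfty).
exact: family_symbol_le.
Qed.

End FamilySymbol.

(** The Beurling-Lax-Halmos theorem, for a subspace that may contain a
    reducing part. An orthonormal basis [w] of the wandering subspace has
    a constant Gram matrix, so its values at almost every point [z] form an
    orthonormal family in [V]. The isometry that maps the family at one fixed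
    point to the family at [z] is [Phi z]; this is how a fixed initial space
    arises, whose dimension is that of the wandering subspace. *)
Lemma beurling (R : realType) (V : sepHilbert R) (M : set (L2t V)) :
  @clsub R (L2H V) M -> zinvariant M ->
  exists (b : nat -> V) (Phi : circle R -> V -> V) (LPhi : Linfty V V Phi),
  [/\ @onz R (vecH V) b,
      forall z x, hnorm (Phi z x) <= hnorm x,
      {ae (@circle_mu R), forall z, forall x y,
        dotp (Phi z x) (Phi z y) = dotp x (@hproj R (vecH V) b y)},
      forall h, h2 h -> M (mulop LPhi h) &
      forall u, (forall m, reducing_part M m -> ip (s := L2H V) m u = 0) ->
        (forall h, h2 h -> ip (s := L2H V) (mulop LPhi h) u = 0) ->
        forall m, M m -> ip (s := L2H V) m u = 0].
Proof.
move=> cM zM; have [w [ow Ww wu]] := wandering_basis cM zM.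
have gw i j := wandering_gram zM (Ww i) (Ww j).
have [z0 Zz0] := gram_point gw.
exists (base_family w z0), (family_symbol w z0).
have L := family_symbol_Linfty ow Zz0.
exists (family_symbol_Linfty ow Zz0).
have Mw n k : M (iter n (@zmul R V) (w k)).
  by apply: iter_zmul_in => //; case: (Ww k).
split.
- exact: onz_base.
- by move=> z x; exact: hnorm_family_symbol.
- apply: filterS (gram_ae gw) => z Zz x y.
  exact: family_symbol_isometry.
- move=> h hh; apply: (@clsub_biorth R (L2H V) M _ cM) => u uM.
  apply: mulop_h2_orth hh => n x; apply: ipC_eq0; apply: uM.
  exact: mulop_zp_in.
- move=> u hinf hP; apply: wold => //; apply: wu => n k.
  rewrite -(hP (zp n (base_family w z0 k))); last exact: h2_zp.
  apply: ae_ip; apply: filterS (mulop_base ow gw Zz0 n k) => z ->.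
  by [].
Qed.

(** * Toeplitz and Hankel operators and their adjoints *)

Section HardyOperators.
Context (R : realType).
Local Notation mu := (@circle_mu R).

(** The definition chooses a function with the required property; it exists
    because the Hardy space is closed. *)
Lemma projH2_spec (V : sepHilbert R) (f : L2t V) : exists p : L2t V,
  [/\ projH2 f = p, h2 p & forall k, h2 k -> ip (s := L2H V) (f - p) k = 0].
Proof.
have [p hp fp] := @proj_exists R (L2H V) _ f (clsub_h2 V).
rewrite /projH2; case: xgetP => [q _ [hq fq]|/(_ (l2fun p))[]]; last first.
  split=> // k hk; exact: (fp (toL2 (proj1 hk))).
exists (toL2 (proj1 hq)); split=> // k hk; exact: (fq k hk).
Qed.

(** On the Hardy space, any square integrable representative [v] can be
    replaced by its projection. *)
Lemma adjH2_spec (V : sepHilbert R) (W : innerType R)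
    (X : (circle R -> V) -> (circle R -> W)) (g : circle R -> W) (v : L2t V) :
  (forall h : L2t V, h2 h -> L2dot (X h) g = ip (s := L2H V) h v) ->
  exists k : L2t V, [/\ adjH2 X g = k, h2 k &
    forall h : L2t V, h2 h -> L2dot (X h) g = ip (s := L2H V) h k].
Proof.
move=> hv; have [p hp vp] := @proj_exists R (L2H V) _ v (clsub_h2 V).
have hvp h : h2 h -> ip (s := L2H V) h v = ip (s := L2H V) h p.
  by move=> hh; rewrite -[v](subrK p) ipDr (ipC_eq0 (vp _ hh)) add0r.
rewrite /adjH2; case: xgetP => [q _ [hq fq]|/(_ (l2fun p))[]]; last first.
  split=> // h hh; have Lh := proj1 hh.
  by rewrite -[h]/(l2fun (toL2 Lh)) hv// hvp.
exists (toL2 (proj1 hq)); split=> // h hh; exact: (fq h hh).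
Qed.

Lemma adj_shift_spec (V : sepHilbert R) (g : L2t V) : exists k : L2t V,
  [/\ adjH2 (@Defs.shift R V) g = k, h2 k &
    forall h, h2 h -> ip (s := L2H V) (zmul h) g = ip (s := L2H V) h k].
Proof.
apply: (@adjH2_spec V V (@Defs.shift R V) g (zmulJ g)) => h hh.
exact: ip_zmul.
Qed.

Section Adjoints.
Variables (V W : sepHilbert R) (Phi : circle R -> V -> W).
Hypothesis LPhi : Linfty V W Phi.

Lemma adj_toeplitz_spec (g : L2t W) : h2 g -> exists k : L2t V,
  [/\ adjH2 (toeplitz Phi) g = k, h2 k &
    forall h, h2 h ->
      ip (s := L2H W) (mulop LPhi h) g = ip (s := L2H V) h k].
Proof.
move=> hg; have [v hv] := mulop_adjoint LPhi g.
have tE h : L2dot (toeplitz Phi (l2fun h)) g = ip (s := L2H W) (mulop LPhi h) g.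
  have [p [pE _ hp]] := projH2_spec (mulop LPhi h).
  have -> : toeplitz Phi h = p by exact: pE.
  rewrite -[LHS]/(ip (s := L2H W) p g); apply/esym/eqP.
  by rewrite -subr_eq0 -ipBl hp.
have [k [k1 k2 k3]] := @adjH2_spec V W (toeplitz Phi) g v
  (fun h hh => etrans (tE h) (hv h)).
by exists k; split=> // h hh; rewrite -k3// tE.
Qed.

Lemma adj_hankel_spec (g : L2t W) : h2 g -> exists k : L2t V,
  [/\ adjH2 (hankel Phi) g = k, h2 k &
    forall h, h2 h ->
      ip (s := L2H W) (mulop LPhi h) (flipL g) = ip (s := L2H V) h k].
Proof.
move=> hg; have [v hv] := mulop_adjoint LPhi (flipL g).
have tE h : L2dot (hankel Phi (l2fun h)) g =
    ip (s := L2H W) (mulop LPhi h) (flipL g).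
  have [p [pE _ hp]] := projH2_spec (flipL (mulop LPhi h)).
  have -> : hankel Phi h = p by exact: pE.
  rewrite -ip_flip -[LHS]/(ip (s := L2H W) p g); apply/esym/eqP.
  by rewrite -subr_eq0 -ipBl hp.
have [k [k1 k2 k3]] := @adjH2_spec V W (hankel Phi) g v
  (fun h hh => etrans (tE h) (hv h)).
by exists k; split=> // h hh; rewrite -k3// tE.
Qed.

End Adjoints.

(** The projections in the Hankel and Toeplitz operators disappear in inner
    products with functions of the Hardy space, and the flip in the Hankel
    operator moves to [f]. *)
Lemma kernel_row (V E F : sepHilbert R) (C : circle R -> V -> E)
    (A : circle R -> V -> F) (LC : Linfty V E C) (LA : Linfty V F A)
    (f : L2t E) (g : L2t F) : h2 f -> h2 g ->
  (adjH2 (hankel C) f + adjH2 (toeplitz A) g = 0 %[ae mu]) <->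
  (forall h, h2 h -> ip (s := L2H E) (mulop LC h) (flipL f) +
    ip (s := L2H F) (mulop LA h) g = 0).
Proof.
move=> hf hg; have [k1 [-> h1 e1]] := adj_hankel_spec LC hf.
have [k2 [-> h2' e2]] := adj_toeplitz_spec LA hg.
split=> [k0 h hh|k0].
  rewrite e1// e2// -ipDr; apply: (@n2_eq0r R (L2H V)); apply: ae_l2n2.
  by apply: filterS k0 => z /(_ I).
have hk : h2 (k1 + k2) by apply: (@subspD R (L2H V)) => //; exact: (proj1 (clsub_h2 V)).
have : l2n2 (k1 + k2) = 0.
  have := k0 _ hk; rewrite e1// e2// -ipDr => /(congr1 (@complex.Re R)).
  by [].
by move=> /l2n2_eq0; apply: filterS => z h _.
Qed.

End HardyOperators.

(** * Hilbert spaces, direct sums and closed subspaces as coefficient spaces *)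

Section HilbertNorm.
Context (R : realType) (E : hilbertType R).
Implicit Types x y : E.

Lemma hilbert_normE x : `|x| = (hnorm x)%:C%C.
Proof.
apply/eqP; rewrite -(@eqrXn2 _ 2)//; last by rewrite lecR hnorm_ge0.
rewrite sqr_normE -rmorphXn /= hnormE; apply/eqP.
apply: eqC => //=; have := dotp_ge0 x; rewrite lecE => /andP[/eqP].
by [].
Qed.

Lemma hilbert_norm_lt x (e : R) : 0 < e -> (`|x| < e%:C%C) = (vn2 x < e ^+ 2).
Proof.
move=> e0; rewrite hilbert_normE ltcR -hnormE ltr_pXn2r//.
  by rewrite nnegrE hnorm_ge0.
by rewrite nnegrE ltW.
Qed.

Lemma posC (e : R[i]) : 0 < e -> exists2 r : R, 0 < r & e = r%:C%C.
Proof.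
rewrite ltcE /= => /andP[/eqP e0 re]; exists (complex.Re e) => //.
exact: eqC.
Qed.

Lemma hilbert_complete (u : nat -> E) : qcauchy (@vn2 R E) u ->
  exists x, qcvg (@vn2 R E) u x.
Proof.
move=> cu; have cF : cauchy (u @ \oo).
  apply: cauchy_exP => _ /posC[r r0 ->].
  have [k hk] := cu (r ^+ 2) (exprn_gt0 _ r0).
  exists (u k); exists k => // n /= kn; rewrite -ball_normE /ball_ /=.
  rewrite distrC hilbert_norm_lt//; exact: hk.
have := @cauchy_cvg E _ _ cF; set x := lim _ => ux; exists x.
apply/cvgrPdist_lt => e e0.
have r0 : 0 < Num.sqrt e by rewrite sqrtr_gt0.
have rC0 : 0 < (Num.sqrt e)%:C%C by rewrite ltcR.
have ux' : u n @[n --> \oo] --> x by exact: ux.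
have [k _ hk] := (@cvgrPdist_lt _ E _ _ _ u x).1 ux' _ rC0.
exists k => // n kn; move: (hk n kn) => /=; rewrite sub0r normrN ger0_norm ?dotp_Re_ge0//.
by rewrite distrC hilbert_norm_lt// sqr_sqrtr// ltW.
Qed.

Definition hilbertH : semiHilbert R :=
  SemiHilbert (@dotpPl R E) (@dotpC R E) (@dotp_Re_ge0 R E) hilbert_complete.

Hypothesis sepE : separable_space E.

(** A dense sequence is total: a vector orthogonal to it has distance at least
    its norm to every term. *)
Lemma hilbert_total : exists d : nat -> E,
  forall x, (forall n, dotp (d n) x = 0) -> x = 0.
Proof.
case: sepE => S cS dS; have [d hd] := pcard_surjP cS.
exists d => x hx; apply: vn2_eq0; apply/eqP.
apply: contraT => x0; have {}x0 : 0 < vn2 x by rewrite lt_def x0 dotp_Re_ge0.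
have rC0 : 0 < (Num.sqrt (vn2 x))%:C%C by rewrite ltcR sqrtr_gt0.
have [y [xy Sy]] : (ball x (Num.sqrt (vn2 x))%:C%C `&` S) !=set0.
  apply: dS; first by exists x; exact: ballxx.
  exact: ball_open.
have [n _ dn] := hd _ Sy.
move: xy; rewrite -ball_normE /ball_ /= hilbert_norm_lt ?sqrtr_gt0//.
rewrite sqr_sqrtr ?ltW// -dn => xy.
have := @cauchy_schwarz R hilbertH (x - d n) x.
rewrite ipBl [X in sqn (_ - X)](hx n) subr0 ip_n2 => h.
have {h} : vn2 x * vn2 x <= vn2 (x - d n) * vn2 x.
  by move: h; rewrite /sqn /= expr0n addr0 expr2.
by rewrite ler_pM2r// leNgt xy.
Qed.

Let d := projT1 (cid hilbert_total).

Let e : nat -> E := @gs R hilbertH d.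

Lemma hilbert_basis_total x : (forall i, dotp x (e i) = 0) -> x = 0.
Proof.
move=> h; apply: (projT2 (cid hilbert_total)).
apply: (@gs_orth R hilbertH) => n; apply: (@ipC_eq0 R hilbertH); exact: h.
Qed.

Definition sep_of_hilbert : sepHilbert R :=
  @SepHilbert R E e (proj1 (@onz_gs R hilbertH d)) (proj2 (@onz_gs R hilbertH d))
    hilbert_basis_total hilbert_complete.

End HilbertNorm.

Section DirectSumSpace.
Context (R : realType) (V W : sepHilbert R).
Local Notation VW := ((V * W)%type : innerType R).

Lemma prod_dotpE (p q : VW) : dotp p q = dotp p.1 q.1 + dotp p.2 q.2.
Proof. by []. Qed.

Lemma prod_vn2E (p : VW) : vn2 p = vn2 p.1 + vn2 p.2.
Proof. by rewrite /vn2 prod_dotpE ReD. Qed.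

Definition prod_basis (k : nat) : VW :=
  if odd k then (0, basis W k./2) else (basis V k./2, 0).

Lemma prod_basis_orth i j : i != j -> dotp (prod_basis i) (prod_basis j) = 0.
Proof.
move=> ij; have hij : odd i = odd j -> i./2 != j./2.
  move=> oij; apply: contra ij => /eqP h2.
  by rewrite -(odd_double_half i) -(odd_double_half j) oij h2.
rewrite prod_dotpE /prod_basis; move: hij; case: (odd i); case: (odd j) => /= h.
- by rewrite linear0l add0r basis_orth// h.
- by rewrite linear0l linear0r addr0.
- by rewrite linear0l linear0r addr0.
- by rewrite linear0l addr0 basis_orth// h.
Qed.

Lemma prod_basis_norm i :
  dotp (prod_basis i) (prod_basis i) = 1 \/ prod_basis i = 0.
Proof.
rewrite prod_dotpE /prod_basis; case: (odd i) => /=.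
  case: (@basis_norm R W i./2) => [->|->]; last by right.
  by left; rewrite linear0l add0r.
case: (@basis_norm R V i./2) => [->|->]; last by right.
by left; rewrite linear0l addr0.
Qed.

Lemma prod_basis_total (p : VW) : (forall i, dotp p (prod_basis i) = 0) -> p = 0.
Proof.
case: p => p1 p2 h; congr pair; apply: basis_total => i.
  have := h i.*2; rewrite prod_dotpE /prod_basis odd_double doubleK /=.
  by rewrite linear0r addr0.
have := h i.*2.+1; rewrite prod_dotpE /prod_basis /= odd_double /= uphalf_double.
by rewrite linear0r add0r.
Qed.

Lemma prod_complete (u : nat -> VW) : qcauchy (@vn2 R VW) u ->
  exists x, qcvg (@vn2 R VW) u x.
Proof.
move=> cu.
have [x1 h1] : exists x, qcvg (@vn2 R V) (fun n => (u n).1) x.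
  apply: sep_complete => e e0; have [k hk] := cu e e0; exists k => m n kn nm.
  apply: le_lt_trans (hk m n kn nm); rewrite [leRHS]prod_vn2E.
  by rewrite lerDl dotp_Re_ge0.
have [x2 h2] : exists x, qcvg (@vn2 R W) (fun n => (u n).2) x.
  apply: sep_complete => e e0; have [k hk] := cu e e0; exists k => m n kn nm.
  apply: le_lt_trans (hk m n kn nm); rewrite [leRHS]prod_vn2E.
  by rewrite lerDr dotp_Re_ge0.
exists (x1, x2); rewrite /qcvg.
rewrite (_ : (fun n => _) = (fun n => vn2 ((u n).1 - x1) + vn2 ((u n).2 - x2))).
  by have := cvgD h1 h2; rewrite addr0 => h; exact: h.
by apply/funext => n; rewrite prod_vn2E.
Qed.

Definition sep_prod : sepHilbert R :=
  @SepHilbert R VW prod_basis prod_basis_orth prod_basis_norm prod_basis_total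
    prod_complete.

End DirectSumSpace.

(** The closed linear span of a sequence, as a double orthogonal complement. *)
Definition span_pred (R : realType) (V : innerType R) (b : nat -> V) : {pred V} :=
  fun x => `[< forall y, (forall i, dotp (b i) y = 0) -> dotp x y = 0 >].

Lemma span_predP (R : realType) (V : innerType R) (b : nat -> V) x :
  reflect (forall y, (forall i, dotp (b i) y = 0) -> dotp x y = 0)
    (x \in span_pred b).
Proof. exact: asboolP. Qed.

Lemma span_submod (R : realType) (V : innerType R) (b : nat -> V) :
  GRing.submod_closed (span_pred b).
Proof.
split=> [|a x y /span_predP hx /span_predP hy]; apply/span_predP => v hv.
  by rewrite linear0l.
by rewrite dotpPl hx// hy// mulr0 addr0.
Qed.

Lemma clsub_span (R : realType) (V : sepHilbert R) (b : nat -> V) :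
  @clsub R (vecH V) [set` span_pred b].
Proof.
have := @clsub_orth R (vecH V) [set y | forall i, dotp (b i) y = 0].
congr clsub; apply/seteqP; split=> x /=.
  by move=> h; apply/span_predP => y; exact: h.
by move=> /span_predP h y; exact: h.
Qed.

Lemma mem_span (R : realType) (V : innerType R) (b : nat -> V) i :
  b i \in span_pred b.
Proof. by apply/span_predP => y; exact. Qed.

(** The norm of a direct sum is a maximum, only equivalent to the inner product
    norm: the factor 2 bounds the sum of two squares by their maximum. *)
Lemma qclosed_closed (R : realType) (V : normedModType R[i]) (q : V -> R)
    (A : set V) :
  (forall v (e : R), 0 < e -> `|v| < e%:C%C -> q v < 2 * e ^+ 2) ->
  (forall x, (forall e : R, 0 < e -> exists2 y, A y & q (x - y) < e) -> A x) ->
  closed A.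
Proof.
move=> hq hA x clx; apply: hA => e e0.
pose r := Num.sqrt (e / 2).
have r0 : 0 < r by rewrite sqrtr_gt0 divr_gt0.
have rC0 : 0 < r%:C%C by rewrite ltcR.
have [y [Ay xy]] := clx _ (nbhsx_ballx x _ rC0).
exists y => //; have := hq (x - y) r r0.
rewrite sqr_sqrtr ?divr_ge0 ?ltW// mulrC divfK ?pnatr_eq0//; apply.
by move: xy; rewrite -ball_normE.
Qed.

Section ClosedSpans.
Context (R : realType).

Lemma closed_span (E : hilbertType R) (sepE : separable_space E) (b : nat -> E) :
  closed [set` span_pred b].
Proof.
apply: (@qclosed_closed R E (@vn2 R E)) => [v e e0 ve|].
  move: ve; rewrite hilbert_norm_lt// => /lt_le_trans; apply.
  by have := sqr_ge0 e; lra.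
exact: (proj2 (@clsub_span R (sep_of_hilbert sepE) b)).
Qed.

Lemma closed_span_prod (E F : hilbertType R) (sepE : separable_space E)
    (sepF : separable_space F) (b : nat -> (E * F)%type) :
  closed [set` span_pred b].
Proof.
apply: (@qclosed_closed R (E * F)%type (@vn2 R (E * F)%type)) => [v e e0|].
  rewrite prod_normE; set m := Num.max _ _ => ve.
  have real1 : `|v.1| \is Num.real by exact: normr_real.
  have real2 : `|v.2| \is Num.real by exact: normr_real.
  have [h1 h2] : `|v.1| < e%:C%C /\ `|v.2| < e%:C%C.
    move: ve; rewrite /m comparable_gt_max; last exact: real_comparable.
    by move=> /andP[].
  move: h1 h2; rewrite !hilbert_norm_lt// => h1 h2.
  rewrite /vn2 /= /prod_dotp ReD mulr_natl mulr2n.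
  exact: ltrD.
exact: (proj2 (@clsub_span R (sep_prod (sep_of_hilbert sepE) (sep_of_hilbert sepF)) b)).
Qed.

End ClosedSpans.

Section SubspaceOfHilbert.
Context (R : realType) (E : hilbertType R) (sepE : separable_space E).
Variable b : nat -> E.
Hypothesis ob : @onz R (vecH (sep_of_hilbert sepE)) b.

Definition span_sub : clsubspace E :=
  ClSubspace (span_submod b) (@closed_span R E sepE b).

Local Notation V1 := (clsub_type span_sub).

Definition span_basis k : V1 := ClSubElt (mem_span b k : b k \in clsub_pred span_sub).

Lemma span_basis_orth i j : i != j -> dotp (span_basis i) (span_basis j) = 0.
Proof. exact: (proj1 ob). Qed.

Lemma span_basis_norm i :
  dotp (span_basis i) (span_basis i) = 1 \/ span_basis i = 0.
Proof. by case: (proj2 ob i) => h; [left|right; apply: val_inj]. Qed.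

Lemma span_basis_total (x : V1) : (forall i, dotp x (span_basis i) = 0) -> x = 0.
Proof.
move=> h; apply: val_inj; apply: vn2_eq0.
have /span_predP hx := clsub_valP x.
rewrite /vn2 [X in complex.Re X](_ : _ = 0)//; apply: hx => i.
rewrite dotpC -[dotp (val x) (b i)]/(dotp x (span_basis i)) h.
by rewrite rmorph0.
Qed.

Lemma span_complete (u : nat -> V1) : qcauchy (@vn2 R V1) u ->
  exists x, qcvg (@vn2 R V1) u x.
Proof.
move=> cu.
have cv : qcauchy (@vn2 R E) (fun n => val (u n)) by exact: cu.
have [x ux] := hilbert_complete cv.
have xs : x \in span_pred b.
  apply: (@nclosed_cvg R (vecH (sep_of_hilbert sepE)) _ (fun n => val (u n)) x
    (proj2 (clsub_span (V := sep_of_hilbert sepE) b)) ux) => n.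
  exact: (clsub_valP (u n)).
by exists (ClSubElt (xs : x \in clsub_pred span_sub)).
Qed.

Definition sep_span : sepHilbert R :=
  @SepHilbert R V1 span_basis span_basis_orth span_basis_norm span_basis_total
    span_complete.

End SubspaceOfHilbert.

(** * Pairs of functions and the kernel of the operator of a symbol *)

Section PairFunctions.
Context (R : realType) (V W : sepHilbert R).
Local Notation VW := (sep_prod V W).
Implicit Types (m : L2t VW) (f : L2t V) (g : L2t W).

Lemma L2_pair f g : L2 VW (fun z => (f z, g z)).
Proof.
apply: (@le_vn2_L2 R VW _ (fun z => vn2 (f z) + vn2 (g z))) => [v||z].
- exact: (cmeasurableD (l2_wm f v.1) (l2_wm g v.2)).
- exact: (integrableD measurableT (l2_int f) (l2_int g)).
- by rewrite prod_vn2E.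
Qed.

Definition pairL f g : L2t VW := toL2 (L2_pair f g).

Lemma dotp_fst (p : VW) (x : V) : dotp p (x, 0) = dotp p.1 x.
Proof. by rewrite prod_dotpE /= linear0r addr0. Qed.

Lemma dotp_snd (p : VW) (y : W) : dotp p (0, y) = dotp p.2 y.
Proof. by rewrite prod_dotpE /= linear0r add0r. Qed.

Lemma L2_fst m : L2 V (fun z => (m z).1).
Proof.
apply: (le_vn2_L2 _ (l2_int m)) => [v|z].
  under eq_fun do rewrite -dotp_fst; exact: l2_wm.
by rewrite [leRHS]prod_vn2E lerDl dotp_Re_ge0.
Qed.

Lemma L2_snd m : L2 W (fun z => (m z).2).
Proof.
apply: (le_vn2_L2 _ (l2_int m)) => [v|z].
  under eq_fun do rewrite -dotp_snd; exact: l2_wm.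
by rewrite [leRHS]prod_vn2E lerDr dotp_Re_ge0.
Qed.

Definition fstL m : L2t V := toL2 (L2_fst m).

Definition sndL m : L2t W := toL2 (L2_snd m).

Lemma ip_pair m m' : ip (s := L2H VW) m m' =
  ip (s := L2H V) (fstL m) (fstL m') + ip (s := L2H W) (sndL m) (sndL m').
Proof.
transitivity (cintegral (fun z =>
  dotp (fstL m z) (fstL m' z) + dotp (sndL m z) (sndL m' z))); first by [].
by rewrite cintegralD//; exact: dot_cintegrable.
Qed.

Lemma pairL_eta m : pairL (fstL m) (sndL m) = m.
Proof. by apply: L2_ext => z /=; case: (m z). Qed.

Lemma fst_pairL f g : fstL (pairL f g) = f.
Proof. exact: L2_ext. Qed.

Lemma snd_pairL f g : sndL (pairL f g) = g.
Proof. exact: L2_ext. Qed.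

Lemma ip_pairL m f g : ip (s := L2H VW) m (pairL f g) =
  ip (s := L2H V) (fstL m) f + ip (s := L2H W) (sndL m) g.
Proof. by rewrite ip_pair fst_pairL snd_pairL. Qed.

Lemma sndLP a m m' : sndL (a *: m + m') = a *: sndL m + sndL m'.
Proof. exact: L2_ext. Qed.

Lemma fst_zmul m : fstL (zmul m) = zmul (fstL m).
Proof. exact: L2_ext. Qed.

Lemma snd_zmul m : sndL (zmul m) = zmul (sndL m).
Proof. exact: L2_ext. Qed.

Lemma fst_zmulJ m : fstL (zmulJ m) = zmulJ (fstL m).
Proof. exact: L2_ext. Qed.

Lemma snd_zmulJ m : sndL (zmulJ m) = zmulJ (sndL m).
Proof. exact: L2_ext. Qed.

Lemma n2_pair m :
  n2 (X := L2H VW) m = n2 (X := L2H V) (fstL m) + n2 (X := L2H W) (sndL m).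
Proof. by rewrite /n2 ip_pair ReD. Qed.

Lemma n2_snd_le m : n2 (X := L2H W) (sndL m) <= 1 * n2 (X := L2H VW) m.
Proof. by rewrite mul1r n2_pair lerDr n2_ge0. Qed.

Lemma h2_fst m : h2 m -> h2 (fstL m).
Proof.
move=> /h2E h; apply/h2E => n x; rewrite ip_zn -[RHS](h n ((x, 0) : VW)) ip_zn.
by congr cintegral; apply/funext => z; rewrite dotp_fst.
Qed.

Lemma h2_snd m : h2 m -> h2 (sndL m).
Proof.
move=> /h2E h; apply/h2E => n x; rewrite ip_zn -[RHS](h n ((0, x) : VW)) ip_zn.
by congr cintegral; apply/funext => z; rewrite dotp_snd.
Qed.

Lemma h2_pair f g : h2 f -> h2 g -> h2 (pairL f g).
Proof.
move=> /h2E hf /h2E hg; apply/h2E => n [x y]; apply: ipC_eq0.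
have -> : @zn R VW n.+1 (x, y) = pairL (zn n.+1 x) (zn n.+1 y) by exact: L2_ext.
by rewrite ip_pairL !fst_pairL !snd_pairL (ipC_eq0 (hf n x)) (ipC_eq0 (hg n y)) addr0.
Qed.

End PairFunctions.

Section KernelOfSymbol.
Context (R : realType) (E F : hilbertType R).
Hypotheses (sepE : separable_space E) (sepF : separable_space F).
Local Notation VE := (sep_of_hilbert sepE).
Local Notation VF := (sep_of_hilbert sepF).
Variable Psi : Lambda E F.

Let LC : Linfty VE VE (symC Psi) := symC_Linfty Psi.
Let LD : Linfty VF VE (symD Psi) := symD_Linfty Psi.
Let LA : Linfty VE VF (symA Psi) := proj1 (symA_Hinfty Psi).
Let LB : Linfty VF VF (symB Psi) := proj1 (symB_Hinfty Psi).

Lemma kerWP (f : L2t VE) (g : L2t VF) : h2 f -> h2 g ->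
  kerW Psi (l2fun f, l2fun g) <->
  (forall h, h2 h -> ip (s := L2H VE) (mulop LC h) (flipL f) +
     ip (s := L2H VF) (mulop LA h) g = 0) /\
  (forall h, h2 h -> ip (s := L2H VE) (mulop LD h) (flipL f) +
     ip (s := L2H VF) (mulop LB h) g = 0).
Proof.
move=> hf hg; have r1 := kernel_row LC LA hf hg.
have r2 := kernel_row LD LB hf hg.
split=> [[_ _ /r1 k1 /r2 k2]//|[k1 k2]].
by split; [exact: hf|exact: hg|exact/r1|exact/r2].
Qed.

(** The flip turns multiplication by [z] into multiplication by its conjugate,
    and the range of an analytic row is analytic: both components of the
    orthogonality relation are thus moved to the argument of the symbol. *)
Lemma kerW_invariant (f : L2t VE) (g k : L2t VF) : h2 f -> h2 g -> h2 k ->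
  (forall h, h2 h -> ip (s := L2H VF) (zmul h) g = ip (s := L2H VF) h k) ->
  kerW Psi (l2fun f, l2fun g) -> kerW Psi (l2fun (zmul f), l2fun k).
Proof.
move=> hf hg hk gk /(kerWP hf hg)[k1 k2].
apply/(kerWP (h2_zmul hf) hk); split=> h hh.
  rewrite flip_zmul -ip_zmul -gk; last exact: (h2_mulop LA (symA_Hinfty Psi)).
  by rewrite -!mulop_zmul; apply: k1; exact: h2_zmul.
rewrite flip_zmul -ip_zmul -gk; last exact: (h2_mulop LB (symB_Hinfty Psi)).
by rewrite -!mulop_zmul; apply: k2; exact: h2_zmul.
Qed.

End KernelOfSymbol.

Lemma hnorm_cval (R : realType) (V : innerType R) (z : circle R) (x : V) :
  hnorm (cval z *: x) = hnorm x.
Proof.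
rewrite /hnorm linearZl_LR linearZr_LR /= mulrA mulJ sqn_cval ReM /=.
by rewrite mul1r mul0r subr0.
Qed.

Lemma H2_shift (R : realType) (V : innerType R) (h : circle R -> V) :
  H2 V h -> H2 V (Defs.shift h).
Proof.
move=> [[mh fh] h0]; split; first split.
- move=> v; under eq_fun do rewrite /Defs.shift linearZl_LR.
  by apply: cmeasurableM; [exact: measurable_cval|exact: mh].
- by move: fh; rewrite /sqrL2norm; under [in X in _ -> X]eq_integral do
    rewrite /Defs.shift hnorm_cval.
- move=> n v; rewrite -[RHS](h0 n.+1 v); congr cintegral; apply/funext => z.
  by rewrite /Defs.shift linearZl_LR /= mulrA -exprSr.
Qed.

Lemma rangeH2_shift (R : realType) (E : hilbertType R) (E1 : clsubspace E)
    (Theta : circle R -> clsub_type E1 -> E) (f : circle R -> E) :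
  Hinfty (clsub_type E1) E Theta -> rangeH2 Theta f ->
  rangeH2 Theta (Defs.shift f).
Proof.
move=> [[bT _ _] _] [hf [h hh fh]]; split; first exact: H2_shift.
exists (Defs.shift h); first exact: H2_shift.
apply: filterS fh => z fz _; rewrite /Defs.shift fz//.
have [lT _] := bT z.
have T0 : Theta z 0 = 0.
  by have := lT (-1) 0 0; rewrite scaler0 addr0 scaleN1r addNr.
by have := lT (cval z) (h z) 0; rewrite addr0 T0 addr0.
Qed.

(** * Right extremal inner functions *)

Lemma adj_eq (R : realType) (V W : innerType R) (T : V -> W) (y : W) (x : V) :
  (forall u, dotp (T u) y = dotp u x) -> adj T y = x.
Proof.
move=> hx; rewrite /adj; case: xgetP => [x' _ /= h|/(_ x)[]//].
apply/eqP; rewrite -subr_eq0; apply/eqP/vn2_eq0.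
have h0 u : dotp u (x' - x) = 0 by rewrite linearBr /= -h hx subrr.
by rewrite /vn2 h0.
Qed.

(** The adjoint is defined with a default value; the default cannot occur at a
    fixed point of [T \o adj T]. *)
Lemma adj_fixed (R : realType) (V W : innerType R) (T : V -> W) (y : W) :
  T 0 = 0 -> T (adj T y) = y -> forall x, dotp (T x) y = dotp x (adj T y).
Proof.
move=> T0; rewrite /adj; case: xgetP => [x' _ /= h _ //|h].
rewrite T0 => y0; case: (h 0) => x.
by rewrite -y0 !linear0r.
Qed.

Section ImageOfIsometry.
Context (R : realType) (X Y : semiHilbert R) (T : X -> Y).
Hypothesis TP : forall a x y, T (a *: x + y) = a *: T x + T y.
Hypothesis Tn : forall x, n2 (T x) = n2 x.

(** An isometry reflects Cauchy sequences, so the image of a complete subspace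
    is complete. *)
Lemma clsub_image (M : set X) : clsub M ->
  clsub [set y | exists2 x, M x & n2 (y - T x) = 0].
Proof.
move=> [sM cM].
have T0 : T 0 = 0.
  by have := TP (-1) 0 0; rewrite scaler0 addr0 scaleN1r addNr.
have TB x y : T (x - y) = T x - T y.
  by rewrite addrC -scaleN1r TP scaleN1r addrC.
split; first split.
- by exists 0; [case: sM|rewrite T0 subrr n2_0].
- move=> a y y' [x Mx yx] [x' Mx' yx']; exists (a *: x + x').
    by case: sM => _; exact.
  rewrite TP (_ : _ - _ = a *: (y - T x) + (y' - T x')).
    by rewrite n2_eq0D// n2Z yx mulr0.
  by rewrite scalerBr addrACA opprD.
- move=> y hy.
  have /choice[x hx] : forall k : nat, exists x, M x /\ n2 (y - T x) < k.+1%:R^-1.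
    move=> k; have k0 : 0 < k.+1%:R^-1 :> R by rewrite invr_gt0.
    have [y' [x Mx yx'] yy'] := hy _ k0; exists x; split=> //.
    by rewrite -[y](subrK y') -addrA n2_eq0D.
  have cx : qcauchy (@n2 R X) x.
    move=> e e0; have e4 : 0 < e / 4 by rewrite divr_gt0.
    have [k _ hk] := near_infty_natSinv_lt (PosNum e4).
    exists k => m n kn nm; rewrite -Tn TB.
    rewrite (_ : T (x m) - T (x n) = (y - T (x n)) + (T (x m) - y)); last first.
      by rewrite [RHS]addrC addrA subrK.
    apply: le_lt_trans (n2D_le _ _) _; rewrite [n2 (T (x m) - y)]n2BC.
    have [_ h1] := hx m; have [_ h2] := hx n.
    have := hk m (leq_trans kn nm); have := hk n kn; move: h1 h2 => /=.
    move: (n2 _) (n2 _) (n.+1%:R^-1) (m.+1%:R^-1); clear -R; move=> a b c d *; lra.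
  have [p xp] := ip_complete cx.
  have Mp : M p by apply: (nclosed_cvg cM xp) => k; case: (hx k).
  exists p => //; apply/eqP; rewrite eq_le n2_ge0 andbT.
  have h : 2 * k.+1%:R^-1 + 2 * n2 (x k - p) @[k --> \oo] --> (0 : R).
    have := cvgD (cvgM (cvg_cst (2 : R)) (@cvg_harmonic R)) (cvgM (cvg_cst (2 : R)) xp).
    by rewrite !mulr0 addr0 => h; exact: h.
  apply: ler_cvg_to (cvg_cst (n2 (y - T p))) h _; apply: nearW => k.
  rewrite (_ : y - T p = (y - T (x k)) + (T (x k) - T p)); last first.
    by rewrite addrA subrK.
  apply: le_trans (n2D_le _ _) _; rewrite -TB Tn lerD2r ler_pM2l// ltW//.
  by case: (hx k).
Qed.

End ImageOfIsometry.

(** A function that can be divided by [z] indefinitely inside the Hardy space has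
    no nonzero Fourier coefficient. *)
Lemma h2_reducing_null (R : realType) (V : sepHilbert R) (f : L2t V) :
  (forall n, h2 (iter n (@zmulJ R V) f)) ->
  {ae (@circle_mu R), forall z, f z = 0}.
Proof.
have hz n i : ip (s := L2H V) (iter n.+1 (@zmulJ R V) f) (zn 1 (basis V i)) = 0 ->
    ip (s := L2H V) f (zp n (basis V i)) = 0.
  have -> : @zp R V n (basis V i) = iter n.+1 (@zmul R V) (zn 1 (basis V i)).
    apply: L2_ext => z; rewrite iter_zmulE /= exprS expr1 scalerA mulrAC cval_mulJ.
    by rewrite mul1r.
  by move=> h; apply: ipC_eq0; rewrite ip_iter_zmul; apply: ipC_eq0.
move=> hf.
have hp n i : ip (s := L2H V) f (zp n (basis V i)) = 0.
  by apply: hz; have /h2E := hf n.+1; exact.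
apply: l2_unique => [//|[|n] i].
- rewrite -[RHS](hp 0%N i); congr ip; apply: L2_ext => z.
  by rewrite /= !expr0.
- by have /h2E := hf 0%N; exact.
Qed.

Section SpanProjection.
Context (R : realType) (V : sepHilbert R) (b : nat -> V).
Local Notation X := (vecH V).
Hypothesis ob : @onz R X b.

Lemma hproj_span x : @hproj R X b x \in span_pred b.
Proof.
apply/span_predP => y hy; apply: (@ip_hsum_orth R X) => //; exact: sqsum_ip.
Qed.

Lemma dotp_hproj y x : y \in span_pred b -> dotp y (@hproj R X b x) = dotp y x.
Proof.
move=> /span_predP hy; apply/eqP; rewrite eq_sym -subr_eq0.
rewrite -[dotp y x]/(@ip R X y x) -[dotp _ _]/(@ip R X y (@hproj R X b x)) -ipBr.
by apply/eqP/hy => i; apply: (@ipC_eq0 R X); exact: ip_hproj.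
Qed.

End SpanProjection.

Section InnerFunction.
Context (R : realType) (E : hilbertType R) (sepE : separable_space E).
Local Notation mu := (@circle_mu R).
Local Notation VE := (sep_of_hilbert sepE).
Local Notation XE := (vecH VE).
Local Notation "'[ f , g ]" := (ip (s := L2H VE) f g).
Variable Q : set (L2t VE).
Hypothesis Qz : forall q, Q q -> Q (zmul q).
Hypothesis QzJ : forall q, Q q -> Q (zmulJ q).

Definition hardy_orth : set (L2t VE) :=
  [set f | h2 f /\ forall q, Q q -> '[f, q] = 0].

Lemma clsub_hardy_orth : @clsub R (L2H VE) hardy_orth.
Proof. exact: clsubI (clsub_h2 VE) (@clsub_orth R (L2H VE) Q). Qed.

Lemma zinvariant_hardy_orth : zinvariant hardy_orth.
Proof.
move=> f [hf fQ]; split; first exact: h2_zmul.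
by move=> q Qq; rewrite ip_zmul; apply: fQ; exact: QzJ.
Qed.

Variables (b : nat -> VE) (Phi : circle R -> VE -> VE) (LPhi : Linfty VE VE Phi).
Hypothesis ob : @onz R XE b.
Hypothesis Phi_le : forall z x, hnorm (Phi z x) <= hnorm x.
Hypothesis Phi_iso : {ae mu, forall z, forall x y,
  dotp (Phi z x) (Phi z y) = dotp x (@hproj R XE b y)}.
Hypothesis Phi_in : forall h, h2 h -> hardy_orth (mulop LPhi h).
Hypothesis Phi_span : forall u, (forall h, h2 h -> '[mulop LPhi h, u] = 0) ->
  forall f, hardy_orth f -> '[f, u] = 0.

Local Notation E1 := (span_sub sepE b).
Local Notation V1 := (clsub_type E1).
Local Notation VS := (sep_span ob).

Definition inner_of (z : circle R) (x : V1) : E := Phi z (val x).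

Lemma val_lin a (x y : V1) : val (a *: x + y) = a *: val x + val y.
Proof. by rewrite linearP. Qed.

Lemma L2_val (h : L2t VS) : L2 VE (fun z => val (h z)).
Proof.
apply: (le_vn2_L2 _ (l2_int h)) => // x.
pose p : VS := ClSubElt (hproj_span ob x : _ \in clsub_pred E1).
have E0 z : dotp (val (h z)) x = dotp (h z) p.
  by rewrite [RHS](dotp_hproj (V := VE) ob x (clsub_valP (h z))).
under eq_fun do rewrite E0.
exact: (l2_wm h).
Qed.

Definition valL (h : L2t VS) : L2t VE := toL2 (L2_val h).

Lemma h2_val (h : L2t VS) : h2 h -> h2 (valL h).
Proof.
move=> /h2E hh; apply/h2E => n x.
rewrite -[RHS](hh n (ClSubElt (hproj_span ob x : _ \in clsub_pred E1) : VS)).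
congr cintegral; apply/funext => z; rewrite !dotpZr; congr (_ * _).
by rewrite [RHS](dotp_hproj (V := VE) ob x (clsub_valP (h z))).
Qed.

Lemma inner_of_Linfty : Linfty VS VE inner_of.
Proof.
case: LPhi => bP mP _; split.
- move=> z; split=> [a x y|]; last first.
    by exists 1 => x; rewrite mul1r; exact: Phi_le.
  by rewrite /inner_of val_lin (Linfty_lin LPhi).
- by move=> x y; exact: mP.
- by exists 1; apply: aeW => z x; rewrite mul1r; exact: Phi_le.
Qed.

Lemma mulop_inner (h : L2t VS) :
  mulop inner_of_Linfty h = mulop LPhi (valL h).
Proof. exact: L2_ext. Qed.

Lemma inner_of_in (h : L2t VS) : h2 h -> hardy_orth (mulop inner_of_Linfty h).
Proof. by move=> hh; rewrite mulop_inner; apply: Phi_in; exact: h2_val. Qed.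

Lemma inner_of_Hinfty : Hinfty V1 E inner_of.
Proof.
split=> [|n x y]; first exact: inner_of_Linfty.
have [/h2E h _] := inner_of_in (h2_zp (V := VS) 0 x).
rewrite -[RHS](h n y) ip_zn; congr cintegral; apply/funext => z.
by rewrite mulop_zp_val expr0 scale1r.
Qed.

Lemma inner_of_iso : {ae mu, forall z, forall x y,
  dotp (inner_of z x) (inner_of z y) = dotp x y}.
Proof.
apply: filterS Phi_iso => z h x y; rewrite [LHS]h.
rewrite (@hproj_fixed R VE b (val y) ob)//.
by have /span_predP := clsub_valP y.
Qed.

Lemma inner_of_adj : {ae mu, forall z, forall x,
  adj (inner_of z) (inner_of z x) = x}.
Proof. by apply: filterS inner_of_iso => z h x; exact: adj_eq. Qed.

Lemma n2_mulop_inner (h : L2t VS) :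
  n2 (X := L2H VE) (mulop inner_of_Linfty h) = n2 (X := L2H VS) h.
Proof.
rewrite /n2; congr complex.Re; apply: ae_eq_cintegral.
- by apply: cmeasurable_dot; exact: l2_wm.
- by apply: cmeasurable_dot; exact: l2_wm.
- by apply: filterS inner_of_iso => z; exact.
Qed.

(** The image of the Hardy space under the isometric multiplication is closed,
    so it is enough to test it against orthogonal vectors. *)
Lemma inner_of_onto (f : L2t VE) : hardy_orth f ->
  exists2 h : L2t VS, h2 h &
    {ae mu, forall z, f z = mulop inner_of_Linfty h z}.
Proof.
move=> Ff.
have cR := @clsub_image R (L2H VS) (L2H VE) (mulop inner_of_Linfty)
  (mulopP inner_of_Linfty) n2_mulop_inner _ (clsub_h2 VS).
have [h hh fh] : [set y | exists2 h, h2 h &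
    n2 (X := L2H VE) (y - mulop inner_of_Linfty h) = 0] f.
  apply: (@clsub_biorth R (L2H VE) _ _ cR) => u hu; apply: Phi_span => // h hh.
  apply: mulop_h2_orth hh => n x; apply: ipC_eq0.
  pose p := @hproj R XE b x.
  pose p1 : VS := ClSubElt (hproj_span ob x : p \in clsub_pred E1).
  rewrite -(hu (mulop inner_of_Linfty (zp n p1))); last first.
    by exists (zp n p1); [exact: h2_zp|rewrite subrr (@n2_0 R (L2H VE))].
  apply/eqP; rewrite -subr_eq0 -ipBr; apply/eqP.
  apply: (@n2_eq0r R (L2H VE)); apply: ae_l2n2.
  apply: filterS Phi_iso => z iso; rewrite l2B !mulop_zp_val -scalerBr.
  rewrite -[inner_of z p1]/(Phi z p) -(LinftyB LPhi).
  suff -> : Phi z (x - p) = 0 by rewrite scaler0.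
  apply: vn2_eq0; rewrite /vn2 iso.
  have -> : dotp (x - p) (@hproj R XE b (x - p)) = 0.
    apply: (@ipC_eq0 R XE); apply: (@ip_hsum_orth R XE) => //; first exact: sqsum_ip.
    by move=> i; apply: (@ipC_eq0 R XE); exact: ip_hproj.
  by [].
exists h => //; apply: filterS (l2n2_eq0 fh) => z /eqP.
by rewrite l2B subr_eq0 => /eqP.
Qed.

Lemma rangeH2_inner (f : L2t VE) : rangeH2 inner_of (l2fun f) <-> hardy_orth f.
Proof.
split=> [[hf [h hh fh]]|Ff].
  pose h' : L2t VS := toL2 (proj1 hh : L2 VS h).
  apply: (@nclosed_null R (L2H VE) _ f (mulop inner_of_Linfty h')).
  - exact: (proj2 clsub_hardy_orth).
  - apply: ae_l2n2; apply: filterS fh => z /(_ I) fz.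
    by rewrite l2B fz; exact: subrr.
  - exact: inner_of_in.
split; first by case: Ff.
have [h hh fh] := inner_of_onto Ff; exists (l2fun h) => //.
by apply: filterS fh => z fz _.
Qed.

(** The Fourier coefficients of [<Theta(z) x, q(z)>] are the inner products of
    a function of [hardy_orth] with [z ^ n q], which belongs to [Q] for every
    integer [n]. *)
Lemma inner_of_orth (q : L2t VE) : Q q ->
  {ae mu, forall z, forall x, dotp (inner_of z x) (q z) = 0}.
Proof.
move=> Qq.
have Qi n : Q (iter n (@zmul R VE) q) /\ Q (iter n (@zmulJ R VE) q).
  by elim: n => [//|n [h1 h2']]; split; [exact: Qz|exact: QzJ].
have hi i : {ae mu, forall z, dotp (inner_of z (basis VS i)) (q z) = 0}.
  pose f := mulop inner_of_Linfty (zp 0 (basis VS i)).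
  have fE z : f z = inner_of z (basis VS i).
    by rewrite mulop_zp_val expr0 scale1r.
  have [hf fQ] : hardy_orth f by apply: inner_of_in; exact: h2_zp.
  suff h : {ae mu, forall z, dotp (f z) (q z) = 0}.
    by apply: filterS h => z; rewrite fE.
  apply: fourier_unique => [|n]; first exact: dot_cintegrable.
  split.
    rewrite -[RHS](fQ _ (proj2 (Qi n))) -ip_iter_zmul.
    by congr cintegral; apply/funext => z; rewrite iter_zmulE dotpZl.
  rewrite -[RHS](fQ _ (proj1 (Qi n))).
  by congr cintegral; apply/funext => z; rewrite iter_zmulE dotpZr rmorphXn.
have := ae_foralln hi; apply: filterS => z hz x.
have l1 := Linfty_cvg inner_of_Linfty z (@basis_cvg R VS x).
rewrite -[LHS]/(@ip R XE (inner_of z x) (q z)).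
apply: (ip_lim l1 (ncvg_cst (q z : XE))).
apply: nearW => n; rewrite /fsum.
have -> := @Linfty_sum R VS VE inner_of inner_of_Linfty z n
  (fun i => dotp x (basis VS i) *: basis VS i).
rewrite ip_suml big1// => i _; rewrite (LinftyZ inner_of_Linfty) ipZl.
by rewrite [X in _ * X](hz i) mulr0.
Qed.

(** If [inner_of = Theta1 * Delta] then every [Theta1 e] belongs to
    [hardy_orth], that is, to the range of [inner_of]; hence the constant [e]
    is [Delta h] with [h] in the Hardy space, and [h] is the pointwise adjoint
    of [Delta] applied to [e]. So the entries of [Delta] are analytic together
    with their conjugates. *)
Lemma inner_of_extremal : right_extremal inner_of.
Proof.
move=> [ Theta1 [Delta [[_ HT adT] [HD adD] ncD dec]]]; apply: ncD.
have LT : Linfty VS VE Theta1 := proj1 HT.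
have LD : Linfty VS VS Delta := proj1 HD.
have coan (e : V1) : exists2 h : L2t VS, h2 h &
    {ae mu, forall z, adj (Delta z) e = h z}.
  pose f := mulop LT (zp 0 (e : VS)).
  have fE z : f z = Theta1 z e by rewrite mulop_zp_val expr0 scale1r.
  have Ff : hardy_orth f.
    split; first by apply: h2_mulop => //; exact: h2_zp.
    move=> q Qq.
    rewrite -[RHS](@ip0l R (L2H VE) q).
    transitivity (cintegral (fun _ : circle R => 0 : R[i])); last first.
      by rewrite ip0l cintegral0.
    apply: ae_eq_cintegral; first by apply: cmeasurable_dot; exact: l2_wm.
      exact: cmeasurable_cst.
    apply: filterS3 dec adD (inner_of_orth Qq) => z decz adDz oz.
    by rewrite fE -{1}(proj2 (adDz e)) -decz oz.
  have [h hh fh] := inner_of_onto Ff; exists h => //.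
  apply: filterS3 fh (filterI dec adD) adT => z fz [decz adDz] adTz.
  have : Theta1 z e = Theta1 z (Delta z (h z)) by rewrite -decz -fE fz.
  by move=> /(congr1 (adj (Theta1 z))); rewrite !adTz => ->; case: (adDz (h z)).
have cst (e e' : V1) : {ae mu, forall z, dotp (Delta z e') e =
    cintegral (fun z => dotp (Delta z e') e)}.
  have [h hh ah] := coan e.
  have ci : cintegrable (fun z => dotp (Delta z e') e).
    have := dot_cst_cintegrable (mulop LD (zp 0 (e' : VS))) (e : VS).
    by congr cintegrable; apply/funext => z; rewrite mulop_zp_val expr0 scale1r.
  apply: fourier_constant => // [n|n]; first exact: (proj2 HD).
  have /h2E/(_ n (e' : VS)) hn := hh.
  transitivity (cintegral (fun z => (cval z ^+ n.+1 * dotp (h z) e')^*)).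
    apply: ae_eq_cintegral.
    - apply: cmeasurableM; last exact: cintegrable_meas ci.
      exact: cmeasurable_cvalJX.
    - apply: cmeasurableJ; apply: cmeasurableM; first exact: cmeasurable_cvalX.
      exact: (l2_wm h).
    - apply: filterS2 ah adD => z hz adDz.
      rewrite rmorphM /= rmorphXn /=; congr (_ * _).
      rewrite (adj_fixed _ (proj2 (adDz e))); last exact: (Linfty0 LD).
      by rewrite hz dotpC.
  rewrite cintegralJ; last exact/cintegrable_cvalXM/dot_cst_cintegrable.
  by rewrite -ip_zn hn rmorph0.
pose c i j := cintegral (fun z => dotp (Delta z (basis VS j)) (basis VS i)).
have aec : {ae mu, forall z, forall i j,
    dotp (Delta z (basis VS j)) (basis VS i) = c i j}.
  by apply: ae_foralln => i; apply: ae_foralln => j; exact: cst.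
have [z0 hz0] : exists z0, forall i j,
    dotp (Delta z0 (basis VS j)) (basis VS i) = c i j := ae_exists aec.
exists (Delta z0); apply: filterS aec => z hz x.
have eb j : Delta z (basis VS j) = Delta z0 (basis VS j).
  by apply: (@dotp_basis R VS) => i; rewrite [LHS]hz [RHS]hz0.
pose s := @fsum R (vecH VS) (@basis R VS) (fun i => dotp x (basis VS i)).
have l1 := Linfty_cvg LD z (@basis_cvg R VS x).
have l2 := Linfty_cvg LD z0 (@basis_cvg R VS x).
apply/eqP; rewrite -subr_eq0; apply/eqP/(@vn2_eq0 R V1).
apply: (@ncvg_unique R (vecH VS) (fun n => Delta z (s n))) => //.
rewrite (_ : (fun n => _) = fun n => Delta z0 (s n))//.
apply/funext => n; rewrite /s /fsum.
have h1 := @Linfty_sum R VS VS Delta LD z n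
  (fun i => dotp x (basis VS i) *: basis VS i).
have h2 := @Linfty_sum R VS VS Delta LD z0 n
  (fun i => dotp x (basis VS i) *: basis VS i).
rewrite h1 h2; apply: eq_bigr => i _.
by rewrite !(LinftyZ LD) eb.
Qed.

End InnerFunction.

(** The set [hardy_orth Q] is shift-invariant and its reducing part is null, so
    the Beurling-Lax-Halmos theorem describes it by its symbol alone. *)
Lemma hardy_orth_range (R : realType) (E : hilbertType R)
    (sepE : separable_space E) (Q : set (L2t (sep_of_hilbert sepE))) :
  (forall q, Q q -> Q (zmul q)) -> (forall q, Q q -> Q (zmulJ q)) ->
  exists (E1 : clsubspace E) (Theta : circle R -> clsub_type E1 -> E),
  [/\ Hinfty (clsub_type E1) E Theta,
      zero_symbol Theta \/ (left_inner Theta /\ right_extremal Theta) &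
      forall f : L2t (sep_of_hilbert sepE),
        rangeH2 Theta (l2fun f) <-> hardy_orth Q f].
Proof.
move=> Qz QzJ; have [b [Phi [LPhi [ob Phi_le Phi_iso Phi_in Phi_span]]]] :=
  beurling (clsub_hardy_orth Q) (zinvariant_hardy_orth QzJ).
have Phi_span' u : (forall h, h2 h -> ip (s := L2H (sep_of_hilbert sepE)) (mulop LPhi h) u = 0) ->
    forall f, hardy_orth Q f -> ip (s := L2H (sep_of_hilbert sepE)) f u = 0.
  apply: Phi_span => m mred; apply: (@n2_eq0l R (L2H (sep_of_hilbert sepE))).
  apply: ae_l2n2; apply: h2_reducing_null => n.
  by case: (mred n).
have HT := inner_of_Hinfty ob Phi_le Phi_in.
exists (span_sub sepE b), (inner_of Phi (b := b)); split=> //; last first.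
  exact: (rangeH2_inner ob Phi_le Phi_iso Phi_in Phi_span').
have [[x x0]|n0] := pselect (exists x : clsub_type (span_sub sepE b), x != 0).
  right; split; last exact: (inner_of_extremal Qz QzJ ob Phi_le Phi_iso Phi_in Phi_span').
  by split=> //; [exists x|exact: inner_of_adj].
left; apply: aeW => z x.
have -> : x = 0.
  by apply/eqP; apply: contraT => x0; case: n0; exists x.
exact: (Linfty0 LPhi z).
Qed.

(** * The symbol and the inner function of an invariant subspace *)

Section Blocks.
Context (R : realType) (U V W W' : innerType R) (Phi : circle R -> V -> W).
Context (i : U -> V) (q : W -> W') (q' : W' -> W).
Hypothesis LPhi : Linfty V W Phi.
Hypotheses (iP : forall a x y, i (a *: x + y) = a *: i x + i y)
           (qP : forall a x y, q (a *: x + y) = a *: q x + q y).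
Hypotheses (i_le : forall x, hnorm (i x) <= hnorm x)
           (q_le : forall y, hnorm (q y) <= hnorm y).
Hypothesis qq' : forall y w, dotp (q y) w = dotp y (q' w).

(** Used for the entries of an operator matrix: [i] is the injection of a summand,
    [q] the projection onto one and [q'] its adjoint. *)
Lemma Linfty_block : Linfty U W' (fun z x => q (Phi z (i x))).
Proof.
case: LPhi => bP mP [B hB].
have le_block M z x : (forall y, hnorm (Phi z y) <= M * hnorm y) ->
    hnorm (q (Phi z (i x))) <= `|M| * hnorm x.
  move=> hM; apply: le_trans (q_le _) _; apply: le_trans (hM _) _.
  apply: le_trans (ler_wpM2r (hnorm_ge0 _) (ler_norm M)) _.
  exact: ler_wpM2l.
split.
- move=> z; have [lP [M hM]] := bP z; split=> [a x y|]; first by rewrite iP lP qP.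
  by exists `|M| => x; exact: le_block.
- by move=> x y; under eq_fun do rewrite qq'; exact: mP.
- by exists `|B|; apply: filterS hB => z hz x; exact: le_block.
Qed.

End Blocks.

Lemma orthoproj_span (R : realType) (V : sepHilbert R) (b : nat -> V) (x : V) :
  @onz R (vecH V) b -> orthoproj [set` span_pred b] x = @hproj R (vecH V) b x.
Proof.
move=> ob; have [_ sP] := span_submod b.
have hs := hproj_span (V := V) ob x; set p := @hproj R (vecH V) b x in hs *.
have po s : s \in span_pred b -> dotp (x - p) s = 0.
  by move=> hs'; rewrite linearBl /= dotpC (dotpC p) (dotp_hproj (V := V) ob x hs') subrr.
rewrite /orthoproj; case: xgetP => [y _ /= [ys yo]|/(_ p)[]//].
have ds : y - p \in span_pred b by rewrite addrC -scaleN1r; exact: sP.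
have e : (x - p) - (x - y) = y - p by rewrite opprB addrC addrA subrK.
apply/eqP; rewrite -subr_eq0; apply/eqP/vn2_eq0.
by rewrite /vn2 -[X in dotp X _]e linearBl /= po// yo// subrr.
Qed.

Section SymbolOfPairs.
Context (R : realType) (E F : hilbertType R).
Hypotheses (sepE : separable_space E) (sepF : separable_space F).
Local Notation VE := (sep_of_hilbert sepE).
Local Notation VF := (sep_of_hilbert sepF).
Local Notation VP := (sep_prod VE VF).
Variables (Phi : circle R -> VP -> VP) (LPhi : Linfty VP VP Phi).

Let inlP a (x y : E) : ((a *: x + y, 0) : E * F) = a *: (x, 0) + (y, 0).
Proof. by congr pair; rewrite /= scaler0 addr0. Qed.

Let inrP a (x y : F) : ((0, a *: x + y) : E * F) = a *: (0, x) + (0, y).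
Proof. by congr pair; rewrite /= scaler0 addr0. Qed.

Let inl_le (x : E) : hnorm ((x, 0) : E * F) <= hnorm x.
Proof. by rewrite /hnorm /= /prod_dotp /= linear0l addr0. Qed.

Let inr_le (x : F) : hnorm ((0, x) : E * F) <= hnorm x.
Proof. by rewrite /hnorm /= /prod_dotp /= linear0l add0r. Qed.

Let fst_le (p : E * F) : hnorm p.1 <= hnorm p.
Proof.
by rewrite ler_sqrt ?dotp_Re_ge0// -[leRHS]/(vn2 (V := VP) p) prod_vn2E lerDl dotp_Re_ge0.
Qed.

Let snd_le (p : E * F) : hnorm p.2 <= hnorm p.
Proof.
by rewrite ler_sqrt ?dotp_Re_ge0// -[leRHS]/(vn2 (V := VP) p) prod_vn2E lerDr dotp_Re_ge0.
Qed.

Let fst_dot (p : E * F) (x : E) : dotp p.1 x = dotp p ((x, 0) : E * F).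
Proof. exact/esym/(dotp_fst (V := VE) (W := VF)). Qed.

Let snd_dot (p : E * F) (x : F) : dotp p.2 x = dotp p ((0, x) : E * F).
Proof. exact/esym/(dotp_snd (V := VE) (W := VF)). Qed.

Definition blockC z (e : E) : E := (Phi z (e, 0)).1.
Definition blockD z (f : F) : E := (Phi z (0, f)).1.
Definition blockA z (e : E) : F := (Phi z (e, 0)).2.
Definition blockB z (f : F) : F := (Phi z (0, f)).2.

Lemma blockC_Linfty : Linfty E E blockC.
Proof. exact: (@Linfty_block R E (E * F)%type (E * F)%type E Phi _ _ _ LPhi inlP (fun _ _ _ => erefl) inl_le fst_le fst_dot). Qed.

Lemma blockD_Linfty : Linfty F E blockD.
Proof. exact: (@Linfty_block R F (E * F)%type (E * F)%type E Phi _ _ _ LPhi inrP (fun _ _ _ => erefl) inr_le fst_le fst_dot). Qed.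

Hypothesis Phi_snd : forall h, h2 h -> h2 (sndL (mulop LPhi h)).

Let snd_h2 (p : VP) n (y : F) :
  cintegral (fun z => cval z ^+ n.+1 * dotp (Phi z p).2 y) = 0.
Proof.
have /h2E h := Phi_snd (h2_zp 0 p).
rewrite -[RHS](h n y) ip_zn; congr cintegral; apply/funext => z.
by congr (_ * dotp _ _); rewrite [RHS]/= expr0 scale1r.
Qed.

Lemma blockA_Hinfty : Hinfty E F blockA.
Proof.
split=> [|n x y]; last exact: snd_h2.
exact: (@Linfty_block R E (E * F)%type (E * F)%type F Phi _ _ _ LPhi inlP (fun _ _ _ => erefl) inl_le snd_le snd_dot).
Qed.

Lemma blockB_Hinfty : Hinfty F F blockB.
Proof.
split=> [|n x y]; last exact: snd_h2.
exact: (@Linfty_block R F (E * F)%type (E * F)%type F Phi _ _ _ LPhi inrP (fun _ _ _ => erefl) inr_le snd_le snd_dot).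
Qed.

Definition block_symbol : Lambda E F :=
  MkLambda blockC_Linfty blockD_Linfty blockA_Hinfty blockB_Hinfty.

Lemma block_symbolE z p : symbol block_symbol z p = Phi z p.
Proof.
case: p => e f; rewrite /symbol /=.
have -> : (e, f) = (e, 0) + (0, f) :> VP.
  by congr pair; rewrite /= ?addr0 ?add0r.
by have := Linfty_lin LPhi z 1 (e, 0) (0, f); rewrite !scale1r => ->.
Qed.

Lemma kerW_block (f : L2t VE) (g : L2t VF) : h2 f -> h2 g ->
  kerW block_symbol (l2fun f, l2fun g) <->
  forall h, h2 h -> ip (s := L2H VP) (mulop LPhi h) (pairL (flipL f) g) = 0.
Proof.
move=> hf hg; apply: iff_trans (kerWP block_symbol hf hg) _.
have h20 (V : sepHilbert R) : h2 (0 : L2t V) by case: (proj1 (clsub_h2 V)).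
have pl (h : L2t VE) : mulop LPhi (pairL h 0) =
    pairL (mulop (blockC_Linfty : Linfty VE VE _) h)
          (mulop (proj1 blockA_Hinfty : Linfty VE VF _) h).
  by apply: L2_ext => z; rewrite /= /blockC /blockA; case: (Phi _ _).
have pr (h : L2t VF) : mulop LPhi (pairL 0 h) =
    pairL (mulop (blockD_Linfty : Linfty VF VE _) h)
          (mulop (proj1 blockB_Hinfty : Linfty VF VF _) h).
  by apply: L2_ext => z; rewrite /= /blockD /blockB; case: (Phi _ _).
split=> [[k1 k2] h hh|k].
  have -> : h = pairL (fstL h) 0 + pairL 0 (sndL h).
    apply: L2_ext => z; rewrite l2D /=; case: (h z) => x y /=.
    by congr pair; rewrite /= ?addr0 ?add0r.
  rewrite -[X in mulop LPhi (X + _)]scale1r mulopP scale1r pl pr ipDl !ip_pairL.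
  rewrite !fst_pairL !snd_pairL [X in X + _](k1 _ (h2_fst hh)).
  by rewrite [X in _ + X](k2 _ (h2_snd hh)) addr0.
split=> h hh.
  rewrite -[RHS](k (pairL h 0)) ?pl ?ip_pairL ?fst_pairL ?snd_pairL//.
  exact: h2_pair.
rewrite -[RHS](k (pairL 0 h)) ?pr ?ip_pairL ?fst_pairL ?snd_pairL//.
exact: h2_pair.
Qed.

(** [Phi z] is isometric on the span of [b] and vanishes on its complement, so
    its adjoint times itself is the projection [hproj b]. *)
Lemma block_partial_isometry (b : nat -> VP) : @onz R (vecH VP) b ->
  {ae (@circle_mu R), forall z, forall x y,
    dotp (Phi z x) (Phi z y) = dotp x (@hproj R (vecH VP) b y)} ->
  partial_isometry_valued block_symbol.
Proof.
move=> ob iso.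
exists (ClSubspace (span_submod b) (@closed_span_prod R E F sepE sepF b)).
apply: filterS iso => z iso p.
transitivity (@hproj R (vecH VP) b p); last exact: (esym (@orthoproj_span R VP b p ob)).
by apply: adj_eq => u; rewrite !block_symbolE iso.
Qed.

End SymbolOfPairs.

(** * Invariant subspaces *)

Section HalfFlip.
Context (R : realType) (V W : sepHilbert R).
Local Notation VW := (sep_prod V W).
Local Notation "'[ f , g ]" := (ip (s := L2H VW) f g).
Implicit Types (p q m : L2t VW).

Definition half_flip p : L2t VW := pairL (flipL (fstL p)) (sndL p).

Lemma half_flip_isometry p q : '[half_flip p, half_flip q] = '[p, q].
Proof. by rewrite ip_pairL fst_pairL snd_pairL ip_flip2 [RHS]ip_pair. Qed.

Variable K : set (L2t VW).
Hypothesis cK : @clsub R (L2H VW) K.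
Hypothesis K_h2 : forall p, K p -> h2 p.
Hypothesis K_inv : forall p, K p -> exists2 q, K q &
  fstL q = zmul (fstL p) /\ forall h, h2 h ->
    ip (s := L2H W) (zmul h) (sndL p) = ip (s := L2H W) h (sndL q).

(** The second component is confined to the Hardy space so that the reducing
    part has no second component. *)
Definition flipped_compl : set (L2t VW) :=
  [set m | h2 (sndL m) /\ forall p, K p -> '[m, half_flip p] = 0].

Lemma clsub_flipped_compl : @clsub R (L2H VW) flipped_compl.
Proof.
have := clsubI
  (@clsub_preimage R (L2H VW) (L2H W) (@sndL R V W) 1 (@sndLP R V W)
    (@n2_snd_le R V W) _ (clsub_h2 W))
  (@clsub_orth R (L2H VW) [set half_flip p | p in K]).
congr clsub; apply/seteqP; split=> m [hm h]; split=> //.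
  by move=> p Kp; apply: h; exists p.
by move=> _ [p Kp <-]; exact: h.
Qed.

(** The flip turns the shift of the first component into the adjoint of
    multiplication by [z]; on the second component the adjoint of the shift is
    already there, up to the projection onto the Hardy space. *)
Lemma zinvariant_flipped_compl : zinvariant flipped_compl.
Proof.
move=> m [hm mK]; split; first by rewrite snd_zmul; exact: h2_zmul.
move=> p Kp; have [q Kq [q1 q2]] := K_inv Kp.
rewrite -[RHS](mK q Kq) !ip_pairL fst_zmul snd_zmul q1 flip_zmul -ip_zmul.
by rewrite -q2.
Qed.

(** The half flip of the difference of [p] and its projection onto [K] belongs to
    the complement. *)
Lemma flipped_compl_orth p : h2 p ->
  (forall m, flipped_compl m -> '[m, half_flip p] = 0) -> K p.
Proof.
move=> hp pM; have [y Ky py] := @proj_exists R (L2H VW) _ p cK.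
have hr : h2 (p - y).
  by apply: (@subspB R (L2H VW)) => //; [exact: (proj1 (clsub_h2 VW))|exact: K_h2].
have r0 : '[p - y, p] = 0.
  rewrite -half_flip_isometry; apply: pM; split.
    by rewrite snd_pairL; exact: h2_snd.
  by move=> k Kk; rewrite half_flip_isometry; exact: py.
apply: (@nclosed_null R (L2H VW) K p y (proj2 cK)) (Ky).
by rewrite /n2 ipBr r0 py// subrr.
Qed.

Lemma reducing_snd_null m : reducing_part flipped_compl m ->
  {ae (@circle_mu R), forall z, sndL m z = 0}.
Proof.
move=> mred; apply: h2_reducing_null => n.
have -> : iter n (@zmulJ R W) (sndL m) = sndL (iter n (@zmulJ R VW) m).
  by elim: n => //= n ->; rewrite snd_zmulJ.
by case: (mred n).
Qed.

(** It is stable under multiplication by [z] and by its conjugate, so that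
    orthogonality to it is a pointwise condition on the first component. *)
Definition reducing_flip : set (L2t V) :=
  [set flipL (fstL m) | m in reducing_part flipped_compl].

Lemma reducing_flip_zmul (q : L2t V) : reducing_flip q -> reducing_flip (zmul q).
Proof.
move=> [m mred <-]; exists (zmulJ m); first exact: reducing_zmulJ.
by rewrite fst_zmulJ flip_zmulJ.
Qed.

Lemma reducing_flip_zmulJ (q : L2t V) : reducing_flip q -> reducing_flip (zmulJ q).
Proof.
move=> [m mred <-]; exists (zmul m).
  by apply: reducing_zmul => //; exact: zinvariant_flipped_compl.
by rewrite fst_zmul flip_zmul.
Qed.

Lemma reducing_orth p : (forall m, reducing_part flipped_compl m ->
    '[m, half_flip p] = 0) <->
  (forall q : L2t V, reducing_flip q -> ip (s := L2H V) (fstL p) q = 0).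
Proof.
have E m : reducing_part flipped_compl m ->
    '[m, half_flip p] = ip (s := L2H V) (flipL (fstL m)) (fstL p).
  move=> mred; rewrite ip_pairL ip_flip.
  by rewrite [X in _ + X](@n2_eq0l R (L2H W)) ?addr0//; exact/ae_l2n2/reducing_snd_null.
split=> [h _ [m mred <-]|h m mred].
  by apply: ipC_eq0; rewrite -E//; exact: h.
by rewrite E//; apply: ipC_eq0; apply: h; exists m.
Qed.

End HalfFlip.

Section Model.
Context (R : realType) (E F : hilbertType R).
Variables (sepE : separable_space E) (sepF : separable_space F).
Local Notation VE := (sep_of_hilbert sepE).
Local Notation VF := (sep_of_hilbert sepF).
Local Notation VP := (sep_prod VE VF).

(** The half flip of [p] is orthogonal to the complement of [K] if and only if it
    is orthogonal to the reducing part, which is the condition on [Theta], and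
    to the image of the Hardy space under the symbol, which is the condition on
    the kernel. *)
Lemma invariant_model (K : set (L2t VP)) :
  @clsub R (L2H VP) K -> (forall p, K p -> h2 p) ->
  (forall p, K p -> exists2 q, K q &
    fstL q = zmul (fstL p) /\ forall h, h2 h ->
      ip (s := L2H VF) (zmul h) (sndL p) = ip (s := L2H VF) h (sndL q)) ->
  exists Psi : Lambda E F, partial_isometry_valued Psi /\
    exists (E1 : clsubspace E) (Theta : circle R -> clsub_type E1 -> E),
      [/\ Hinfty (clsub_type E1) E Theta,
          zero_symbol Theta \/ (left_inner Theta /\ right_extremal Theta) &
          forall p, h2 p -> K p <->
            kerW Psi (l2fun (fstL p), l2fun (sndL p)) /\
            rangeH2 Theta (l2fun (fstL p))].
Proof.
move=> cK K_h2 K_inv; pose M := flipped_compl K.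
have [b [Phi [LPhi [ob _ iso Phi_in Phi_span]]]] :=
  beurling (clsub_flipped_compl K) (zinvariant_flipped_compl K_inv).
have Phi_snd h : h2 h -> h2 (sndL (mulop LPhi h)).
  by move=> /Phi_in [].
exists (block_symbol Phi_snd); split; first exact: block_partial_isometry iso.
have [E1 [ Theta [HT innT rT]]] := hardy_orth_range
  (@reducing_flip_zmul R VE VF K) (reducing_flip_zmulJ K_inv).
exists E1, Theta; split=> // p hp.
have hf := h2_fst hp; have hg := h2_snd hp.
split=> [Kp|[/(kerW_block Phi_snd hf hg) kp /rT [_ /reducing_orth rp]]].
  split.
    by apply/(kerW_block Phi_snd hf hg) => h hh; case: (Phi_in h hh) => _; exact.
  apply/rT; split=> //; apply/reducing_orth => m mred.
  by case: (mred 0%N) => _; exact.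
apply: (flipped_compl_orth cK K_h2 hp); exact: Phi_span.
Qed.

End Model.

Theorem theorem1p1 (R : realType) (E F : hilbertType R)
    (sepE : separable_space E) (sepF : separable_space F)
    (N : set ((circle R -> E) * (circle R -> F)))
    (hN : closed_subspace_H2 N) :
  invariant_shift N <->
  exists Psi : Lambda E F,
    (zero_symbol (symbol Psi) \/ partial_isometry_valued Psi) /\
    exists (E1 : clsubspace E) (Theta : circle R -> clsub_type E1 -> E),
      [/\ Hinfty (clsub_type E1) E Theta,
          zero_symbol Theta \/ (left_inner Theta /\ right_extremal Theta) &
          N = kerW Psi `&` [set p | rangeH2 Theta p.1 /\ H2 F p.2]].
Proof.
pose VE := sep_of_hilbert sepE; pose VF := sep_of_hilbert sepF.
pose VP := sep_prod VE VF.
case: hN => N_h2 N0 NP Ncl; split=> [Ninv|]; last first.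
  move=> [Psi [_ [E1 [ Theta [HT _ NE]]]]] [f g] Nfg.
  have := Nfg; rewrite {1}NE => -[kfg [rf hg]].
  have hf := proj1 rf.
  pose f' : L2t VE := toL2 (proj1 hf : L2 VE f).
  pose g' : L2t VF := toL2 (proj1 hg : L2 VF g).
  have [k [kE hk gk]] := adj_shift_spec g'.
  have -> : adjH2 (@Defs.shift R F) g = l2fun k by exact: kE.
  rewrite NE; split; last first.
    by split; [exact: rangeH2_shift|exact: hk].
  exact: (@kerW_invariant R E F sepE sepF Psi f' g' k).
pose K : set (L2t VP) := [set p : L2t VP | N (l2fun (fstL p), l2fun (sndL p))].
have K_h2 p : K p -> h2 p.
  move=> /N_h2 [h1 h2']; rewrite -[p]pairL_eta.
  by apply: h2_pair; [exact: h1|exact: h2'].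
have cK : @clsub R (L2H VP) K.
  split; first split.
  - exact: N0.
  - by move=> a p q Kp Kq; exact: NP Kp Kq.
  - move=> p hp; have hp2 : h2 p.
      by apply: (proj2 (clsub_h2 VP)) => e /hp [q Kq pq]; exists q => //; exact: K_h2.
    apply: Ncl => [||e e0]; [exact: (h2_fst hp2)|exact: (h2_snd hp2)|].
    have [q Kq pq] := hp e e0.
    exists (l2fun (fstL q), l2fun (sndL q)) => //=.
    have -> : sqrL2norm (l2fun (fstL p) - l2fun (fstL q))%R =
        (n2 (X := L2H VE) (fstL (p - q)))%:E by exact: (sqrL2norm_l2 (fstL (p - q))).
    have -> : sqrL2norm (l2fun (sndL p) - l2fun (sndL q))%R =
        (n2 (X := L2H VF) (sndL (p - q)))%:E by exact: (sqrL2norm_l2 (sndL (p - q))).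
    by rewrite -EFinD lte_fin -n2_pair.
have K_inv p : K p -> exists2 q, K q & fstL q = zmul (fstL p) /\
    forall h, h2 h -> ip (s := L2H VF) (zmul h) (sndL p) = ip (s := L2H VF) h (sndL q).
  move=> /Ninv; have [k [kE hk gk]] := adj_shift_spec (sndL p) => Kq.
  exists (pairL (zmul (fstL p)) k); last by rewrite fst_pairL snd_pairL.
  move: Kq; rewrite -[adjH2 _ _]/(adjH2 (@Defs.shift R F) (l2fun (sndL p))) kE.
  by rewrite /K /mkset fst_pairL snd_pairL.
have [Psi [pPsi [E1 [ Theta [HT iT KE]]]]] := invariant_model cK K_h2 K_inv.
exists Psi; split; first by right.
exists E1, Theta; split=> //; apply/seteqP; split=> [[f g] Nfg|[f g] [kfg [rf hg]]].
  have [hf hg] := N_h2 _ Nfg.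
  pose p : L2t VP := pairL (toL2 (proj1 hf : L2 VE f)) (toL2 (proj1 hg : L2 VF g)).
  have hp : h2 p by apply: h2_pair.
  by have [/(_ Nfg) [k1 k2] _] := KE p hp.
have hf := proj1 rf.
pose p : L2t VP := pairL (toL2 (proj1 hf : L2 VE f)) (toL2 (proj1 hg : L2 VF g)).
have hp : h2 p by apply: h2_pair.
by have [_ h] := KE p hp; exact: h.
Qed.
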